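(* Let $m>0$ and let $\eta^\circ$ be the Lévy exponent of an $\alpha$-stable Lévy process in $\mathbb{R}^d$, $0<\alpha\le2$. For each $N\ge2$ consider the symmetric $N$-component synchronization model (defined in the context) with Lévy exponent $\eta^\circ$ and exponential inter-event distribution $F(s)=1-\exp(-s/m)$ for $s\ge0$ ($F(s)=0$ for $s<0$), and let $d^{(N)}_{jk}(\infty)$ be a random vector having the limit distribution, as $t\to\infty$, of $d^{(N)}_{jk}(t)=x_j(t)-x_k(t)$, $j\neq k$. Then the distribution of the rescaled difference $d^{(N)}_{jk}(\infty)/(N-1)^{1/\alpha}$ does not depend on $N$ (it is the same for every $N\ge2$).
   Context: Model (symmetric synchronization model). Fix integers $N\ge2$, $d\ge1$. (Free dynamics) $x_1^\circ,\dots,x_N^\circ$ are independent Lévy processes in $\mathbb{R}^d$ (started at $0$, independent stationary increments, stochastically continuous) with a common Lévy exponent $\eta^\circ:\mathbb{R}^d\to\mathbb{C}$, i.e. $\mathsf{E}\exp(i\langle\lambda,x_j^\circ(t)-x_j^\circ(s)\rangle)=e^{(t-s)\eta^\circ(\lambda)}$ for $0\le s\le t$. Write $x^\circ=(x_1^\circ,\dots,x_N^\circ)$. (Synchronization epochs) For $k=1,\dots,N$ let $0=\tau^{(k)}_0<\tau^{(k)}_1<\tau^{(k)}_2<\cdots$ be independent renewal sequences: the intervals $\Delta^{(k)}_n=\tau^{(k)}_n-\tau^{(k)}_{n-1}$, $n\ge1$, are i.i.d. with distribution function $F$, the same for all $k$. Let $0=T_0<T_1<T_2<\cdots$ be the superposition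 of these $N$ renewal sequences (a.s. no two share an epoch). (Synchronization jumps) If $T_q=\tau_n^{(j_1)}$ for some $n$, component $j_1$ sends at time $T_q$ a message to a component $j_2\ne j_1$ chosen independently and uniformly (probability $1/(N-1)$ each) among the other components; then $x_{j_2}(T_q+0)=x_{j_1}(T_q)$ and $x_j(T_q+0)=x_j(T_q)$ for $j\ne j_2$. (Dynamics) $x(t)=x(0)+x^\circ(t)-x^\circ(0)$ for $t\in[0,T_1]$; for $n\ge1$, $x(T_n+0)$ is given by the jump rule and $x(t)=x(T_n+0)+(x^\circ(t)-x^\circ(T_n+0))$ for $t\in(T_n,T_{n+1}]$. (Initial condition) $x(0)\in(\mathbb{R}^d)^N$ has a distribution invariant under permutations of the $N$ components. The free dynamics, the epochs together with the choices of recipients, and $x(0)$ are independent. By symmetry the law of $x_j(t)-x_k(t)$ is the same for all $j\ne k$; it converges weakly as $t\to\infty$. A random vector $U\in\mathbb{R}^d$ is $\alpha$-stable if there are nonrandom $D_n\in\mathbb{R}^d$ such that for each $n\in\mathbb{N}$ the sum of $n$ independent copies of $U$ has the same distribution as $n^{1/\alpha}U+D_n$. A Lévy process $(y(t))_{t\ge0}$ is called $\alpha$-stable if each $y(t)$ is $\alpha$-stable. *)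

(* Defs.v *)
From HB Require Import structures.
From mathcomp Require Import all_boot all_order all_algebra all_fingroup.
From mathcomp Require Import complex.
From mathcomp Require Import all_classical all_reals all_analysis.

Set Implicit Arguments.
Unset Strict Implicit.
Unset Printing Implicit Defensive.

Import Order.TTheory GRing.Theory Num.Theory.
Import numFieldNormedType.Exports.

Local Open Scope classical_set_scope.
Local Open Scope complex_scope.
Local Open Scope ring_scope.

Definition borel (E : topologicalType) : set (set E) := <<s (@open E) >>.

(* [X] generates a sigma-algebra on its domain once its codomain is given the
   sigma-algebra [G]. *)
Definition sigma_of (Omega E : Type) (G : set (set E)) (X : Omega -> E) :
    set (set Omega) :=
  preimage_set_system setT X G.

Section RandomElements.
Context (disp : measure_display) (Omega : measurableType disp) (R : realType).
Variable P : probability Omega R.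

Definition random_element (E : topologicalType) (X : Omega -> E) : Prop :=
  forall B, borel B -> measurable (X @^-1` B).

(* Joint independence of a family of classes of events. *)
Definition independent_family (I : eqType) (F : I -> set (set Omega)) : Prop :=
  forall (s : seq I) (A : I -> set Omega), uniq s ->
    (forall i, i \in s -> F i (A i)) ->
    P (\bigcap_(i in [set` s]) A i) = (\prod_(i <- s) P (A i))%E.

End RandomElements.

Definition same_law (R : realType) (E : topologicalType)
    (disp1 : measure_display) (Omega1 : measurableType disp1)
    (P1 : probability Omega1 R) (X1 : Omega1 -> E)
    (disp2 : measure_display) (Omega2 : measurableType disp2)
    (P2 : probability Omega2 R) (X2 : Omega2 -> E) : Prop :=
  forall B, borel B -> P1 (X1 @^-1` B) = P2 (X2 @^-1` B).

(* Weak convergence, as t -> +oo, of the law of [Y t] to the law of [Z]. *)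
Definition converges_in_law (R : realType) (E : topologicalType)
    (disp1 : measure_display) (Omega1 : measurableType disp1)
    (P1 : probability Omega1 R) (Y : R -> Omega1 -> E)
    (disp2 : measure_display) (Omega2 : measurableType disp2)
    (P2 : probability Omega2 R) (Z : Omega2 -> E) : Prop :=
  forall f : E -> R, continuous f -> (exists M, forall u, `|f u| <= M) ->
    (\int[P1]_w f (Y t w)) @[t --> +oo] --> \int[P2]_w f (Z w).

Definition cexp (R : realType) (z : R[i]) : R[i] :=
  (expR (complex.Re z) * cos (complex.Im z)) +i*
  (expR (complex.Re z) * sin (complex.Im z)).

Section LevyProcesses.
Context (R : realType) (d : nat).
Context (disp : measure_display) (Omega : measurableType disp).
Variable P : probability Omega R.

Definition inner (u v : 'rV[R]_d) : R := \sum_(i < d) u ord0 i * v ord0 i.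

(* E exp(i <lambda, X>) *)
Definition char_fun (X : Omega -> 'rV[R]_d) (lambda : 'rV[R]_d) : R[i] :=
  (\int[P]_w cos (inner lambda (X w))) +i* (\int[P]_w sin (inner lambda (X w))).

(* Processes are indexed by R; only times t >= 0 are meaningful. *)
Record levy_process (y : R -> Omega -> 'rV[R]_d) : Prop := LevyProcess {
  levy_random : forall t : R, 0 <= t -> random_element (E := 'rV[R]_d) (y t) ;
  levy_start : {ae P, forall w, y 0 w = 0} ;
  levy_independent : forall t : nat -> R, 0 <= t 0%N ->
    (forall n, t n <= t n.+1) ->
    independent_family P
      (fun n : nat => sigma_of (@borel 'rV[R]_d) (fun w => y (t n.+1) w - y (t n) w)) ;
  levy_stationary : forall s h : R, 0 <= s -> 0 <= h ->
    same_law (E := 'rV[R]_d) P (fun w => y (s + h) w - y s w) P (fun w => y h w - y 0 w) ;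
  levy_continuous : forall t e : R, 0 <= t -> 0 < e ->
    P [set w | e < `|y s w - y t w|] @[s --> within [set s | 0 <= s] (nbhs t)]
      --> 0%E
}.

Definition levy_exponent (eta : 'rV[R]_d -> R[i]) (y : R -> Omega -> 'rV[R]_d) :
    Prop :=
  forall (s t : R) lambda, 0 <= s -> s <= t ->
    char_fun (fun w => y t w - y s w) lambda = cexp ((t - s)%:C * eta lambda).

(* "n independent copies of U" are taken on an arbitrary probability space. *)
Definition stable_vector (alpha : R) (U : Omega -> 'rV[R]_d) : Prop :=
  exists D : nat -> 'rV[R]_d, forall n : nat, (0 < n)%N ->
    forall (disp' : measure_display) (Omega' : measurableType disp')
      (Q : probability Omega' R) (V : 'I_n -> Omega' -> 'rV[R]_d),
    (forall i, random_element (E := 'rV[R]_d) (V i)) ->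
    (forall i, same_law (E := 'rV[R]_d) Q (V i) P U) ->
    independent_family Q (fun i => sigma_of (@borel 'rV[R]_d) (V i)) ->
    same_law (E := 'rV[R]_d) Q (fun w => \sum_(i < n) V i w)
             P (fun w => n%:R `^ alpha^-1 *: U w + D n).

Definition stable_process (alpha : R) (y : R -> Omega -> 'rV[R]_d) : Prop :=
  forall t : R, 0 <= t -> stable_vector alpha (y t).

End LevyProcesses.

Section Paths.
Context (R : realType).

(* f(t+0) and f(t-0) *)
Definition rlim (m n : nat) (f : R -> 'M[R]_(m, n)) (t : R) : 'M[R]_(m, n) :=
  lim (f s @[s --> t^'+]).

Definition llim (m n : nat) (f : R -> 'M[R]_(m, n)) (t : R) : 'M[R]_(m, n) :=
  lim (f s @[s --> t^'-]).

(* One-sided limits exist and every value is one of them: this covers both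
   right-continuous paths with left limits and left-continuous paths with right
   limits. Stochastic continuity alone does not provide the
   right limits of the free paths at the epochs. *)
Definition regular_path (m n : nat) (f : R -> 'M[R]_(m, n)) : Prop :=
  (forall t : R, 0 <= t -> cvg (f s @[s --> t^'+])) /\
  (forall t : R, 0 < t -> cvg (f s @[s --> t^'-]) /\
                      (f t = rlim f t \/ f t = llim f t)).

(* The superposition is the increasing enumeration of all the epochs. *)
Definition superposition (N : nat) (tau : 'I_N -> nat -> R) (T : nat -> R) :
    Prop :=
  [/\ T 0%N = 0,
      forall q, T q < T q.+1
    & forall s, (exists2 q, (0 < q)%N & T q = s) <->
                (exists k n, (0 < n)%N /\ tau k n = s)].

(* Row j of the N x d matrix x(t) is x_j(t); [r k n] is the recipient of the
   message sent by k at its n-th epoch. *)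
Definition sync_dynamics (N d : nat) (x0 : R -> 'M[R]_(N, d))
    (tau : 'I_N -> nat -> R) (r : 'I_N -> nat -> 'I_N) (T : nat -> R)
    (x : R -> 'M[R]_(N, d)) : Prop :=
  [/\ forall t : R, 0 <= t -> t <= T 1%N -> x t = x 0 + x0 t - x0 0,
      forall q n j1, (0 < q)%N -> (0 < n)%N -> T q = tau j1 n ->
        row (r j1 n) (rlim x (T q)) = row j1 (x (T q)) /\
        (forall j, j != r j1 n -> row j (rlim x (T q)) = row j (x (T q)))
    & forall q (t : R), (0 < q)%N -> T q < t -> t <= T q.+1 ->
        x t = rlim x (T q) + (x0 t - rlim x0 (T q))].

End Paths.

(* A realization, on some probability space, of the symmetric N-component
   synchronization model in R^d with Levy exponent [eta] and inter-event
   distribution function [F]. The value [sm_recip k 0] plays no role. *)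
Record sync_model (R : realType) (N d : nat) (eta : 'rV[R]_d -> R[i])
    (F : R -> R) := SyncModel {
  sm_disp : measure_display ;
  sm_Omega : measurableType sm_disp ;
  sm_P : probability sm_Omega R ;

  sm_free : R -> sm_Omega -> 'M[R]_(N, d) ;
  sm_tau : 'I_N -> nat -> sm_Omega -> R ;
  sm_recip : 'I_N -> nat -> sm_Omega -> 'I_N ;
  sm_T : nat -> sm_Omega -> R ;
  sm_x : R -> sm_Omega -> 'M[R]_(N, d) ;

  sm_free_levy : forall j : 'I_N,
    levy_process sm_P (fun t w => row j (sm_free t w)) ;
  sm_free_exponent : forall j : 'I_N,
    levy_exponent sm_P eta (fun t w => row j (sm_free t w)) ;
  sm_free_regular : {ae sm_P, forall w, forall j : 'I_N,
    regular_path (fun t => row j (sm_free t w))} ;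
  sm_free_independent : independent_family sm_P (fun j : 'I_N =>
    <<s \bigcup_(t in [set t : R | 0 <= t])
          sigma_of (@borel 'rV[R]_d) (fun w => row j (sm_free t w)) >>) ;

  sm_tau_measurable : forall k n, measurable_fun setT (sm_tau k n) ;
  sm_tau_increasing : {ae sm_P, forall w, forall k,
    sm_tau k 0%N w = 0 /\ (forall n, sm_tau k n w < sm_tau k n.+1 w)} ;
  sm_interval_law : forall k n (s : R),
    sm_P [set w | sm_tau k n.+1 w - sm_tau k n w <= s] = (F s)%:E ;
  sm_recip_measurable : forall k n (S : set 'I_N),
    measurable (sm_recip k n @^-1` S) ;
  sm_recip_law : forall k n j, (0 < n)%N ->
    sm_P (sm_recip k n @^-1` [set j]) =
      (if j == k then 0 else (N.-1%:R)^-1)%:E ;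
  (* the intervals (inl) and the recipients (inr) are all independent *)
  sm_epochs_independent : independent_family sm_P
    (fun i : ('I_N * nat) + ('I_N * nat) =>
       match i with
       | inl (k, n) =>
           sigma_of measurable (fun w => sm_tau k n.+1 w - sm_tau k n w)
       | inr (k, n) => sigma_of setT (sm_recip k n.+1)
       end) ;
  sm_superposition : {ae sm_P, forall w,
    superposition (fun k n => sm_tau k n w) (fun q => sm_T q w)} ;
  sm_no_common_epoch : {ae sm_P, forall w, forall k k' n n',
    (0 < n)%N -> (0 < n')%N -> sm_tau k n w = sm_tau k' n' w -> k = k'} ;

  sm_x_random : forall t : R, 0 <= t ->
    random_element (E := 'M[R]_(N, d)) (sm_x t) ;
  sm_x_dynamics : {ae sm_P, forall w,
    sync_dynamics (fun t => sm_free t w) (fun k n => sm_tau k n w)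
      (fun k n => sm_recip k n w) (fun q => sm_T q w) (fun t => sm_x t w)} ;

  sm_x_exchangeable : forall sigma : 'S_N,
    same_law (E := 'M[R]_(N, d)) sm_P (fun w => row_perm sigma (sm_x 0 w)) sm_P (sm_x 0) ;

  sm_independent : independent_family sm_P (fun i : 'I_3 => tnth [tuple
    <<s \bigcup_(t in [set t : R | 0 <= t])
          sigma_of (@borel 'M[R]_(N, d)) (sm_free t) >> ;
    <<s (\bigcup_k \bigcup_n sigma_of measurable (sm_tau k n)) `|`
        (\bigcup_k \bigcup_(n in [set n | (0 < n)%N])
           sigma_of setT (sm_recip k n)) >> ;
    sigma_of (@borel 'M[R]_(N, d)) (sm_x 0) ] i)
}.

Definition sm_diff (R : realType) (N d : nat) (eta : 'rV[R]_d -> R[i])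
    (F : R -> R) (S : sync_model N eta F) (j k : 'I_N) (t : R)
    (w : sm_Omega S) : 'rV[R]_d :=
  row j (sm_x t w) - row k (sm_x t w).

Arguments sm_diff {R N d eta F} S j k t w.

Definition exponential_df (R : realType) (m : R) (s : R) : R :=
  if 0 <= s then 1 - expR (- s / m) else 0.

(* Main.v *)
Require Import Defs.
From HB Require Import structures.
From mathcomp Require Import all_boot all_order all_algebra all_fingroup.
From mathcomp Require Import complex.
From mathcomp Require Import all_classical all_reals all_analysis.
From mathcomp Require Import archimedean measurable_realfun lebesgue_measure.
From mathcomp Require Import ring lra zify.

(** Why the law of the rescaled difference does not depend on [N].

    Fix a direction [lam], put [theta = - 2 Re (eta lam)], and follow two components
    [j] and [k] backwards in time from a time [t]: whenever the component followed is
    the recipient of a message, the line jumps to the sender. While the two ancestral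
    lines sit at distinct components, the difference collects independent free
    increments, whose characteristic function at [lam] over a lapse [u] is
    exp (- theta u); once the lines have met they stay together and the difference
    collects nothing more. Every clock rings at rate [1 / m] and the message uses a
    given recipient with probability [1 / (N - 1)], so distinct lines meet at rate
    [beta = 2 / (m (N - 1))]. For large [t] the lines have met with probability close
    to 1, the initial condition is forgotten, and the characteristic function of
    [x_j(t) - x_k(t)] tends to the expectation of exp (- theta T) for an exponential
    time [T] of rate [beta], that is to [beta / (theta + beta)]. Stability, used for
    the sum of [N - 1] unit increments, says that dilating [lam] by
    [(N - 1) ^ (1 / alpha)] multiplies [Re (eta lam)] by [N - 1]; after the rescaling
    the characteristic function is [m^-1 / (m^-1 - Re (eta lam))], where [N] no longer
    appears, and characteristic functions determine laws.

    The meeting of the lines is computed without a Markov process. The evolution of the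
    epochs is split according to the finite history of the messages sent
    ([valid], [during]), and [coal_prob] adds up, over the histories for which the lines
    have met, the decay accumulated before they met. The compensation formula of
    the exponential clocks ([compensation]) gives a balance for each history
    ([balance], [entry_mass_cons]); summed over the histories of each length, these
    balances form a linear recursion whose solution is the Laplace transform of
    [coal_prob] ([laplace_coal_prob]).

    Along a history for which the lines have met, the difference is a sum of free increments
    between epochs ([dynamics_displacement]), and its characteristic function is the
    product of the decays, the epochs being independent of the free motion ([during_cos],
    [during_sin]). Since the right limits at the epochs enter the dynamics, this uses that
    the free motion has no jump at an independent random time
    ([cvg_mesh_random_time]). Hence the characteristic function at time [t] is
    within 1 minus the probability of coalescence of [coal_prob]
    ([coalescence_bounds]). As its limit is known to exist, it is identified by
    Abelian means, that is by the Laplace transforms at small frequencies ([abel_mean_le],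
    [limit_cos], [limit_sin]).

    Uniqueness ([char_fun_inj]) is obtained by approximating the indicators of orthants by
    trigonometric polynomials, in two bounded limits. *)

Set Implicit Arguments.
Unset Strict Implicit.
Unset Printing Implicit Defensive.

Import Order.TTheory GRing.Theory Num.Theory.
Import numFieldNormedType.Exports.

Local Open Scope classical_set_scope.
Local Open Scope complex_scope.
Local Open Scope ring_scope.

(** * Independent sigma-algebras and decoupling *)

Section Independence.
Context {dsp : measure_display} {Om : measurableType dsp} {R : realType}.
Variable P : probability Om R.

Definition indep (F G : set (set Om)) :=
  forall A B, F A -> G B -> P (A `&` B) = (P A * P B)%E.

Lemma indepC F G : indep F G -> indep G F.
Proof. by move=> FG A B GA FB; rewrite setIC FG// muleC. Qed.

Lemma gen_measurable (F : set (set Om)) : F `<=` measurable -> <<s F >> `<=` measurable.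
Proof. by move=> Fm; apply: smallest_sub => //; exact: sigma_algebra_measurable. Qed.

(** The events independent of a fixed one form a Dynkin class, so independence
    passes from a pi-system to the sigma-algebra that it generates. *)
Lemma indep_gen F G : setI_closed F -> F `<=` measurable -> G `<=` measurable ->
  indep F G -> indep <<s F >> G.
Proof.
move=> FI Fm Gm FG A B FA GB.
have mB := Gm _ GB.
pose T' := g_sigma_algebraType F.
have sm := gen_measurable Fm.
apply: (@dynkin_induction _ T' F (fun C => P (C `&` B) = (P C * P B)%E)) => //.
- by rewrite setTI probability_setT mul1e.
- by move=> C FC; exact: FG.
- move=> C /sm mC e.
  rewrite setIC -setDE measureD//; last exact: (le_lt_trans (probability_le1 P mB)) (ltry _).
  rewrite probability_setC// muleBl ?mul1e ?fin_num_measure//.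
  by rewrite setIC -e.
- move=> C mC tC e.
  have mC' n : dsp.-measurable (C n) by apply: sm; exact: mC.
  rewrite setI_bigcupl measure_bigcup//; last 2 first.
  - by move=> n _; exact: measurableI.
  - exact: trivIset_setIr.
  rewrite measure_bigcup// [RHS]muleC.
  rewrite -[X in (X * _)%E]fineK ?fin_num_measure// -nneseriesZl//.
  by apply: eq_eseriesr => n _; rewrite fineK ?fin_num_measure// muleC; exact: e.
Qed.

Section Grouping.
Variables (I : choiceType) (F : I -> set (set Om)).
Hypothesis FI : forall i, setI_closed (F i).
Hypothesis FT : forall i, F i setT.
Hypothesis Fm : forall i, F i `<=` measurable.
Hypothesis indF : independent_family P F.

(** Asking for [F i (A i)] at every index, and not only at those in [s], allows
    two cylinders to be intersected over the union of their index lists. *)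
Definition cylinders (J : set I) : set (set Om) :=
  [set C | exists (s : seq I) (A : I -> set Om), [/\ uniq s,
     (forall i, i \in s -> J i), (forall i, F i (A i)) & C = \bigcap_(i in [set` s]) A i]].

Lemma cylinders_setI J : setI_closed (cylinders J).
Proof.
move=> _ _ [s [A [us sJ FA ->]]] [t [B [ut tJ FB ->]]].
exists (undup (s ++ t)), (fun i => (if i \in s then A i else setT) `&`
  (if i \in t then B i else setT)); split.
- exact: undup_uniq.
- by move=> i; rewrite mem_undup mem_cat => /orP[/sJ|/tJ].
- by move=> i; apply: FI; case: ifP.
- apply/seteqP; split => [w [sw tw] i /= _|w stw].
    by split; case: ifPn => // ?; [exact: sw|exact: tw].
  split => i /= hi; have := stw i; rewrite /= mem_undup mem_cat hi ?orbT => /(_ isT) [];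
  by [].
Qed.

Lemma cylinders_measurable J : cylinders J `<=` measurable.
Proof.
move=> _ [s [A [us sJ FA ->]]].
by apply: fin_bigcap_measurable => // i _; exact: Fm.
Qed.

Lemma cylinders_gen J : <<s \bigcup_(i in J) F i >> `<=` <<s cylinders J >>.
Proof.
apply: smallest_sub; first exact: smallest_sigma_algebra.
apply: subset_trans; last exact: sub_gen_smallest.
move=> C [i Ji FC]; exists [:: i], (fun j => if j == i then C else setT); split => //.
- by move=> j; rewrite inE => /eqP ->.
- by move=> j; case: eqP => [->|].
- by apply/seteqP; split => [w Cw j /=|w]; [rewrite inE => ->|move=> /(_ i); rewrite /= inE eqxx; exact].
Qed.

(** Cylinders over [J] and cylinders over [K] involve disjoint lists of indices,
    hence are independent; both classes are pi-systems and [indep_gen] applies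
    to each side in turn. *)
Lemma indep_group (J K : set I) : (forall i, J i -> K i -> False) ->
  indep <<s \bigcup_(i in J) F i >> <<s \bigcup_(i in K) F i >>.
Proof.
move=> JK A B /cylinders_gen GA /cylinders_gen GB.
have mc := @cylinders_measurable.
suff /(_ A B GA GB) : indep <<s cylinders J >> <<s cylinders K >> by [].
apply: indep_gen => //; [exact: cylinders_setI|exact: gen_measurable|].
apply/indepC/indep_gen => //; [exact: cylinders_setI|].
move=> _ _ [s [A' [us sK FA ->]]] [t [B' [ut tJ FB ->]]].
have st i : i \in s -> i \in t -> False by move=> /sK Ki /tJ Ji; exact: JK Ki.
pose C i := if i \in s then A' i else B' i.
rewrite [X in P X](_ : _ = \bigcap_(i in [set` s ++ t]) C i); last first.
  apply/seteqP; split => [w [sw tw] i /=|w stw].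
    rewrite mem_cat /C; case: ifPn => [si _|_ ti]; [exact: sw|exact: tw].
  split => i /= hi; have := stw i; rewrite /= mem_cat hi ?orbT /C => /(_ isT).
    by rewrite hi.
  by case: ifPn => // si; have := st _ si hi.
have h1 r (D : I -> set Om) (ur : uniq r) (FD : forall i, F i (D i)) :
  P (\bigcap_(i in [set` r]) D i) = (\prod_(i <- r) P (D i))%E by apply: indF.
rewrite !h1 //; last 2 first.
- rewrite cat_uniq us ut andbT /=; apply/hasPn => i ti; apply/negP => si; exact: st si ti.
- by move=> i; rewrite /C; case: ifP.
rewrite big_cat /=; congr (_ * _)%E; rewrite big_seq [RHS]big_seq; apply: eq_bigr => i hi.
  by rewrite /C hi.
by rewrite /C; case: ifPn => // si; have := st _ si hi.
Qed.

End Grouping.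

End Independence.

Section Decoupling.
Context {dsp d1 d2 : measure_display} {Om : measurableType dsp}
  {T1 : measurableType d1} {T2 : measurableType d2} {R : realType}.
Variables (P : probability Om R) (X : Om -> T1) (Y : Om -> T2).
Hypotheses (mX : measurable_fun setT X) (mY : measurable_fun setT Y).
Hypothesis XY : forall A B, measurable A -> measurable B ->
  P (X @^-1` A `&` Y @^-1` B) = (P (X @^-1` A) * P (Y @^-1` B))%E.

Let X' : {mfun Om >-> T1} := HB.pack X (isMeasurableFun.Build _ _ _ _ _ mX).
Let Y' : {mfun Om >-> T2} := HB.pack Y (isMeasurableFun.Build _ _ _ _ _ mY).
Let mXY : measurable_fun setT (fun w => (X w, Y w)).
Proof. exact: measurable_fun_pair. Qed.
Let XY' : {mfun Om >-> (T1 * T2)%type} := HB.pack (fun w => (X w, Y w)) (isMeasurableFun.Build _ _ _ _ _ mXY).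

(** The joint law of two independent maps is the product of their laws, so that
    an expectation is a double integral by Tonelli's theorem. *)
Lemma decouple (H : T1 * T2 -> \bar R) : measurable_fun [set: T1 * T2] H -> (forall z, 0 <= H z)%E ->
  (\int[P]_w H (X w, Y w) = \int[P]_w2 \int[P]_w1 H (X w1, Y w2))%E.
Proof.
move=> mH H0.
transitivity (\int[distribution P XY']_z H z)%E.
  by rewrite ge0_integral_distribution.
transitivity (\int[distribution P X' \x distribution P Y']_z H z)%E.
  apply: eq_measure_integral => A mA _; apply/esym.
  exact: product_measure_unique.
rewrite fubini_tonelli2// ge0_integral_distribution//; last 2 first.
- exact: measurable_fun_fubini_tonelli_G.
- by move=> y; apply: integral_ge0.
apply: eq_integral => w2 _; rewrite /fubini_G /=.
rewrite ge0_integral_distribution//; exact: measurableT_comp.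
Qed.

Lemma measurable_partial_integral (H : T1 * T2 -> \bar R) :
  measurable_fun [set: T1 * T2] H -> (forall z, 0 <= H z)%E ->
  measurable_fun setT (fun y => \int[P]_w H (X w, y))%E.
Proof.
move=> mH H0; apply: (eq_measurable_fun (fun y => \int[distribution P X']_x H (x, y))%E).
  by move=> y _; rewrite ge0_integral_distribution//; exact: measurableT_comp.
exact: (@measurable_fun_fubini_tonelli_G _ _ T1 T2 R (distribution P X') H mH H0).
Qed.

End Decoupling.

(** The identity, seen as a pair of maps into the set of outcomes carrying
    [<<s F >>] and [<<s G >>], turns independence of sigma-algebras into
    independence of maps. A function [H] on the product describes a random
    quantity [H (w, w)] whose first argument only uses the information of [F]
    and whose second argument only uses that of [G]. *)
Section SigmaDecoupling.
Context {dsp : measure_display} {Om : measurableType dsp} {R : realType}.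
Variables (P : probability Om R) (F G : set (set Om)).
Hypotheses (Fm : F `<=` measurable) (Gm : G `<=` measurable).
Hypothesis FG : indep P <<s F >> <<s G >>.

Lemma decouple_sigma (H : g_sigma_algebraType F * g_sigma_algebraType G -> \bar R) :
  measurable_fun [set: g_sigma_algebraType F * g_sigma_algebraType G] H ->
  (forall z, 0 <= H z)%E ->
  (\int[P]_w H (w, w) = \int[P]_w2 \int[P]_w1 H (w1, w2))%E.
Proof.
move=> mH H0.
have := @decouple dsp _ _ Om (g_sigma_algebraType F) (g_sigma_algebraType G) R P idfun idfun.
apply => //.
- by move=> _ A mA; rewrite setTI; exact: gen_measurable mA.
- by move=> _ A mA; rewrite setTI; exact: gen_measurable mA.
Qed.

Lemma measurable_partial_sigma (H : g_sigma_algebraType F * g_sigma_algebraType G -> \bar R) :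
  measurable_fun [set: g_sigma_algebraType F * g_sigma_algebraType G] H ->
  (forall z, 0 <= H z)%E ->
  measurable_fun [set: g_sigma_algebraType G] (fun w2 => \int[P]_w1 H (w1, w2))%E.
Proof.
move=> mH H0; apply: (@measurable_partial_integral dsp _ _ Om (g_sigma_algebraType F)
  (g_sigma_algebraType G) R P idfun) => //.
by move=> _ A mA; rewrite setTI; exact: gen_measurable mA.
Qed.

End SigmaDecoupling.

Section Expectation.
Context {dsp : measure_display} {Om : measurableType dsp} {R : realType}.
Variable P : probability Om R.
Implicit Types f g : Om -> R.

(** On these functions the real-valued integral against a probability is linear,
    monotone and stable under bounded convergence, without side conditions. *)
Definition bounded_rv f := measurable_fun setT f /\ exists M, forall w, `|f w| <= M.

Lemma bounded_rv_integrable f : bounded_rv f -> P.-integrable setT (EFin \o f).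
Proof.
move=> [mf [M hM]]; apply: measurable_bounded_integrable => //.
  by rewrite (le_lt_trans (probability_le1 _ _)) ?ltry.
exists M; split; first by rewrite num_real.
by move=> x xM w _ /=; exact: (le_trans (hM w) (ltW xM)).
Qed.

Lemma bounded_rv_cst r : bounded_rv (cst r).
Proof. by split; [exact: measurable_cst|exists `|r|]. Qed.

Lemma bounded_rvD f g : bounded_rv f -> bounded_rv g -> bounded_rv (fun w => f w + g w).
Proof.
move=> [mf [M hM]] [mg [L hL]]; split; first exact: measurable_funD.
by exists (M + L) => w; rewrite (le_trans (ler_normD _ _)) ?lerD.
Qed.

Lemma bounded_rvN f : bounded_rv f -> bounded_rv (fun w => - f w).
Proof.
move=> [mf [M hM]]; split; first exact: measurable_funN.
by exists M => w; rewrite normrN.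
Qed.

Lemma bounded_rvB f g : bounded_rv f -> bounded_rv g -> bounded_rv (fun w => f w - g w).
Proof. by move=> hf hg; apply: bounded_rvD => //; exact: bounded_rvN. Qed.

Lemma bounded_rvM f g : bounded_rv f -> bounded_rv g -> bounded_rv (fun w => f w * g w).
Proof.
move=> [mf [M hM]] [mg [L hL]]; split; first exact: measurable_funM.
by exists (M * L) => w; rewrite normrM ler_pM.
Qed.

Lemma bounded_rv_cos f : measurable_fun setT f -> bounded_rv (fun w => cos (f w)).
Proof.
move=> mf; split; last by exists 1 => w; rewrite ler_norml cos_geN1 cos_le1.
by apply: (measurableT_comp _ mf); apply: continuous_measurable_fun; exact: continuous_cos.
Qed.

Lemma bounded_rv_sin f : measurable_fun setT f -> bounded_rv (fun w => sin (f w)).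
Proof.
move=> mf; split; last by exists 1 => w; rewrite ler_norml sin_geN1 sin_le1.
by apply: (measurableT_comp _ mf); apply: continuous_measurable_fun; exact: continuous_sin.
Qed.

Lemma expD f g : bounded_rv f -> bounded_rv g ->
  \int[P]_w (f w + g w) = \int[P]_w f w + \int[P]_w g w.
Proof. by move=> hf hg; rewrite RintegralD//; exact: bounded_rv_integrable. Qed.

Lemma expB f g : bounded_rv f -> bounded_rv g ->
  \int[P]_w (f w - g w) = \int[P]_w f w - \int[P]_w g w.
Proof. by move=> hf hg; rewrite RintegralB//; exact: bounded_rv_integrable. Qed.

Lemma expZ r f : bounded_rv f -> \int[P]_w (r * f w) = r * \int[P]_w f w.
Proof. by move=> hf; rewrite RintegralZl//; exact: bounded_rv_integrable. Qed.

Lemma exp_cst r : \int[P]_w r = r.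
Proof. have e := probability_setT P.
by rewrite Rintegral_cst// [X in fine X]e mulr1. Qed.

Lemma exp_le f g : bounded_rv f -> bounded_rv g -> (forall w, f w <= g w) ->
  \int[P]_w f w <= \int[P]_w g w.
Proof. by move=> hf hg fg; apply: le_Rintegral => //; exact: bounded_rv_integrable. Qed.

Lemma expE f : bounded_rv f -> (\int[P]_w f w)%:E = (\int[P]_w (f w)%:E)%E.
Proof. by move=> hf; rewrite fineK//; apply: integrable_fin_num => //; exact: bounded_rv_integrable. Qed.

Lemma exp_abs f (M : R) : measurable_fun setT f -> (forall w, `|f w| <= M) -> `|\int[P]_w f w| <= M.
Proof.
move=> mf hM; have bf : bounded_rv f by split => //; exists M.
rewrite (le_trans (le_normr_Rintegral _ _)) //; first exact: bounded_rv_integrable.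
rewrite -[leRHS]exp_cst; apply: exp_le => //; last exact: bounded_rv_cst.
by split; [exact: measurableT_comp|exists M => w; rewrite normr_id].
Qed.

Lemma exp_ae f g : measurable_fun setT f -> measurable_fun setT g ->
  {ae P, forall w, f w = g w} -> \int[P]_w f w = \int[P]_w g w.
Proof.
move=> mf mg fg; rewrite /Rintegral; congr fine; apply: ae_eq_integral => //.
- exact/measurable_EFinP.
- exact/measurable_EFinP.
- by apply: filterS fg => w /= -> .
Qed.

Lemma exp_cvg (f_ : nat -> Om -> R) f (M : R) : (forall n, measurable_fun setT (f_ n)) ->
  measurable_fun setT f -> (forall n w, `|f_ n w| <= M) ->
  {ae P, forall w, f_ n w @[n --> \oo] --> f w} ->
  (\int[P]_w f_ n w) @[n --> \oo] --> \int[P]_w f w.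
Proof.
move=> mf_ mf hM cf.
have [] := @dominated_convergence _ _ _ P setT measurableT
  (fun n w => (f_ n w)%:E) (EFin \o f) (cst M%:E).
- by move=> n; exact/measurable_EFinP.
- exact/measurable_EFinP.
- by apply: filterS cf => w /= cw _; apply: cvg_EFin => //; exact: nearW.
- by apply: bounded_rv_integrable; exact: bounded_rv_cst.
- by apply: aeW => w n _ /=; rewrite lee_fin.
move=> fi _ c; apply: (fine_cvg (f := fun n => (\int[P]_w (f_ n w)%:E)%E)).
by rewrite fineK//; exact: integrable_fin_num.
Qed.

End Expectation.

Section RealDecoupling.
Context {dsp : measure_display} {Om : measurableType dsp} {R : realType}.
Variables (P : probability Om R) (F G : set (set Om)).
Hypotheses (Fm : F `<=` measurable) (Gm : G `<=` measurable).
Hypothesis FG : indep P <<s F >> <<s G >>.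

Let T1 := g_sigma_algebraType F.
Let T2 := g_sigma_algebraType G.

Lemma sub_measurable_fun {d} {T : measurableType d} (H : set (set Om)) (f : Om -> T) :
  H `<=` measurable ->
  @measurable_fun _ _ (g_sigma_algebraType H) T setT f -> measurable_fun setT f.
Proof. by move=> Hm mf _ B mB; exact: gen_measurable (mf measurableT B mB). Qed.

Lemma measurable_diag {d} {T : measurableType d} (H : T1 * T2 -> T) :
  measurable_fun [set: T1 * T2] H -> measurable_fun [set: Om] (fun w => H (w, w)).
Proof.
move=> mH; apply: (measurableT_comp mH (f:=H) (g := fun w : Om => (w : T1, w : T2))).
apply: measurable_fun_pair.
- by move=> _ A mA; rewrite setTI; exact: gen_measurable mA.
- by move=> _ A mA; rewrite setTI; exact: gen_measurable mA.
Qed.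

Lemma measurable_section1 {d} {T : measurableType d} (H : T1 * T2 -> T) w2 :
  measurable_fun [set: T1 * T2] H -> measurable_fun [set: Om] (fun w => H (w, w2)).
Proof.
move=> mH; apply: (sub_measurable_fun Fm).
exact: (measurable_fun_pair1 w2 mH).
Qed.

(** Adding the bound [M] reduces the statement to nonnegative functions. *)
Lemma decouple_bounded (H : T1 * T2 -> R) (M : R) :
  measurable_fun [set: T1 * T2] H -> (forall z, `|H z| <= M) ->
  (\int[P]_w H (w, w) = \int[P]_w2 \int[P]_w1 H (w1, w2)).
Proof.
move=> mH hM.
have mHd : measurable_fun [set: Om] (fun w => H (w, w)) by exact: measurable_diag.
have mHs w2 : measurable_fun [set: Om] (fun w => H (w, w2)) by exact: measurable_section1.
have bd : bounded_rv (fun w : Om => H (w, w)) by split => //; exists M.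
have bs w2 : bounded_rv (fun w : Om => H (w, w2)) by split => //; exists M.
have H0 z : 0 <= H z + M by have := hM z; rewrite ler_norml; lra.
have mHM : measurable_fun [set: T1 * T2] (fun z => (H z + M)%:E).
  by apply/measurable_EFinP; exact: measurable_funD.
have := decouple_sigma Fm Gm FG (H := fun z => (H z + M)%:E) mHM.
move=> /(_ (fun z => H0 z)) h.
pose J w2 := \int[P]_w H (w, w2).
have JE w2 : (\int[P]_w1 (H (w1, w2) + M)%:E)%E = (J w2 + M)%:E.
  by rewrite -expE ?expD ?exp_cst//; [exact: bounded_rv_cst|apply: bounded_rvD => //; exact: bounded_rv_cst].
have JM w2 : `|J w2| <= M by exact: exp_abs.
have mJ : @measurable_fun _ _ T2 R setT J.
  have := measurable_partial_sigma P Fm mHM (fun z => H0 z).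
  under eq_fun do rewrite JE.
  move=> /measurable_EFinP /= m1.
  have := measurable_funB m1 (@measurable_cst _ _ T2 R setT M).
  by apply: eq_measurable_fun => w _ /=; rewrite addrK.
have bJ : @bounded_rv _ Om R J by split; [exact: (sub_measurable_fun (H := G) (f := J) Gm mJ)|exists M].
move: h; rewrite -expE; last by apply: bounded_rvD => //; exact: bounded_rv_cst.
rewrite expD// ?exp_cst//; last exact: bounded_rv_cst.
under eq_integral do rewrite JE.
rewrite -expE; last by apply: bounded_rvD => //; exact: bounded_rv_cst.
rewrite expD//; last exact: bounded_rv_cst.
by rewrite exp_cst => -[] /addIr.
Qed.

Lemma indep_expM (f g : Om -> R) : @measurable_fun _ _ T1 R setT f ->
  @measurable_fun _ _ T2 R setT g -> (exists M : R, forall w, `|f w| <= M) ->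
  (exists M : R, forall w, `|g w| <= M) ->
  \int[P]_w (f w * g w) = \int[P]_w f w * \int[P]_w g w.
Proof.
move=> mf mg [M hM] [L hL].
have := @decouple_bounded (fun z => f z.1 * g z.2) (M * L).
move=> -> /=; last 2 first.
- by apply: measurable_funM; apply: measurableT_comp => //.
- by move=> z; rewrite normrM ler_pM.
have bf : bounded_rv f by split; [exact: sub_measurable_fun mf|exists M].
have bg : bounded_rv g by split; [exact: sub_measurable_fun mg|exists L].
under eq_Rintegral => w2 _.
  under eq_Rintegral do rewrite mulrC.
  rewrite expZ // mulrC.
  over.
by rewrite expZ.
Qed.

End RealDecoupling.

(** A sub-sigma-algebra has no type of its own here: being measurable for
    [<<s F >>] is being measurable from the same set of outcomes carrying
    [<<s F >>]. *)
Notation meas_in F f := (@measurable_fun _ _ (g_sigma_algebraType F) _ setT f).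

Section MeasIn.
Context {Om : pointedType} {d} {T : measurableType d}.

Lemma meas_inS (F G : set (set Om)) (f : Om -> T) :
  <<s F >> `<=` <<s G >> -> meas_in F f -> meas_in G f.
Proof. by move=> FG mf _ B mB; exact: FG (mf measurableT B mB). Qed.

Lemma meas_in_bigcup (I : Type) (F : I -> set (set Om)) (J : set I) i (f : Om -> T) :
  J i -> meas_in (F i) f -> meas_in (\bigcup_(i in J) F i) f.
Proof.
move=> Ji; apply: meas_inS; apply: smallest_sub => [|C FC]; first exact: smallest_sigma_algebra.
by apply: sub_gen_smallest; exists i.
Qed.

End MeasIn.

Section CharacteristicFunctions.
Context {dsp : measure_display} {Om : measurableType dsp} {R : realType}.
Variable P : probability Om R.
Implicit Types f g : Om -> R.

(** A single frequency is enough: the characteristic function of a vector [X] at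
    [lam] is [char_rv] of the scalar [inner lam X]. *)
Definition char_rv f : R[i] := (\int[P]_w cos (f w)) +i* (\int[P]_w sin (f w)).

(** The addition formulas of cosine and sine expand both parts into expectations
    of products of independent factors. *)
Lemma char_rv_indepD (F G : set (set Om)) f g : F `<=` measurable -> G `<=` measurable ->
  indep P <<s F >> <<s G >> -> meas_in F f -> meas_in G g ->
  char_rv (fun w => f w + g w) = char_rv f * char_rv g.
Proof.
move=> Fm Gm FG mf mg.
have ccos (H : set (set Om)) (h : Om -> R) : meas_in H h -> meas_in H (fun w => cos (h w)).
  by move=> mh; apply: (measurableT_comp _ mh); apply: continuous_measurable_fun; exact: continuous_cos.
have csin (H : set (set Om)) (h : Om -> R) : meas_in H h -> meas_in H (fun w => sin (h w)).
  by move=> mh; apply: (measurableT_comp _ mh); apply: continuous_measurable_fun; exact: continuous_sin.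
have c1 (h : Om -> R) : exists M : R, forall w, `|cos (h w)| <= M.
  by exists 1 => w; rewrite ler_norml cos_geN1 cos_le1.
have s1 (h : Om -> R) : exists M : R, forall w, `|sin (h w)| <= M.
  by exists 1 => w; rewrite ler_norml sin_geN1 sin_le1.
have mf' := sub_measurable_fun Fm mf; have mg' := sub_measurable_fun Gm mg.
rewrite /char_rv; under eq_Rintegral do rewrite cosD.
under [in X in _ +i* X]eq_Rintegral do rewrite sinD.
rewrite expB; [|by apply: bounded_rvM; exact: bounded_rv_cos|by apply: bounded_rvM; exact: bounded_rv_sin].
rewrite expD; [|by apply: bounded_rvM; [exact: bounded_rv_sin|exact: bounded_rv_cos]|by apply: bounded_rvM; [exact: bounded_rv_cos|exact: bounded_rv_sin]].
rewrite !(indep_expM Fm Gm FG) //; try by [exact: ccos|exact: csin].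
by simpc; congr (_ +i* _); rewrite addrC.
Qed.

Lemma char_rv0 : char_rv (fun=> 0) = 1.
Proof. by rewrite /char_rv cos0 sin0 !exp_cst. Qed.

Lemma char_rvN f : measurable_fun setT f -> char_rv (fun w => - f w) = (char_rv f)^*%C.
Proof.
move=> mf; rewrite /char_rv; under eq_Rintegral do rewrite cosN.
under [in X in _ +i* X]eq_Rintegral do rewrite sinN -mulN1r.
by rewrite expZ ?mulN1r//; exact: bounded_rv_sin.
Qed.

End CharacteristicFunctions.

Lemma measurable_fun_natb {d} {T : measurableType d} {R : realType} (b : T -> bool) :
  measurable_fun setT b -> measurable_fun setT (fun x => (b x)%:R : R).
Proof. by move=> mb; apply: (measurableT_comp (f := fun c : bool => c%:R : R)). Qed.

(** * The exponential clock *)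

Section ExponentialClock.
Context {R : realType}.
Variable m : R.
Hypothesis m0 : 0 < m.
Notation leb := (@lebesgue_measure R).

(** [exponential_prob] is given by its values on sets; the passage to integrals
    of functions goes through its Radon-Nikodym derivative, which agrees almost
    everywhere with the density. *)
Lemma ge0_integral_exponential (g : R -> \bar R) : measurable_fun setT g ->
  (forall x, 0 <= g x)%E ->
  (\int[exponential_prob m^-1]_x g x = \int[leb]_x (g x * (exponential_pdf m^-1 x)%:E))%E.
Proof.
move=> mg g0.
have r0 : 0 < m^-1 by rewrite invr_gt0.
have mpdf : measurable_fun setT (fun x => (exponential_pdf m^-1 x)%:E).
  by apply/measurable_EFinP; exact: measurable_exponential_pdf.
have dom : exponential_prob m^-1 `<< leb.
  apply/null_content_dominatesP => A mA A0.
  by apply: null_set_integral => //=; exact/measurable_funTS.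
rewrite -(Radon_Nikodym_SigmaFinite.change_of_variables dom g0 measurableT mg).
have mRN := measurable_int _ (Radon_Nikodym_SigmaFinite.f_integrable dom).
apply: ae_eq_integral => //.
- exact: emeasurable_funM.
- exact: emeasurable_funM.
- apply: ae_eqe_mul2l; apply: integral_ae_eq => //.
    exact: Radon_Nikodym_SigmaFinite.f_integrable.
  by move=> E _ mE; rewrite -Radon_Nikodym_SigmaFinite.f_integral.
Qed.

Lemma exponential_prob_tail (x : R) :
  exponential_prob m^-1 `]x, +oo[%classic = (1 - exponential_df m x)%:E.
Proof.
have r0 : 0 < m^-1 by rewrite invr_gt0.
rewrite -setCitvl probability_setC// EFinB; congr (1 - _)%E.
rewrite -[LHS]/(exponential_prob m^-1 `]-oo, x]%classic).
rewrite /exponential_prob /exponential_df integral_mkcond.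
have [x0|x0] := leP 0 x; last first.
  apply: integral0_eq => y _; rewrite patchE; case: ifPn => //.
  rewrite inE /= in_itv /= => yx; rewrite /exponential_pdf patchE ifF//.
  by apply/negbTE; rewrite notin_setE /= in_itv /= andbT; apply/negP; rewrite -ltNge; exact: le_lt_trans yx x0.
transitivity (\int[leb]_(y in `[0%R, x]) (exponential_pdf m^-1 y)%:E)%E.
  rewrite [RHS]integral_mkcond; apply: eq_integral => y _.
  rewrite /patch /= !mem_setE !in_itv /=; case: (leP y x) => yx; rewrite ?andbF ?andbT//.
  case: ifPn => // y0; rewrite /exponential_pdf patchE ifF//.
  by apply/negbTE; rewrite notin_setE /= in_itv /= andbT; apply/negP.
have [<-|xn0] := eqVneq 0 x.
  by rewrite set_itv1 integral_set1 oppr0 mul0r expR0 subrr.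
rewrite -[LHS]/(exponential_prob m^-1 `[0, x]%classic).
by rewrite exponential_prob_itv0c ?lt_neqAle ?xn0// mulNr mulrC -mulNr -EFinB.
Qed.

Context {dsp : measure_display} {Om : measurableType dsp}.
Variable P : probability Om R.
Variable Delta : Om -> R.
Hypothesis mDelta : measurable_fun setT Delta.
Hypothesis law : forall s, P [set w | Delta w <= s] = (exponential_df m s)%:E.

Let mDelta' : @measurable_fun _ _ Om (measurableTypeR R) setT Delta.
Proof. exact: mDelta. Qed.
Let Delta' : {mfun Om >-> measurableTypeR R} := HB.pack Delta (isMeasurableFun.Build _ _ _ _ _ mDelta').

Lemma tail_exponential u : P [set w | u < Delta w] = (1 - exponential_df m u)%:E.
Proof.
rewrite (_ : [set w | u < Delta w] = ~` [set w | Delta w <= u]); last first.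
  by apply/seteqP; split => w /=; rewrite ltNge => /negP.
rewrite probability_setC ?law//.
rewrite (_ : [set w | _] = Delta @^-1` `]-oo, u]%classic).
  by rewrite -[X in measurable X]setTI; exact: mDelta.
by apply/seteqP; split => w /=; rewrite in_itv.
Qed.

Lemma distribution_exponential (A : set R) : measurable A ->
  distribution P Delta' A = exponential_prob m^-1 A.
Proof.
move=> mA.
have r0 : 0 < m^-1 by rewrite invr_gt0.
pose ep : probability (measurableTypeR R) R :=
  exponential_distribution_exponential_prob__canonical__probability_measure_Probability r0.
have -> : exponential_prob m^-1 A = ep A by [].
refine (@measure_unique _ R (measurableTypeR R) (@RGenOInfty.G R)
  (fun n => `](- n%:R), +oo[%classic) _ _ _ _ (distribution P Delta') ep _ _ A mA) => //.
- exact: RGenOInfty.measurableE.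
- move=> _ _ [x ->] [y ->]; exists (Num.max x y).
  by apply/seteqP; split => z /=; rewrite !in_itv /= !andbT gt_max;
    [move=> [-> ->]|move=> /andP[]].
- by move=> n; exists (- n%:R).
- apply/seteqP; split => // x _; exists (Num.truncn (- x)).+1 => //=; rewrite in_itv /= andbT.
  by rewrite ltrNl truncnS_gt.
- move=> _ [x ->]; rewrite [RHS]exponential_prob_tail -tail_exponential.
  by congr (P _); apply/seteqP; split => w /=; rewrite in_itv /= andbT.
- by move=> n; rewrite (le_lt_trans (probability_le1 _ _)) ?ltry.
Qed.
(** For an exponential law of mean [m] the density at [u] is the tail
    probability at [u] divided by [m]. *)
Lemma exponential_law_tail (g : R -> \bar R) : measurable_fun setT g ->
  (forall x, 0 <= g x)%E ->
  (\int[P]_w g (Delta w) = m^-1%:E *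
    \int[leb]_u (g u * ((0 <= u)%R%:R)%:E * P [set w | u < Delta w]%R))%E.
Proof.
move=> mg g0.
have r0 : 0 < m^-1 by rewrite invr_gt0.
transitivity (\int[distribution P Delta']_x g x)%E.
  by rewrite ge0_integral_distribution.
transitivity (\int[exponential_prob m^-1]_x g x)%E.
  by apply: eq_measure_integral => A mA _; exact: distribution_exponential.
rewrite ge0_integral_exponential//.
have hE u : (g u * ((0 <= u)%R%:R)%:E * P [set w | u < Delta w]%R =
    m%:E * (g u * (exponential_pdf m^-1 u)%:E))%E.
  rewrite tail_exponential /exponential_df.
  case: leP => u0; last first.
    rewrite mule0 mul0e /exponential_pdf patchE ifF ?mule0//.
    by apply/negbTE; rewrite notin_setE /= in_itv /= andbT; apply/negP; rewrite -ltNge.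
  rewrite mule1 exponential_pdfE// muleCA -EFinM; congr (_ * _%:E)%E.
  rewrite opprB addrC subrK mulrA divff ?gt_eqF// mul1r.
  by rewrite mulNr mulrC -mulNr.
under [in RHS]eq_integral do rewrite hE.
rewrite ge0_integralZl//; last 3 first.
- apply: emeasurable_funM => //; apply/measurable_EFinP; exact: measurable_exponential_pdf.
- by move=> u _; rewrite mule_ge0// lee_fin exponential_pdf_ge0// invr_ge0 ltW.
- by rewrite lee_fin ltW.
by rewrite muleA -EFinM mulVf ?gt_eqF// mul1e.
Qed.

(** Tonelli's theorem turns the tail probability into the time during which the
    clock has not yet rung. *)
Lemma exponential_law (g : measurableTypeR R -> \bar R) : measurable_fun setT g ->
  (forall x, 0 <= g x)%E ->
  (\int[P]_w g (Delta w) = m^-1%:E *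
    \int[P]_w \int[leb]_u (g u * ((0 <= u < Delta w)%R%:R)%:E))%E.
Proof.
move=> mg g0; rewrite exponential_law_tail//; congr (_ * _)%E.
pose k (z : measurableTypeR R * Om) : \bar R := (g z.1 * ((0 <= z.1 < Delta z.2)%R%:R)%:E)%E.
have mk : measurable_fun [set: measurableTypeR R * Om] k.
  apply: emeasurable_funM; first exact: measurableT_comp.
  apply/measurable_EFinP/measurable_fun_natb/measurable_and.
    exact: (@measurable_fun_ler _ _ _ _ (cst 0) fst).
  by apply: measurable_fun_ltr => //; exact: measurableT_comp.
have k0 z : (0 <= k z)%E by rewrite mule_ge0// lee_fin.
have := fubini_tonelli (m1 := leb) (m2 := P) k mk k0.
rewrite /fubini_F /fubini_G /k /= => <-.
apply: eq_integral => u _.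
rewrite -muleA ge0_integralZl//; last first.
  apply/measurable_EFinP/measurable_fun_natb/measurable_and => //.
  exact: measurable_fun_ltr.
congr (_ * _)%E.
case: (0 <= u) => /=; last by rewrite mul0e integral0.
rewrite mul1e -[X in P X]setIT -integral_indic//; last first.
  rewrite (_ : [set w | _] = Delta @^-1` `]u, +oo[%classic).
    by rewrite -[X in measurable X]setTI; exact: mDelta.
  by apply/seteqP; split => w /=; rewrite in_itv /= andbT.
by apply: eq_integral => w _; rewrite indicE mem_setE.
Qed.

Section Compensation.
Variables (F G : set (set Om)).
Hypotheses (Fm : F `<=` measurable) (Gm : G `<=` measurable).
Hypothesis FG : indep P <<s F >> <<s G >>.
Hypothesis DF : meas_in F Delta.

Let T2 := g_sigma_algebraType G.

(** The compensation formula of a Poisson clock, for one interval: as long as it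
    has not rung, the clock rings at rate [m^-1], and what is counted at the
    ring may depend on anything independent of this interval. *)
Lemma compensation (h : measurableTypeR R * T2 -> \bar R) :
  measurable_fun [set: measurableTypeR R * T2] h -> (forall z, 0 <= h z)%E ->
  (\int[P]_w h (Delta w, w) = m^-1%:E *
    \int[P]_w \int[leb]_u (h (u, w) * ((0 <= u < Delta w)%R%:R)%:E))%E.
Proof.
move=> mh h0.
have mid1 : measurable_fun [set: Om] (fun w : Om => w : T2).
  by move=> _ A mA; rewrite setTI; exact: gen_measurable mA.
have DI (A : set (measurableTypeR R)) (B : set T2) : measurable A -> measurable B ->
    P (Delta @^-1` A `&` B) = (P (Delta @^-1` A) * P B)%E.
  move=> mA mB; apply: FG => //.
  by rewrite -[X in <<s F >> X]setTI; exact: DF.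
rewrite (decouple mDelta' mid1 DI)//.
pose k (z : (measurableTypeR R * T2) * measurableTypeR R) : \bar R :=
  (h (z.2, z.1.2) * ((0 <= z.2 < z.1.1)%R%:R)%:E)%E.
have mk : measurable_fun [set: (measurableTypeR R * T2) * measurableTypeR R] k.
  apply: emeasurable_funM.
    apply: (measurableT_comp mh); apply: measurable_fun_pair => //.
    exact: measurableT_comp.
  apply/measurable_EFinP/measurable_fun_natb/measurable_and.
    exact: (@measurable_fun_ler _ _ _ _ (cst 0) snd).
  by apply: measurable_fun_ltr => //; exact: measurableT_comp.
have k0 z : (0 <= k z)%E by rewrite mule_ge0// lee_fin.
pose H' (z : measurableTypeR R * T2) := (\int[leb]_u k (z, u))%E.
have mH' : measurable_fun [set: measurableTypeR R * T2] H'.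
  exact: (@measurable_fun_fubini_tonelli_F _ _ _ _ _ leb k mk k0).
have H'0 z : (0 <= H' z)%E by apply: integral_ge0.
have := decouple mDelta' mid1 DI mH' H'0.
rewrite {1}/H' /k /= => ->.
rewrite -ge0_integralZl//; last first.
- by rewrite lee_fin invr_ge0 ltW.
- by move=> w _; exact: integral_ge0.
- have mJ := measurable_partial_integral P mDelta' mH' H'0.
  exact: (sub_measurable_fun (H := G) (f := (fun x : Om => \int[P]_w1 H' (Delta w1, x))%E) Gm mJ).
apply: eq_integral => w2 _.
rewrite (@exponential_law (fun u => h (u, w2)))//.
have q := measurable_fun_pair1 (f := h) (w2 : T2) mh.
exact: q.
Qed.

End Compensation.

End ExponentialClock.

(** * Histories of synchronization *)

(** The evolution of the epochs is described by the finite list of messages sent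
    so far, most recent first; a message is a pair (sender, recipient),
    [Delta k i] is the [i]-th interval of the clock of [k] and [rcp k i] the
    recipient of the message sent at its end. *)
Section Histories.
Context {R : realType} {Om : Type} {N : nat}.
Variables (Delta : 'I_N -> nat -> Om -> R) (rcp : 'I_N -> nat -> Om -> 'I_N).
Variables (theta : R).

Definition event := ('I_N * 'I_N)%type.
Implicit Types (h : seq event) (j k p q : 'I_N) (w : Om).

Definition epoch k n w := \sum_(i < n) Delta k i w.

Definition sent_count h k := count (fun e : event => e.1 == k) h.

Definition next_epoch h k w := epoch k (sent_count h k).+1 w.

Definition last_epoch h w := if h is e :: h' then next_epoch h' e.1 w else 0.

(** Comparing each epoch with the preceding one only is enough: [during]
    requires the clocks that did not send the last message to ring later, and
    this forces the whole list to be in chronological order. *)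
Fixpoint valid h w := if h is e :: h' then
  [&& valid h' w, last_epoch h' w < next_epoch h' e.1 w & rcp e.1 (sent_count h' e.1) w == e.2] else true.

Definition during h s w :=
  [&& valid h w, last_epoch h w < s & [forall k, s < next_epoch h k w]].

(** Ancestry, backwards in time: right after the message [e], the value held by
    its recipient is the one of its sender. *)
Definition relabel (e : event) j := if j == e.2 then e.1 else j.

(** With [theta = - 2 Re (eta lam)] this is the characteristic function at [lam]
    of the difference of two free increments over a lapse [u], the increments
    being those of the components where two ancestral lines sit. *)
Definition decay j k (u : R) : R := if j == k then 1 else expR (- theta * u).

(** The ancestral lines of [j] and [k] are followed back from the last message
    of [h] to time 0. The weight is the product of the decays along the way, and
    it is zero when the lines have not met by time 0; for [theta = 0] it is the
    indicator of the meeting. *)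
Fixpoint coalescence_at_last h j k w : R := if h is e :: h' then
    decay (relabel e j) (relabel e k) (next_epoch h' e.1 w - last_epoch h' w) *
    coalescence_at_last h' (relabel e j) (relabel e k) w
  else (j == k)%:R.

Definition coalescence h j k s w := decay j k (s - last_epoch h w) * coalescence_at_last h j k w.

Lemma epochS k n w : epoch k n.+1 w = epoch k n w + Delta k n w.
Proof. by rewrite /epoch big_ord_recr. Qed.

Lemma epoch0 k w : epoch k 0 w = 0.
Proof. by rewrite /epoch big_ord0. Qed.

Lemma next_epochE h k w : next_epoch h k w = epoch k (sent_count h k).+1 w.
Proof. by []. Qed.

Lemma decay_gt0 j k u : 0 < decay j k u.
Proof. by rewrite /decay; case: ifP => // _; exact: expR_gt0. Qed.

Lemma coalescence_at_last_ge0 h j k w : 0 <= coalescence_at_last h j k w.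
Proof.
elim: h j k => [|e h IH] j k /=; first by case: eqP.
by rewrite mulr_ge0// ltW// decay_gt0.
Qed.

Lemma coalescence_ge0 h j k s w : 0 <= coalescence h j k s w.
Proof. by rewrite mulr_ge0 ?coalescence_at_last_ge0// ltW// decay_gt0. Qed.

Lemma valid_epoch_le h k w : valid h w -> epoch k (sent_count h k) w <= last_epoch h w.
Proof.
elim: h => [_|e h IH /= /and3P[hv hl _]]; first by rewrite /epoch big_ord0.
case: eqVneq => [<-|ek]; first by rewrite add1n.
by rewrite add0n (le_trans (IH hv))// ltW.
Qed.

Lemma last_epoch_ge0 h w : valid h w -> 0 <= last_epoch h w.
Proof.
elim: h => [//|e h IH /= /and3P[hv hl _]].
by rewrite (le_trans (IH hv))// ltW.
Qed.

(** The map [pr] makes the same lemmas available on the probability space, on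
    its sub-sigma-algebras and on products with the time axis. *)
Section Measurability.
Context {d} {U : measurableType d} (pr : U -> Om).

Lemma measurable_forall (T : finType) (b : T -> U -> bool) :
  (forall t, measurable_fun setT (b t)) -> measurable_fun setT (fun u => [forall t, b t u]).
Proof.
move=> mb; rewrite (_ : (fun u => _) = fun u => all (fun t => b t u) (enum T)); last first.
  apply/funext => u; apply/forallP/allP => [h k _|h k]; [exact: h|].
  by apply: h; rewrite mem_enum.
elim: (enum T) => [|k s IH] /=; first exact: measurable_cst.
exact: measurable_and.
Qed.

Lemma measurable_epoch k n : (forall i, (i < n)%N -> measurable_fun setT (fun u => Delta k i (pr u))) ->
  measurable_fun setT (fun u => epoch k n (pr u)).
Proof.
elim: n => [_|n IH hn].
  by under eq_fun do rewrite /epoch big_ord0; exact: measurable_cst.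
under eq_fun do rewrite epochS; apply: measurable_funD; last exact: hn.
by apply: IH => i ni; apply: hn; exact: leqW.
Qed.

(** Only the intervals and recipients that [h] has used are required to be
    measurable: at the next ring of a clock, the interval that is ending must be
    left free. *)
Definition history_measurable h := forall k i, (i < sent_count h k)%N ->
  measurable_fun setT (fun u => Delta k i (pr u)) /\
  forall q, measurable_fun setT (fun u => rcp k i (pr u) == q).

Lemma history_measurableW e h : history_measurable (e :: h) -> history_measurable h.
Proof. by move=> he k i ik; apply: he; rewrite /= (leq_trans ik)// leq_addl. Qed.

Lemma measurable_next_epoch_sender e h : history_measurable (e :: h) ->
  measurable_fun setT (fun u => next_epoch h e.1 (pr u)).
Proof.
by move=> he; apply: measurable_epoch => i ih; have [] := he e.1 i _; rewrite //= eqxx add1n.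
Qed.

Lemma measurable_last_epoch h : history_measurable h -> measurable_fun setT (fun u => last_epoch h (pr u)).
Proof. by case: h => [_|e h /measurable_next_epoch_sender//]; exact: measurable_cst. Qed.

Lemma measurable_valid h : history_measurable h -> measurable_fun setT (fun u => valid h (pr u)).
Proof.
elim: h => [_|e h IH he] /=; first exact: measurable_cst.
have hm := history_measurableW he.
apply: measurable_and; first exact: IH.
apply: measurable_and.
  by apply: measurable_fun_ltr; [exact: measurable_last_epoch|exact: measurable_next_epoch_sender].
by have [] := he e.1 (sent_count h e.1) _; rewrite //= eqxx add1n.
Qed.

Lemma measurable_decay j k (f : U -> R) : measurable_fun setT f ->
  measurable_fun setT (fun u => decay j k (f u)).
Proof.
move=> mf; rewrite /decay; case: (j == k) => //.
by apply: measurableT_comp => //; exact: measurable_funM.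
Qed.

Lemma measurable_coalescence_at_last h j k : history_measurable h ->
  measurable_fun setT (fun u => coalescence_at_last h j k (pr u)).
Proof.
elim: h j k => [|e h IH] j k he /=; first exact: measurable_cst.
have hm := history_measurableW he.
apply: measurable_funM; last exact: IH.
by apply/measurable_decay/measurable_funB; [exact: measurable_next_epoch_sender|exact: measurable_last_epoch].
Qed.

Lemma measurable_coalescence h j k (f : U -> R) : history_measurable h -> measurable_fun setT f ->
  measurable_fun setT (fun u => coalescence h j k (f u) (pr u)).
Proof.
move=> hm mf; apply: measurable_funM; last exact: measurable_coalescence_at_last.
by apply/measurable_decay/measurable_funB => //; exact: measurable_last_epoch.
Qed.

End Measurability.
End Histories.

(** * Balance of the discounted weight of coalescence *)

Section Translation.
Context {R : realType}.
Notation leb := (@lebesgue_measure R).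

Lemma ge0_integral_translate (a : R) (f : measurableTypeR R -> \bar R) :
  measurable_fun setT f -> (forall x, 0 <= f x)%E ->
  (\int[leb]_u f (a + u)%R = \int[leb]_s f s)%E.
Proof.
move=> mf f0.
pose sh (u : measurableTypeR R) : measurableTypeR R := a + u.
have msh : measurable_fun [set: measurableTypeR R] sh by exact: measurable_funD.
transitivity (\int[pushforward leb sh]_s f s)%E.
  by rewrite ge0_integral_pushforward.
apply: eq_measure_integral => A mA _; apply/esym.
apply: lebesgue_measure_unique => // _ [[x y] /= xy <-].
rewrite /pushforward /=.
rewrite (_ : sh @^-1` _ = `](x - a), (y - a)]%classic); last first.
  by apply/seteqP; split => z; rewrite /= !in_itv /= /sh; [move=> /andP[]|move=> /andP[]]; lra.
rewrite !lebesgue_measure_itv /= !lte_fin ltrD2r; case: ifP => // _.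
by rewrite -!EFinB; congr (_%:E); lra.
Qed.

End Translation.

Lemma esum_cst {R : realDomainType} (x : \bar R) n :
  (\sum_(i < n) x = n%:R%:E * x)%E.
Proof.
elim: n => [|n IH]; first by rewrite big_ord0 mul0e.
by rewrite big_ord_recr /= IH -natr1 EFinD ge0_muleDl ?lee_fin ?mul1e.
Qed.

Lemma eq_inv_mule {R : realFieldType} (K : R) (x y : \bar R) : 0 < K ->
  (y = K%:E * x)%E -> (x = K^-1%:E * y)%E.
Proof. by move=> K0 ->; rewrite muleA -EFinM mulVf ?gt_eqF// mul1e. Qed.

Section ExponentialIntegral.
Context {R : realType}.
Notation leb := (@lebesgue_measure R).

Lemma integral_expR_itvoo (K x : R) : 0 < K -> 0 < x ->
  (\int[leb]_u ((0 < u < x)%R%:R * expR (- K * u))%:E = (K^-1 * (1 - expR (- K * x)))%:E)%E.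
Proof.
move=> K0 x0.
have mE : measurable_fun setT (fun u : measurableTypeR R => expR (- K * u)).
  by apply: measurableT_comp => //; exact: measurable_funM.
transitivity (\int[leb]_(u in `[0%R, x]) (expR (- K * u))%:E)%E.
  rewrite -integral_itv_obnd_cbnd; last exact/measurable_EFinP/measurable_funTS.
  rewrite -integral_itv_bndo_bndc; last exact/measurable_EFinP/measurable_funTS.
  rewrite [RHS]integral_mkcond; apply: eq_integral => u _.
  rewrite /patch mem_setE in_itv /=; case: ifP => _; rewrite ?mul1r ?mul0r//.
have -> : (\int[leb]_(u in `[0%R, x]) (expR (- K * u))%:E =
    \int[leb]_(u in `[0%R, x]) (K^-1%:E * (exponential_pdf K u)%:E))%E.
  apply: eq_integral => u; rewrite inE /= in_itv /= => /andP[u0 _].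
  by rewrite exponential_pdfE// -EFinM mulKf// gt_eqF.
rewrite ge0_integralZl//=; last 3 first.
- apply/measurable_funTS/measurable_EFinP; exact: measurable_exponential_pdf.
- by move=> u _; rewrite lee_fin exponential_pdf_ge0// ltW.
- by rewrite lee_fin invr_ge0 ltW.
rewrite -[X in (_ * X)%E]/(exponential_prob K `[0%R, x]%classic).
by rewrite exponential_prob_itv0c.
Qed.

(** The loss of a quantity that decreases at rates [eps] and [c] between [a] and
    [b] is the integral of the rate of decrease. *)
Lemma integral_discount (eps c a b : R) : 0 < eps -> 0 <= c -> a < b ->
  ((eps + c)%:E * \int[leb]_s ((a < s < b)%R%:R * (expR (- eps * s) * expR (- c * (s - a))))%:E =
   (expR (- eps * a) - expR (- eps * b) * expR (- c * (b - a)))%:E)%E.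
Proof.
move=> e0 c0 ab; have K0 : 0 < eps + c by lra.
rewrite -(ge0_integral_translate a); last 2 first.
- apply/measurable_EFinP; apply: measurable_funM.
    by apply/measurable_fun_natb/measurable_and; exact: measurable_fun_ltr.
  apply: measurable_funM; first by apply: measurableT_comp => //; exact: measurable_funM.
  by apply: measurableT_comp => //; apply: measurable_funM => //; exact: measurable_funB.
- by move=> s; rewrite lee_fin !mulr_ge0// expR_ge0.
transitivity ((eps + c)%:E * \int[leb]_u ((expR (- eps * a))%:E *
    ((0 < u < b - a)%R%:R * expR (- (eps + c) * u))%:E))%E.
  congr (_ * _)%E; apply: eq_integral => u _; rewrite -EFinM; congr (_%:E).
  rewrite [RHS]mulrCA -ltrBrDl (_ : (a < a + u) = (0 < u)); last by apply/idP/idP; lra.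
  by congr (_ * _); rewrite -!expRD; congr expR; ring.
rewrite ge0_integralZl//; last first.
- apply/measurable_EFinP; apply: measurable_funM.
    by apply/measurable_fun_natb/measurable_and; exact: measurable_fun_ltr.
  by apply: measurableT_comp => //; exact: measurable_funM.
rewrite integral_expR_itvoo ?subr_gt0// -!EFinM; congr (_%:E).
rewrite mulrCA mulVKf ?gt_eqF// mulrBr mulr1; congr (_ - _).
by rewrite -!expRD; congr expR; ring.
Qed.

End ExponentialIntegral.

(** For each history, the weight [coalescence] discounted by [exp (- eps s)] is
    followed in time. It enters when the last message of the history is sent
    ([entry_mass]), it decreases at rate [eps + rate j k] while the history
    lasts ([occupation]), and the rest leaves when a clock rings
    ([exit_mass]). *)
Section Clocks.
Context {R : realType} {dsp : measure_display} {Om : measurableType dsp}.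
Variable P : probability Om R.
Context {N : nat}.
Variables (m theta eps : R) (Delta : 'I_N -> nat -> Om -> R) (rcp : 'I_N -> nat -> Om -> 'I_N).
Hypotheses (hN : (2 <= N)%N) (m0 : 0 < m) (theta0 : 0 <= theta) (eps0 : 0 < eps).
Notation leb := (@lebesgue_measure R).

Definition clock_events (i : ('I_N * nat) + ('I_N * nat)) : set (set Om) := match i with
  | inl (k, n) => sigma_of measurable (Delta k n)
  | inr (k, n) => sigma_of setT (rcp k n) end.

Hypothesis mDelta : forall k n, measurable_fun setT (Delta k n).
Hypothesis mrcp : forall k n (S : set 'I_N), measurable (rcp k n @^-1` S).
Hypothesis Dlaw : forall k n s, P [set w | Delta k n w <= s] = (exponential_df m s)%:E.
Hypothesis rlaw : forall k n j, P (rcp k n @^-1` [set j]) =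
  (if j == k then 0 else (N.-1%:R)^-1)%:E.
Hypothesis ind : independent_family P clock_events.
Hypothesis noties : {ae P, forall w k k' n n',
  epoch Delta k n.+1 w = epoch Delta k' n'.+1 w -> k = k'}.

Lemma clock_events_measurable i : clock_events i `<=` measurable.
Proof.
case: i => [[k n]|[k n]] _ [B mB <-]; rewrite setTI.
  by rewrite -[X in measurable X]setTI; exact: mDelta.
exact: mrcp.
Qed.

Lemma clock_events_setT i : clock_events i setT.
Proof. by case: i => [[k n]|[k n]]; exists setT => //; rewrite preimage_setT setTI. Qed.

Lemma clock_events_setI i : setI_closed (clock_events i).
Proof.
case: i => [[k n]|[k n]] _ _ [A mA <-] [B mB <-]; exists (A `&` B) => //.
- exact: measurableI.
- by rewrite preimage_setI !setTI.
- by rewrite preimage_setI !setTI.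
Qed.

Definition other_events i := \bigcup_(j in [set j | j != i]) clock_events j.

Lemma other_events_measurable i : other_events i `<=` measurable.
Proof. by move=> A [j _]; exact: clock_events_measurable. Qed.

Lemma indep_clock i : indep P <<s clock_events i >> <<s other_events i >>.
Proof.
have := @indep_group _ _ _ P _ _ clock_events_setI clock_events_setT
  clock_events_measurable ind [set i] [set j | j != i].
by rewrite bigcup_set1; apply => j -> /=; rewrite eqxx.
Qed.

Lemma Delta_other i k n : inl (k, n) != i -> meas_in (other_events i) (Delta k n).
Proof.
move=> ki _ B mB; apply: sub_gen_smallest; exists (inl (k, n)) => //.
by exists B.
Qed.

Lemma rcp_other i k n q : inr (k, n) != i ->
  meas_in (other_events i) (fun w => rcp k n w == q).
Proof.
move=> ki _ B mB; apply: sub_gen_smallest; exists (inr (k, n)) => //.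
exists [set j | B (j == q)] => //.
Qed.

Notation epoch := (epoch Delta).
Notation next_epoch := (next_epoch Delta).
Notation last_epoch := (last_epoch Delta).
Notation valid := (valid Delta rcp).
Notation during := (during Delta rcp).
Notation coalescence_at_last := (coalescence_at_last Delta theta).
Notation coalescence := (coalescence Delta theta).
Notation history_measurable := (history_measurable Delta rcp).

Definition fires h p w := [&& valid h w, last_epoch h w < next_epoch h p w &
  [forall k, (k != p) ==> (next_epoch h p w < next_epoch h k w)]].

Definition exit_mass h p j k := (\int[P]_w ((fires h p w)%:R * expR (- eps * next_epoch h p w) *
  coalescence h j k (next_epoch h p w) w)%:E)%E.

Definition occupation h j k := (\int[P]_w \int[leb]_s ((during h s w)%:R * expR (- eps * s) *
  coalescence h j k s w)%:E)%E.

(** Compensation formula for the interval of the clock of [p] that is running: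
    the event that [p] is first to ring and the weight at that time are a
    function of this interval and of variables independent of it. *)
Lemma exit_mass_occupation h p j k : exit_mass h p j k = (m^-1%:E * occupation h j k)%E.
Proof.
pose n := sent_count h p; pose i : ('I_N * nat) + ('I_N * nat) := inl (p, n).
pose G := other_events i; pose T2 := g_sigma_algebraType G.
have hm : history_measurable (fun z : measurableTypeR R * T2 => z.2) h.
  move=> k' l lk; split => [|q].
    apply: (measurableT_comp (f := Delta k' l : T2 -> R)) => //.
    apply: Delta_other; apply/eqP => -[kp ln]; move: lk.
    by rewrite kp ln ltnn.
  apply: (measurableT_comp (f := (fun w => rcp k' l w == q) : T2 -> bool)) => //.
  exact: rcp_other.
have mep k' l : (l <= sent_count h k')%N || (k' != p) ->
    measurable_fun setT (fun z : measurableTypeR R * T2 => epoch k' l z.2).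
  move=> hl; apply: measurable_epoch => l' ll'.
  apply: (measurableT_comp (f := Delta k' l' : T2 -> R)) => //.
  apply: Delta_other; apply/eqP => -[kp ln]; move: hl.
  by rewrite kp eqxx orbF leqNgt -/n -ln ll'.
pose g (z : measurableTypeR R * T2) : R := [&& valid h z.2, last_epoch h z.2 < z.1 &
  [forall k, (k != p) ==> (z.1 < next_epoch h k z.2)]]%:R * expR (- eps * z.1) * coalescence h j k z.1 z.2.
have mg : measurable_fun [set: measurableTypeR R * T2] (fun z => (g z)%:E).
  apply/measurable_EFinP; apply: measurable_funM; last exact: (measurable_coalescence theta j k hm measurable_fst).
  apply: measurable_funM; last first.
    by apply: measurableT_comp => //; exact: measurable_funM.
  apply: measurable_fun_natb; apply: measurable_and; first exact: (measurable_valid hm).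
  apply: measurable_and; first by apply: measurable_fun_ltr => //; exact: (measurable_last_epoch hm).
  apply: measurable_forall => k'; case: eqVneq => [_|kp] /=; first exact: measurable_cst.
  by apply: measurable_fun_ltr => //; apply: mep; rewrite kp orbT.
have g0 z : (0 <= (g z)%:E)%E.
  by rewrite lee_fin /g; apply: mulr_ge0; [apply: mulr_ge0|]; rewrite ?ler0n ?expR_ge0 ?coalescence_ge0.
have msh : measurable_fun [set: measurableTypeR R * T2]
    (fun z => (epoch p n z.2 + z.1, z.2) : measurableTypeR R * T2).
  apply: measurable_fun_pair => //; apply: measurable_funD => //.
  by apply: mep; rewrite leqnn.
have DF : meas_in (clock_events i) (Delta p n).
  by move=> _ B mB; apply: sub_gen_smallest; exists B.
(* The epoch of [p] is the sum of its past intervals and of the running one. *)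
have := compensation m0 (mDelta p n) (Dlaw p n)
  (@other_events_measurable i) (@indep_clock i) DF
  (h := fun z => (g (epoch p n z.2 + z.1, z.2))%:E)
  (measurableT_comp mg msh) (fun z => g0 _).
rewrite /exit_mass /=; under eq_integral do rewrite -epochS; move=> ->.
congr (_ * _)%E; rewrite /occupation; apply: eq_integral => w _.
pose f (s : measurableTypeR R) := (g (s, w) * (epoch p n w <= s < next_epoch h p w)%R%:R)%:E.
have mf : measurable_fun setT f.
  apply/measurable_EFinP/measurable_funM.
    have q := measurable_fun_pair1 (f := fun z => (g z)%:E) (w : T2) mg.
    exact/measurable_EFinP.
  apply: measurable_fun_natb; apply: measurable_and; first exact: measurable_fun_ler.
  exact: measurable_fun_ltr.
(* From the age of the running interval to the absolute time. *)
transitivity (\int[leb]_s f s)%E.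
  rewrite -(ge0_integral_translate (epoch p n w) mf); last first.
    by move=> s; rewrite /f EFinM; apply: mule_ge0; rewrite // lee_fin.
  apply: eq_integral => u _; rewrite /f -EFinM; congr ((_ * _%:R)%:E).
  by rewrite lerDl [next_epoch h p w]epochS ltrD2l.
apply: eq_integral => s _; rewrite /f /g /=; congr (_%:E).
rewrite mulrAC; congr (_ * _); rewrite mulrAC -natrM mulnb; congr (_%:R * _); congr (nat_of_bool _).
rewrite /during; case: (boolP (valid h w)) => //= hv.
case: (ltP (last_epoch h w) s) => //= ls.
rewrite (le_trans (valid_epoch_le p hv) (ltW ls)) /=.
apply/andP/forallP => [[/forallP hk sp] k'|hk].
  by have [->//|kp] := eqVneq k' p; have := hk k'; rewrite kp.
by split; [apply/forallP => k'; rewrite hk implybT|exact: hk].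
Qed.

Definition entry_mass h j k := (\int[P]_w (([&& valid h w & [forall l, last_epoch h w < next_epoch h l w]])%:R *
  expR (- eps * last_epoch h w) * coalescence_at_last h j k w)%:E)%E.

Definition rate (j k : 'I_N) : R := if j == k then 0 else theta.

Lemma decayE j k u : decay theta j k u = expR (- rate j k * u).
Proof. by rewrite /decay /rate; case: eqP => // _; rewrite oppr0 mul0r expR0. Qed.

Lemma rate_ge0 j k : 0 <= rate j k.
Proof. by rewrite /rate; case: ifP. Qed.

(** Outside of ties exactly one clock [p] rings first, the history lasts from
    its last message to this ring, and the identity is [integral_discount] on
    that interval. *)
Lemma balance_path h j k w :
  (forall p q, next_epoch h p w = next_epoch h q w -> p = q) ->
  ((([&& valid h w & [forall l, last_epoch h w < next_epoch h l w]])%:R *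
     expR (- eps * last_epoch h w) * coalescence_at_last h j k w)%:E =
   (eps + rate j k)%:E * \int[leb]_s ((during h s w)%:R * expR (- eps * s) * coalescence h j k s w)%:E
   + \sum_(p < N) ((fires h p w)%:R * expR (- eps * next_epoch h p w) * coalescence h j k (next_epoch h p w) w)%:E)%E.
Proof.
move=> notie.
have [/andP[hv /forallP hl]|nC] := boolP [&& valid h w & [forall l, last_epoch h w < next_epoch h l w]]; last first.
  rewrite !mul0r integral0_eq ?mule0 ?add0e ?big1//.
    move=> p _; rewrite (_ : fires h p w = false) ?mul0r//; apply/negP => /and3P[hv hl /forallP ht].
    case/negP: nC; rewrite hv; apply/forallP => l.
    by have [->//|lp] := eqVneq l p; have := ht l; rewrite lp => /(lt_trans hl).
  move=> s _; rewrite (_ : during h s w = false) ?mul0r//; apply/negP => /and3P[hv hl /forallP ht].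
  by case/negP: nC; rewrite hv; apply/forallP => l; exact: lt_trans hl (ht l).
have i0 : 'I_N by exact: Ordinal (ltn_trans (ltnSn 0) hN).
have [p _ pmin] := arg_minP (fun l => next_epoch h l w) (isT : xpredT i0).
have dE s : during h s w = (last_epoch h w < s < next_epoch h p w).
  rewrite /during hv /=; congr (_ && _); apply/forallP/idP => [/(_ p)//|sp l].
  exact: lt_le_trans sp (pmin l isT).
have fE q : fires h q w = (q == p).
  apply/idP/eqP => [/and3P[_ _ /forallP ht]|->].
    apply/eqP; apply: contraT => qp; have := ht p; rewrite eq_sym qp /=.
    by rewrite ltNge pmin.
  rewrite /fires hv hl; apply/forallP => l; apply/implyP => lp.
  rewrite lt_neqAle pmin// andbT; apply: contra_neq lp => /notie //.
rewrite (bigD1 p)//= big1 ?adde0; last by move=> q /negbTE qp; rewrite fE qp !mul0r.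
rewrite fE eqxx !mul1r /coalescence.
under eq_integral => s _.
  rewrite dE decayE mulrA (mulrC _ (coalescence_at_last h j k w)) -!mulrA EFinM.
  over.
rewrite ge0_integralZl//; last 2 first.
- apply/measurable_EFinP; apply: measurable_funM.
    by apply/measurable_fun_natb/measurable_and; exact: measurable_fun_ltr.
  apply: measurable_funM; first by apply: measurableT_comp => //; exact: measurable_funM.
  by apply: measurableT_comp => //; apply: measurable_funM => //; exact: measurable_funB.
- by rewrite lee_fin coalescence_at_last_ge0.
rewrite muleCA integral_discount//; last exact: rate_ge0.
by rewrite decayE -EFinM -EFinD; congr (_%:E); ring.
Qed.

Lemma measurable_Delta_rcp h : history_measurable (id : Om -> Om) h.
Proof.
move=> k i _; split => // q.
by apply: (measurable_fun_bool true) => //; rewrite setTI;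
  rewrite [X in measurable X](_ : _ = rcp k i @^-1` [set q])//; apply/seteqP; split => w /= /eqP.
Qed.

Lemma measurable_epochT k n : measurable_fun setT (epoch k n).
Proof. exact: measurable_epoch. Qed.

Lemma fires_measurable {d} {U : measurableType d} (pr : U -> Om) h p j k :
  history_measurable pr h -> (forall q, measurable_fun setT (fun u => next_epoch h q (pr u))) ->
  measurable_fun setT (fun u => ((fires h p (pr u))%:R * expR (- eps * next_epoch h p (pr u)) *
    coalescence h j k (next_epoch h p (pr u)) (pr u))%:E).
Proof.
move=> hm mn.
apply/measurable_EFinP; apply: measurable_funM; last exact: (measurable_coalescence theta j k hm (mn p)).
apply: measurable_funM; last by apply: measurableT_comp => //; apply: measurable_funM => //; exact: mn.
apply: measurable_fun_natb; apply: measurable_and; first exact: (measurable_valid hm).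
apply: measurable_and; first by apply: measurable_fun_ltr; [exact: (measurable_last_epoch hm)|exact: mn].
by apply: measurable_forall => l; case: (l != p) => //=; apply: measurable_fun_ltr; exact: mn.
Qed.

Lemma exit_mass_measurable h p j k : measurable_fun setT
  (fun w => ((fires h p w)%:R * expR (- eps * next_epoch h p w) * coalescence h j k (next_epoch h p w) w)%:E).
Proof.
apply: (fires_measurable (pr := id : Om -> Om)) => [|q]; first exact: measurable_Delta_rcp.
exact: (measurable_epochT q (sent_count h q).+1).
Qed.

Lemma during_coalescence_measurable h j k : measurable_fun [set: Om * measurableTypeR R]
  (fun z => ((during h z.2 z.1)%:R * coalescence h j k z.2 z.1)%:E).
Proof.
have mn q : measurable_fun [set: Om * measurableTypeR R] (fun z => next_epoch h q z.1).
  by apply: (measurableT_comp (measurable_epochT _ _)).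
have hm : history_measurable (fst : Om * measurableTypeR R -> Om) h.
  move=> l i ih; split => [|q]; first exact: (measurableT_comp (mDelta l i)).
  have [_ /(_ q) mq] := measurable_Delta_rcp ih.
  exact: (measurableT_comp mq).
apply/measurable_EFinP; apply: measurable_funM; last exact: (measurable_coalescence theta j k hm measurable_snd).
apply: measurable_fun_natb; apply: measurable_and; first exact: (measurable_valid hm).
apply: measurable_and; first by apply: measurable_fun_ltr; [exact: (measurable_last_epoch hm)|exact: measurable_snd].
by apply: measurable_forall => l; exact: measurable_fun_ltr.
Qed.

Lemma discounted_coalescence_measurable h j k : measurable_fun [set: Om * measurableTypeR R]
  (fun z => ((during h z.2 z.1)%:R * expR (- eps * z.2) * coalescence h j k z.2 z.1)%:E).
Proof.
have /measurable_EFinP mc := during_coalescence_measurable h j k.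
apply/measurable_EFinP; under eq_fun do rewrite mulrAC.
apply: measurable_funM => //; apply: measurableT_comp => //; exact: measurable_funM.
Qed.

Lemma entry_mass_measurable h j k : measurable_fun setT
  (fun w => (([&& valid h w & [forall l, last_epoch h w < next_epoch h l w]])%:R *
    expR (- eps * last_epoch h w) * coalescence_at_last h j k w)%:E).
Proof.
have hm : history_measurable (id : Om -> Om) h by exact: measurable_Delta_rcp.
have mn l := measurable_epochT l (sent_count h l).+1.
apply/measurable_EFinP; apply: measurable_funM; last exact: (measurable_coalescence_at_last theta j k hm).
apply: measurable_funM; last first.
  by apply: measurableT_comp => //; apply: measurable_funM => //; exact: (measurable_last_epoch hm).
apply: measurable_fun_natb; apply: measurable_and; first exact: (measurable_valid hm).
by apply: measurable_forall => l; apply: measurable_fun_ltr; [exact: (measurable_last_epoch hm)|exact: mn].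
Qed.

Lemma integrand_ge0 (b : bool) h j k s t w : 0 <= b%:R * expR t * coalescence h j k s w.
Proof. by apply: mulr_ge0; [apply: mulr_ge0|]; rewrite ?ler0n ?expR_ge0 ?coalescence_ge0. Qed.

(** Each of the [N] clocks takes out weight at rate [m^-1]. *)
Lemma balance h j k : (entry_mass h j k =
  (eps + rate j k + N%:R * m^-1)%:E * occupation h j k)%E.
Proof.
have mocc : measurable_fun setT (fun w => \int[leb]_s ((during h s w)%:R * expR (- eps * s) *
    coalescence h j k s w)%:E)%E.
  apply: (@measurable_fun_fubini_tonelli_F _ _ _ _ _ leb
   (fun z => ((during h z.2 z.1)%:R * expR (- eps * z.2) * coalescence h j k z.2 z.1)%:E)).
    exact: discounted_coalescence_measurable.
  by move=> z; rewrite lee_fin integrand_ge0.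
have occ0 w : (0 <= \int[leb]_s ((during h s w)%:R * expR (- eps * s) * coalescence h j k s w)%:E)%E.
  by apply: integral_ge0 => s _; rewrite lee_fin integrand_ge0.
have mf := exit_mass_measurable h.
have c0 : 0 <= eps + rate j k by rewrite addr_ge0 ?rate_ge0// ltW.
transitivity (\int[P]_w ((eps + rate j k)%:E * \int[leb]_s ((during h s w)%:R * expR (- eps * s) * coalescence h j k s w)%:E
   + \sum_(p < N) ((fires h p w)%:R * expR (- eps * next_epoch h p w) * coalescence h j k (next_epoch h p w) w)%:E))%E.
  apply: ae_eq_integral => //.
  - exact: entry_mass_measurable.
  - apply: emeasurable_funD; first exact: emeasurable_funM.
    by apply: emeasurable_sum => p; exact: mf.
  - by apply: filterS noties => w notie _ /=; rewrite balance_path// => p q; exact: notie.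
rewrite ge0_integralD//; last 4 first.
- by move=> w _; rewrite mule_ge0.
- exact: emeasurable_funM.
- by move=> w _; apply: sume_ge0 => p _; rewrite lee_fin integrand_ge0.
- by apply: emeasurable_sum => p; exact: mf.
rewrite ge0_integralZl//.
rewrite ge0_integral_sum//; last by move=> p w _; rewrite lee_fin integrand_ge0.
rewrite -[X in (X + _)%E]/(_ * occupation h j k)%E.
rewrite (eq_bigr (fun=> (m^-1%:E * occupation h j k)%E)); last by move=> p _; rewrite -(exit_mass_occupation h p j k).
rewrite esum_cst muleA -EFinM [X in _ = (X * _)%E]EFinD ge0_muleDl//.
by rewrite lee_fin mulr_ge0// invr_ge0 ltW.
Qed.

Lemma Delta_gt0 k n : {ae P, forall w, 0 < Delta k n w}.
Proof.
have m1 : measurable [set w | Delta k n w <= 0].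
  rewrite (_ : [set w | _] = Delta k n @^-1` `]-oo, 0]%classic).
    by rewrite -[X in measurable X]setTI; exact: mDelta.
  by apply/seteqP; split => w /=; rewrite in_itv.
exists [set w | Delta k n w <= 0]; split => //.
- by rewrite Dlaw /exponential_df lexx oppr0 mul0r expR0 subrr.
- by move=> w /= /negP; rewrite -leNgt.
Qed.

(** What enters [(p, q) :: h] is what leaves [h] through the clock of [p], when
    the recipient is [q]. The recipient is independent of the clocks and of the
    previous recipients, hence the factor [1 / (N - 1)]; the two lines move to
    their ancestors. *)
Lemma entry_mass_cons h p q j k : entry_mass ((p, q) :: h) j k =
  ((if q == p then 0 else (N.-1%:R)^-1 * m^-1)%:E *
   occupation h (relabel (p, q) j) (relabel (p, q) k))%E.
Proof.
set j' := relabel _ j; set k' := relabel _ k.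
pose n := sent_count h p; pose i : ('I_N * nat) + ('I_N * nat) := inr (p, n).
pose T (w : Om) : R := (fires h p w)%:R * expR (- eps * next_epoch h p w) * coalescence h j' k' (next_epoch h p w) w.
have mT : measurable_fun setT (fun w => (T w)%:E) by exact: exit_mass_measurable.
have mq : measurable_fun setT (fun w => (rcp p n w == q)%:R : R).
  by apply: measurable_fun_natb; have [_] := @measurable_Delta_rcp ((p, q) :: h) p n ltac:(by rewrite /= eqxx add1n).
transitivity (\int[P]_w ((rcp p n w == q)%:R%:E * (T w)%:E))%E.
  apply: ae_eq_integral => //.
  - exact: entry_mass_measurable.
  - by apply: emeasurable_funM => //; exact/measurable_EFinP.
  apply: filterS (Delta_gt0 p n.+1) => w D0 _; rewrite -EFinM; congr (_%:E).
  rewrite -[coalescence_at_last _ _ _ _]/(coalescence h j' k' (next_epoch h p w) w) -[last_epoch (_ :: _) w]/(next_epoch h p w).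
  rewrite /T [RHS]mulrA [X in _ = X * _]mulrA -natrM mulnb; do 2 congr (_ * _).
  congr (nat_of_bool _)%:R.
  rewrite /fires /=; case: (valid h w); rewrite ?andbF//=.
  case: (last_epoch h w < next_epoch h p w); rewrite ?andbF//= -/n andbC; case: (rcp p n w == q); rewrite ?andbF//=.
  rewrite !andbT; apply/forallP/forallP => [hl l|hl l].
    by apply/implyP => lp; have := hl l; rewrite !next_epochE /= eq_sym (negbTE lp) add0n.
  have := hl l; rewrite !next_epochE /=; have [->|lp] := eqVneq l p.
    by move=> _; rewrite add1n [X in _ < X]epochS ltrDl D0.
  by rewrite add0n.
pose T1 := g_sigma_algebraType (clock_events i); pose T2 := g_sigma_algebraType (other_events i).
have mT2 : @measurable_fun _ _ T2 _ setT (fun w => (T w)%:E).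
  have mD l l' : @measurable_fun _ _ T2 _ setT (Delta l l') by exact: Delta_other.
  have mE l l' : @measurable_fun _ _ T2 _ setT (epoch l l') by exact: (measurable_epoch (pr := id : T2 -> Om)).
  have hm : history_measurable (id : T2 -> Om) h.
    move=> l l' ll'; split => // q'.
    by apply: rcp_other; apply/eqP => -[lp ln]; move: ll'; rewrite lp ln ltnn.
  exact: (fires_measurable p j' k' hm (fun l => mE l (sent_count h l).+1)).
have mq1 : @measurable_fun _ _ T1 _ setT (fun w => (rcp p n w == q)%:R : R).
  apply: measurable_fun_natb; apply: (measurable_fun_bool true) => //; rewrite setTI.
  apply: sub_gen_smallest; exists [set q] => //; rewrite setTI.
  by apply/seteqP; split => w /= /eqP.
have T0 w : (0 <= (T w)%:E)%E by rewrite lee_fin integrand_ge0.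
have := @decouple_sigma _ _ R P (clock_events i) (other_events i) (@clock_events_measurable i)
  (@other_events_measurable i) (@indep_clock i) (fun z => ((rcp p n z.1 == q)%:R%:E * (T z.2)%:E))%E.
move=> ->; last 2 first.
- apply: emeasurable_funM; last exact: (measurableT_comp mT2).
  by apply/measurable_EFinP; exact: (measurableT_comp mq1).
- by move=> z; rewrite mule_ge0// lee_fin.
under eq_integral => w2 _ /=.
  rewrite ge0_integralZr//; last exact/measurable_EFinP.
  over.
rewrite ge0_integralZl//; last by apply: integral_ge0 => w _; rewrite lee_fin.
rewrite -[X in (_ * X)%E]/(exit_mass h p j' k') exit_mass_occupation muleA; congr (_ * _)%E.
have -> : (\int[P]_w (rcp p n w == q)%:R%:E = P (rcp p n @^-1` [set q]))%E.
  rewrite -[X in P X]setIT -integral_indic//.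
  by apply: eq_integral => w _; rewrite indicE; congr ((nat_of_bool _)%:R%:E); apply/idP/idP => [/eqP e|]; [exact/mem_set|rewrite inE /= => ->].
by rewrite rlaw -EFinM; case: ifP => //; rewrite mul0r.
Qed.

Lemma entry_mass_nil j k : entry_mass [::] j k = (j == k)%:R%:E.
Proof.
transitivity (\int[P]_w (j == k)%:R%:E)%E; last first.
  by have e := probability_setT P; rewrite integral_cst// [X in (_ * X)%E]e mule1.
apply: ae_eq_integral => //.
- exact: (entry_mass_measurable [::]).
- have h0 : {ae P, forall w l, 0 < Delta l 0 w}.
    by apply: filter_forall => l; exact: Delta_gt0.
  apply: filterS h0 => w D0 _; congr (_%:E); rewrite /= mulr0 expR0 mulr1.
  rewrite (_ : [forall l, _] = true) ?mul1r//; apply/forallP => l.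
  by rewrite next_epochE epochS epoch0 add0r.
Qed.

Fixpoint histories (n : nat) : seq (seq ('I_N * 'I_N)) := if n is n'.+1 then
  [seq e :: h | e <- enum {: 'I_N * 'I_N}, h <- histories n'] else [:: [::]].

Definition occupation_level n j k := (\sum_(h <- histories n) occupation h j k)%E.

Lemma occupation_ge0 h j k : (0 <= occupation h j k)%E.
Proof.
by apply: integral_ge0 => w _; apply: integral_ge0 => s _; rewrite lee_fin integrand_ge0.
Qed.

Lemma occupation_level_ge0 n j k : (0 <= occupation_level n j k)%E.
Proof. by apply: sume_ge0 => h _; exact: occupation_ge0. Qed.

Let a : R := N%:R * m^-1.
Let c : R := (N.-1%:R)^-1 * m^-1.
Let K j k : R := eps + rate j k + a.

Let a_gt0 : 0 < a. Proof. by rewrite mulr_gt0 ?invr_gt0// ltr0n; exact: ltn_trans hN. Qed.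
Let K_gt0 j k : 0 < K j k.
Proof. by rewrite /K ltr_wpDl ?a_gt0// addr_ge0 ?rate_ge0// ltW. Qed.

Lemma occupation_level0 j k : occupation_level 0 j k = ((j == k)%:R / K j k)%:E.
Proof.
rewrite /occupation_level /= big_seq1; have := balance [::] j k; rewrite entry_mass_nil -/a -/(K j k).
by move=> /(eq_inv_mule (K_gt0 j k)) ->; rewrite -EFinM mulrC.
Qed.

Lemma occupation_levelS n j k : (occupation_level n.+1 j k = (K j k)^-1%:E *
  \sum_(e : 'I_N * 'I_N) (if e.2 == e.1 then 0 else c)%:E * occupation_level n (relabel e j) (relabel e k))%E.
Proof.
have -> : occupation_level n.+1 j k = (\sum_(e : 'I_N * 'I_N) \sum_(h <- histories n) occupation (e :: h) j k)%E.
  by rewrite /occupation_level /= big_allpairs_dep big_enum.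
rewrite ge0_sume_distrr; last first.
  move=> e _; rewrite mule_ge0 ?occupation_level_ge0// lee_fin; case: ifP => // _.
  by rewrite mulr_ge0// invr_ge0// ltW.
apply: eq_bigr => -[p q] _ /=.
rewrite [X in (_ * (_ * X))%E]/occupation_level ge0_sume_distrr; last by move=> h _; exact: occupation_ge0.
rewrite ge0_sume_distrr; last first.
  move=> h _; rewrite mule_ge0 ?occupation_ge0// lee_fin; case: ifP => // _.
  by rewrite mulr_ge0// invr_ge0// ltW.
apply: eq_bigr => h _; rewrite -entry_mass_cons balance -/a -/(K j k).
by rewrite muleA -EFinM mulVf ?gt_eqF// mul1e.
Qed.

(** By symmetry, the weight of all the histories of a given length depends on
    the pair [j, k] only through [j == k]. *)
Fixpoint occupation_diag n : R := if n is n'.+1 then a * occupation_diag n' / (eps + a) else (eps + a)^-1.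

(** The rate at which two distinct ancestral lines meet: among the [N (N - 1)]
    possible messages, those from [j] to [k] and from [k] to [j]. *)
Let beta : R := 2 * c.

Fixpoint occupation_off n : R := if n is n'.+1 then
  ((a - beta) * occupation_off n' + beta * occupation_diag n') / (eps + theta + a) else 0.

Lemma sum_pairs_neq : \sum_(e : 'I_N * 'I_N) (if e.2 == e.1 then 0 else c) = a.
Proof.
rewrite -(pair_bigA _ (fun p q : 'I_N => if q == p then 0 else c)) /=.
under eq_bigr => p _.
  rewrite (bigD1 p)//= eqxx add0r (eq_bigr (fun=> c)); last by move=> q /negbTE ->.
  rewrite sumr_const cardC1 card_ord; over.
rewrite sumr_const card_ord -mulrnA -mulr_natl /a /c natrM.
have n1 : N.-1%:R != 0 :> R by rewrite pnatr_eq0 -lt0n; move: hN; case: (N) => [|[]].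
have m1 : m != 0 by rewrite gt_eqF.
by move: n1; move: (N.-1%:R : R) (N%:R : R) => x y x0; field; rewrite ?x0 ?m1.
Qed.

(** A message merges the lines of [j != k] exactly when it joins [j] and [k], in
    either direction. *)
Lemma occupation_levelE n j k : occupation_level n j k = (if j == k then occupation_diag n else occupation_off n)%:E.
Proof.
elim: n j k => [|n IH] j k.
  by rewrite occupation_level0 /K /rate; case: eqP => _; rewrite ?mul0r// addr0 mul1r.
rewrite occupation_levelS.
have -> : (\sum_(e : 'I_N * 'I_N) (if e.2 == e.1 then 0 else c)%:E * occupation_level n (relabel e j) (relabel e k) =
   (if j == k then a * occupation_diag n else (a - beta) * occupation_off n + beta * occupation_diag n)%:E)%E.
  under eq_bigr do rewrite IH -EFinM.
  rewrite sumEFin; congr (_%:E).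
  have [->|jk] := eqVneq j k.
    under eq_bigr do rewrite eqxx.
    by rewrite -mulr_suml sum_pairs_neq.
  transitivity (\sum_(e : 'I_N * 'I_N) ((if e.2 == e.1 then 0 else c) * occupation_off n +
     (if e == (k, j) then c * (occupation_diag n - occupation_off n) else 0) +
     (if e == (j, k) then c * (occupation_diag n - occupation_off n) else 0))).
    apply: eq_bigr => -[p q] _; rewrite /relabel /= !xpair_eqE.
    have [qj|qj] := eqVneq j q; have [qk|qk] := eqVneq k q.
    - by rewrite qj qk eqxx in jk.
    - rewrite -qj andbT andbF addr0.
      have [->|pk] := eqVneq p k; last by rewrite addr0.
      by rewrite (negbTE jk); ring.
    - rewrite -qk andbT andbF addr0 [j == p]eq_sym.
      have [->|pj] := eqVneq p j; last by rewrite addr0.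
      by rewrite eq_sym (negbTE jk); ring.
    - by rewrite (negbTE jk) !andbF !addr0.
  rewrite !big_split /= -mulr_suml sum_pairs_neq -!big_mkcond !big_pred1_eq /beta; ring.
by rewrite -EFinM /K /rate; case: eqP => _ /=; rewrite ?addr0 mulrC.
Qed.

Lemma geometric_occupation_diag : series occupation_diag @ \oo --> eps^-1.
Proof.
have ea0 : 0 < eps + a by rewrite addr_gt0 ?a_gt0.
rewrite (_ : occupation_diag = geometric (eps + a)^-1 (a / (eps + a))).
  rewrite (_ : eps^-1 = (eps + a)^-1 / (1 - a / (eps + a))).
    apply: cvg_geometric_series.
    rewrite ger0_norm; last by apply: divr_ge0; apply: ltW; rewrite ?a_gt0.
    rewrite ltr_pdivrMr// mul1r.
    by rewrite ltrDr.
  rewrite -[X in X - _](divff (lt0r_neq0 ea0)) -mulrBl addrK invfM invrK.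
  by rewrite mulrCA mulVf ?gt_eqF// mulr1.
apply/funext => n; rewrite /geometric /=; elim: n => [|n IH] /=; first by rewrite expr0 mulr1.
by rewrite IH exprSr; ring.
Qed.

Let b_ge0 : 0 <= a - beta.
Proof.
have n1 : 1 <= N.-1%:R :> R by rewrite ler1n; move: hN; case: (N) => [|[]].
have nE : N%:R = N.-1%:R + 1 :> R by rewrite natr1 prednK// (ltn_trans _ hN).
rewrite /a /beta /c mulrA -mulrBl mulr_ge0 ?invr_ge0 ?(ltW m0)// subr_ge0 nE.
by rewrite ler_pdivrMr ?(lt_le_trans ltr01)//; nra.
Qed.

Let beta_gt0 : 0 < beta.
Proof.
rewrite /beta /c !mulr_gt0 ?invr_gt0// ltr0n; move: hN; by case: (N) => [|[]].
Qed.

Lemma occupation_off_ge0 n : 0 <= occupation_off n.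
Proof.
have i0 : (0 < N)%N by exact: ltn_trans hN.
have := occupation_level_ge0 n (Ordinal i0) (Ordinal hN).
by rewrite occupation_levelE.
Qed.

Lemma occupation_diag_ge0 n : 0 <= occupation_diag n.
Proof.
have i0 : (0 < N)%N by exact: ltn_trans hN.
by have := occupation_level_ge0 n (Ordinal i0) (Ordinal i0); rewrite occupation_levelE eqxx lee_fin.
Qed.

(** Summing the recursion gives the affine equation of which the announced value
    [x] is the unique solution; the partial sums are nondecreasing and stay
    below [x], so that they converge and their limit solves the equation. *)
Lemma series_occupation_off : series occupation_off @ \oo --> beta / eps / (eps + theta + beta).
Proof.
pose L := eps + theta + a.
have L0 : 0 < L by rewrite ltr_wpDl ?a_gt0// addr_ge0// ltW.
have Lb0 : 0 < eps + theta + beta by rewrite ltr_wpDl ?beta_gt0// addr_ge0// ltW.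
pose x := beta / eps / (eps + theta + beta).
have xE : L * x = (a - beta) * x + beta / eps.
  rewrite /L -[X in _ = _ + X](divfK (lt0r_neq0 Lb0) (beta / eps)) -/x; ring.
have rec M : series occupation_off M.+1 = ((a - beta) * series occupation_off M + beta * series occupation_diag M) / L.
  rewrite /series /= big_nat_recl//= add0r !big_distrr /= -big_split /= -mulr_suml.
  by congr (_ / _); apply: eq_bigr => i _.
have Dle M : series occupation_diag M <= eps^-1.
  have ndD : nondecreasing_seq (series occupation_diag).
    by apply: nondecreasing_series => n _ _; exact: occupation_diag_ge0.
  have := nondecreasing_cvgn_le ndD (cvgP _ geometric_occupation_diag) M.
  by rewrite (cvg_lim _ geometric_occupation_diag).
have Xle M : series occupation_off M <= x.
  elim: M => [|M IH].
    by rewrite /series /= big_geq// /x !divr_ge0// ltW// beta_gt0.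
  rewrite rec ler_pdivrMr// [x * L]mulrC xE lerD// ler_wpM2l// ltW// beta_gt0.
have ndX : nondecreasing_seq (series occupation_off).
  by apply: nondecreasing_series => n _ _; exact: occupation_off_ge0.
have cX : cvgn (series occupation_off).
  by apply: nondecreasing_is_cvgn => //; exists x => _ [n _ <-].
pose l := limn (series occupation_off).
have c1 : (fun M => series occupation_off M.+1) @ \oo --> l by rewrite cvg_shiftS.
have c2 : (fun M => series occupation_off M.+1) @ \oo --> ((a - beta) * l + beta * eps^-1) / L.
  under eq_fun do rewrite rec.
  apply: cvgMl; apply: cvgD; first exact: cvgMr.
  by apply: cvgMr; exact: geometric_occupation_diag.
have lE : l = ((a - beta) * l + beta * eps^-1) / L.
  by rewrite -(cvg_lim (@Rhausdorff R) c2); exact/esym/(cvg_lim (@Rhausdorff R) c1).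
rewrite (_ : beta / eps / _ = l)//; apply: (mulIf (lt0r_neq0 Lb0)); rewrite divfK ?gt_eqF//.
have : L * l = (a - beta) * l + beta / eps by move: lE => /(congr1 (fun z => z * L)); rewrite divfK ?gt_eqF// mulrC.
rewrite /L => e; rewrite (_ : l * _ = (eps + theta + a) * l - (a - beta) * l); last by ring.
by rewrite e; ring.
Qed.

Lemma occupation_total j k : j != k ->
  (\sum_(0 <= n <oo) occupation_level n j k = (beta / eps / (eps + theta + beta))%:E)%E.
Proof.
move=> jk; under eq_eseriesr do rewrite occupation_levelE (negbTE jk).
apply/cvg_lim => //; apply: cvg_EFin; first by apply: nearW => n; rewrite sumEFin.
by apply: cvg_trans series_occupation_off; apply: near_eq_cvg; apply: nearW => n; rewrite /= sumEFin.
Qed.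

(** For [theta = 0], the probability that the ancestral lines of [j] and [k] at
    time [t] have met; in general the same with the decay accumulated before
    they met. *)
Definition coal_prob j k t := (\sum_(0 <= n <oo) \sum_(h <- histories n)
  \int[P]_w ((during h t w)%:R * coalescence h j k t w)%:E)%E.

Lemma during_term_ge0 h j k t w : (0 <= ((during h t w)%:R * coalescence h j k t w)%:E)%E.
Proof. by rewrite lee_fin mulr_ge0// coalescence_ge0. Qed.

Lemma measurable_coal_term h j k : measurable_fun [set: measurableTypeR R]
  (fun t => \int[P]_w ((during h t w)%:R * coalescence h j k t w)%:E)%E.
Proof.
exact: (@measurable_fun_fubini_tonelli_G _ _ _ _ _ P _ (during_coalescence_measurable h j k)
  (fun z => during_term_ge0 h j k z.2 z.1)).
Qed.

Lemma coal_prob_ge0 j k t : (0 <= coal_prob j k t)%E.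
Proof.
apply: nneseries_ge0 => n _ _; apply: sume_ge0 => h _; apply: integral_ge0 => w _.
exact: during_term_ge0.
Qed.

Lemma measurable_coal_prob j k : measurable_fun [set: measurableTypeR R] (coal_prob j k).
Proof.
rewrite /coal_prob; apply: (ge0_emeasurable_sum (P := xpredT)).
- move=> n t _ _; apply: sume_ge0 => h _; apply: integral_ge0 => w _.
  exact: during_term_ge0.
- by move=> n _; apply: emeasurable_sum => h; exact: measurable_coal_term.
Qed.

(** For a meeting time T that is exponential of rate [beta], this is the Laplace
    transform in [t] of the expectation of exp (- theta T) on the event that T
    is at most [t]. Tonelli's theorem reduces the integral to
    [occupation_total]. *)
Lemma laplace_coal_prob j k : j != k ->
  (\int[leb]_t ((expR (- eps * t))%:E * coal_prob j k t) =
   (beta / eps / (eps + theta + beta))%:E)%E.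
Proof.
move=> jk; rewrite -(occupation_total jk).
have mterm := measurable_coal_term.
have term0 h t : (0 <= \int[P]_w ((during h t w)%:R * coalescence h j k t w)%:E)%E.
  by apply: integral_ge0 => w _; exact: during_term_ge0.
have mdisc : measurable_fun [set: measurableTypeR R] (fun t => (expR (- eps * t))%:E).
  by apply/measurable_EFinP; apply: measurableT_comp => //; exact: measurable_funM.
have disc0 t : (0 <= (expR (- eps * t))%:E)%E by rewrite lee_fin expR_ge0.
transitivity (\int[leb]_t \sum_(0 <= n <oo) \sum_(h <- histories n)
   ((expR (- eps * t))%:E * \int[P]_w ((during h t w)%:R * coalescence h j k t w)%:E))%E.
  apply: eq_integral => t _; rewrite /coal_prob -nneseriesZl; last first.
    by move=> n _; apply: sume_ge0 => h _.
  by apply: eq_eseriesr => n _; rewrite ge0_sume_distrr.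
rewrite integral_nneseries//; last 2 first.
- by move=> n; apply: emeasurable_sum => h; apply: emeasurable_funM => //; exact: mterm.
- by move=> n t _; apply: sume_ge0 => h _; rewrite mule_ge0.
apply: eq_eseriesr => n _; rewrite ge0_integral_sum//; last 2 first.
- by move=> h; apply: emeasurable_funM => //; exact: mterm.
- by move=> h t _; rewrite mule_ge0.
apply: eq_bigr => h _.
pose f (z : Om * measurableTypeR R) := ((during h z.2 z.1)%:R * expR (- eps * z.2) * coalescence h j k z.2 z.1)%:E.
have f0 z : (0 <= f z)%E by rewrite lee_fin integrand_ge0.
have := fubini_tonelli (m1 := P) (m2 := leb) f (discounted_coalescence_measurable h j k) f0.
rewrite /fubini_F /fubini_G /f /= -/(occupation h j k) => ->.
apply: eq_integral => t _; rewrite -ge0_integralZl//; last first.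
- by move=> w _; exact: during_term_ge0.
- exact: (measurable_fun_pair1 (f := fun z => ((during h z.2 z.1)%:R * coalescence h j k z.2 z.1)%:E) t (during_coalescence_measurable h j k)).
by apply: eq_integral => w _; rewrite -EFinM mulrA [expR _ * _]mulrC.
Qed.

End Clocks.

(** * Free increments along two ancestral lines *)

Section NestedIndependence.
Context {dsp : measure_display} {Om : measurableType dsp} {R : realType}.
Variable P : probability Om R.

(** Independence between the components, and of the increments of each
    component, gives joint independence: a finite rectangle is grouped by
    component, on a common range [iota 0 M] of increments. *)
Lemma independent_nested (L : finType) (F : L -> set (set Om)) (G : L * nat -> set (set Om)) :
  independent_family P F -> (forall l, independent_family P (fun i => G (l, i))) ->
  (forall x, G x setT) ->
  (forall l (s : seq nat) (A : nat -> set Om), (forall i, G (l, i) (A i)) -> F l (\bigcap_(i in [set` s]) A i)) ->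
  independent_family P G.
Proof.
move=> indF indG GT GF s A us GA.
pose M := (\max_(x <- s) x.2).+1.
pose B x := if x \in s then A x else setT.
have GB x : G x (B x) by rewrite /B; case: ifPn => [/GA|_].
pose C l := \bigcap_(i in [set` iota 0 M]) B (l, i).
have sM x : x \in s -> (x.2 < M)%N by move=> xs; rewrite ltnS; exact: leq_bigmax_seq.
have -> : \bigcap_(x in [set` s]) A x = \bigcap_(l in [set` enum L]) C l.
  apply/seteqP; split => [w sw l _ i _|w lw [l i] /= xs].
    by rewrite /B; case: ifPn => // xs; exact: sw.
  have := lw l (mem_enum L l) i; rewrite /B xs; apply.
  by apply: (introT idP); rewrite mem_iota add0n; exact: sM xs.
rewrite indF ?enum_uniq//; last by move=> l _; apply: GF => i; exact: GB.
transitivity (\prod_(l <- enum L) \prod_(i <- iota 0 M) P (B (l, i)))%E.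
  by apply: eq_bigr => l _; apply: (indG l); rewrite ?iota_uniq// => i _; exact: GB.
rewrite -(big_allpairs (F := fun x => P (B x))).
transitivity (\prod_(x <- [seq (l, i) | l <- enum L, i <- iota 0 M] | x \in s) P (A x))%E.
  rewrite [RHS]big_mkcond; apply: eq_bigr => x _; rewrite /B; case: ifP => // _.
  exact: probability_setT.
rewrite -big_filter; apply: perm_big; apply: uniq_perm => //.
  apply: filter_uniq; apply: allpairs_uniq; rewrite ?enum_uniq ?iota_uniq// => -[? ?] [? ?] //.
move=> x; rewrite mem_filter; case: (boolP (x \in s)) => [xs|_]; rewrite ?andFb// andTb.
apply/allpairsP; exists x; rewrite mem_enum mem_iota add0n /= sM//; split => //.
by case: (x).
Qed.

End NestedIndependence.

Section Increments.
Context {dsp : measure_display} {Om : measurableType dsp} {R : realType}.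
Variable P : probability Om R.
Context {N : nat}.
(* the free components in the direction lambda, and the real part of the exponent *)
Variables (f : 'I_N -> R -> Om -> R) (theta : R).

(** Histories list the most recent message first, so that the last lapse of [u]
    has index [size h]. *)
Fixpoint displacement (u : nat -> R) (h : seq ('I_N * 'I_N)) (j k : 'I_N) (w : Om) : R :=
  (f j (u (size h).+1) w - f j (u (size h)) w) - (f k (u (size h).+1) w - f k (u (size h)) w) +
  (if h is e :: h' then displacement u h' (relabel e j) (relabel e k) w else 0).

Fixpoint decay_product (u : nat -> R) (h : seq ('I_N * 'I_N)) (j k : 'I_N) : R :=
  decay theta j k (u (size h).+1 - u (size h)) *
  (if h is e :: h' then decay_product u h' (relabel e j) (relabel e k) else 1).

Variables (u : nat -> R).
Let xi (x : 'I_N * nat) (w : Om) := f x.1 (u x.2.+1) w - f x.1 (u x.2) w.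
Hypothesis mxi : forall x, measurable_fun setT (xi x).
Hypothesis ind_xi : independent_family P (fun x => sigma_of measurable (xi x)).
Variable phi : nat -> R[i].
Hypothesis char_xi : forall j n, char_rv P (xi (j, n)) = phi n.
Hypothesis phi_norm : forall n, phi n * (phi n)^*%C = (expR (- theta * (u n.+1 - u n)))%:C.

Let Gx x := sigma_of measurable (xi x).
Let Gm x : Gx x `<=` measurable.
Proof. by move=> _ [B mB <-]; rewrite setTI -[X in measurable X]setTI; exact: mxi. Qed.
Let GT x : Gx x setT. Proof. by exists setT => //; rewrite preimage_setT setTI. Qed.
Let GI x : setI_closed (Gx x).
Proof.
move=> _ _ [A mA <-] [B mB <-]; exists (A `&` B); first exact: measurableI.
by rewrite preimage_setI !setTI.
Qed.
Let Gxi x : meas_in (Gx x) (xi x).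
Proof. by move=> _ B mB; apply: sub_gen_smallest; exists B. Qed.
Let GJm (J : set ('I_N * nat)) : \bigcup_(x in J) Gx x `<=` measurable.
Proof. by move=> A [x _]; exact: Gm. Qed.

Lemma xi_meas_in (J : set ('I_N * nat)) l n : J (l, n) ->
  meas_in (\bigcup_(x in J) Gx x) (fun w => f l (u n.+1) w - f l (u n) w).
Proof. by move=> Jx; exact: (@meas_in_bigcup _ _ _ _ Gx J (l, n) _ Jx (@Gxi (l, n))). Qed.

Lemma displacement_meas_in (J : set ('I_N * nat)) h j k : (forall x, (x.2 <= size h)%N -> J x) ->
  meas_in (\bigcup_(x in J) Gx x) (displacement u h j k).
Proof.
elim: h j k => [|e h IH] j k hJ /=.
  by apply: measurable_funD => //; apply: measurable_funB; apply: xi_meas_in; exact: hJ.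
apply: measurable_funD; last by apply: IH => x xh; apply: hJ; exact: leqW.
by apply: measurable_funB; apply: xi_meas_in; exact: hJ.
Qed.

(** Independent components give the product of [phi] and of its conjugate; on a
    single component the difference vanishes. *)
Lemma char_increment_diff n j k :
  char_rv P (fun w => xi (j, n) w - xi (k, n) w) = (decay theta j k (u n.+1 - u n))%:C.
Proof.
rewrite /decay; have [->|jk] := eqVneq j k.
  by under [X in char_rv P X]eq_fun do rewrite subrr; exact: char_rv0.
rewrite (char_rv_indepD (f := xi (j, n)) (g := fun w => - xi (k, n) w)
  (F := \bigcup_(x in [set (j, n)]) Gx x) (G := \bigcup_(x in [set (k, n)]) Gx x)).
- by rewrite char_rvN// !char_xi phi_norm.
- exact: GJm.
- exact: GJm.
- by apply: (indep_group GI GT Gm ind_xi) => x -> [] /eqP; exact/negP.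
- exact: xi_meas_in.
- by apply: measurable_funN; exact: xi_meas_in.
Qed.

Lemma char_displacement h j k : char_rv P (displacement u h j k) = (decay_product u h j k)%:C.
Proof.
elim: h j k => [|e h IH] j k /=.
  rewrite mulr1 -char_increment_diff; congr char_rv; apply/funext => w; by rewrite addr0.
rewrite rmorphM /= -IH -char_increment_diff.
apply: (char_rv_indepD (F := \bigcup_(x in [set x | x.2 = (size h).+1]) Gx x)
  (G := \bigcup_(x in [set x | (x.2 <= size h)%N]) Gx x)
  (f := fun w => xi (j, (size h).+1) w - xi (k, (size h).+1) w)) => //.
- by apply: (indep_group GI GT Gm ind_xi) => x /= ->; rewrite ltnn.
- by apply: measurable_funB; exact: xi_meas_in.
- exact: displacement_meas_in.
Qed.

End Increments.

(** * Free motion observed at independent random times *)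

Section AlmostSureLimit.
Context {dsp : measure_display} {Om : measurableType dsp} {R : realType}.
Variable P : probability Om R.

(** A variable with values at most 1 and expectation 1 is 1 almost surely. As
    [z] may fail to be measurable, the proof works with an upper limit of the
    [z_ n], truncated to [-1, 1]. *)
Lemma ae_limit_eq1 (z_ : nat -> Om -> R) (z : Om -> R) :
  (forall n, measurable_fun setT (z_ n)) -> (forall n w, `|z_ n w| <= 1) ->
  {ae P, forall w, z_ n w @[n --> \oo] --> z w} ->
  (\int[P]_w z_ n w) @[n --> \oo] --> (1 : R) ->
  {ae P, forall w, z w = 1}.
Proof.
move=> mz z1 cz Ez.
pose g w : R := fine (limn_esup (fun n => (z_ n w)%:E)).
have mg : measurable_fun setT g.
  apply: measurableT_comp => //; apply: measurable_fun_limn_esup => n.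
  exact/measurable_EFinP.
have gz w : z_ n w @[n --> \oo] --> z w -> g w = z w.
  move=> cw; rewrite /g; have cE : (z_ n w)%:E @[n --> \oo] --> (z w)%:E.
    by apply: cvg_EFin => //; exact: nearW.
  by rewrite is_cvg_limn_esupE ?(cvg_lim _ cE)//; apply: cvgP cE.
have gle : {ae P, forall w, g w <= 1}.
  apply: filterS cz => w cw; rewrite gz//; apply: (cvgr_to_le cw); apply: nearW => n.
  by have := z1 n w; rewrite ler_norml => /andP[].
have gabs : {ae P, forall w, `|g w| <= 1}.
  apply: filterS cz => w cw; rewrite gz//; apply: (cvgr_to_le (cvg_norm cw)).
  exact: nearW.
pose g' w := Num.max (-1) (Num.min 1 (g w)).
have mg' : measurable_fun setT g'.
  by apply: measurable_maxr => //; exact: measurable_minr.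
have gg' : {ae P, forall w, g w = g' w}.
  apply: filterS gabs => w; rewrite ler_norml /g' => /andP[h1 h2].
  by rewrite (min_idPr h2) (max_idPr h1).
have g'1 w : g' w <= 1 by rewrite /g' ge_max ge_min lexx /= andbT; lra.
have bg' : bounded_rv g'.
  split => //; exists 1 => w; rewrite ler_norml g'1 andbT /g' le_max lexx//.
have Eg : \int[P]_w g' w = 1.
  have c : \int[P]_w z_ n w @[n --> \oo] --> \int[P]_w g' w.
    apply: (exp_cvg mz mg' z1); apply: filterS2 cz gg' => w cw <-.
    by rewrite gz.
  by rewrite -(cvg_lim (@Rhausdorff R) c) (cvg_lim (@Rhausdorff R) Ez).
have b1 : bounded_rv (fun w => 1 - g' w) by apply: bounded_rvB => //; exact: bounded_rv_cst.
have : (\int[P]_w `|(1 - g' w)%:E| = 0)%E.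
  under eq_integral => w _ do rewrite gee0_abs ?lee_fin ?subr_ge0 ?g'1//.
  by rewrite -expE// expB ?exp_cst ?Eg ?subrr//; exact: bounded_rv_cst.
move=> /ae_eq_integral_abs -/(_ measurableT) h.
have {}h := h (iffRL (measurable_EFinP _ _) b1.1).
apply: filterS3 h cz gg' => w /(_ I) [] /eqP; rewrite subr_eq0 => /eqP e cw.
by rewrite gz// => ->.
Qed.

End AlmostSureLimit.

(** A random time is approximated by times with values in a countable mesh, on
    which a process is jointly measurable in the time and the outcome. The mesh
    point [mesh n u] lies strictly after [u] and [meshl n u] strictly before, so
    that they detect the two one-sided limits; at [u = 0] the latter is [0]. *)
Section Mesh.
Context {R : realType}.
Implicit Types (u : R) (n : nat).

Definition cell n u := Num.truncn (n.+1%:R * u).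
Definition mesh n u : R := (cell n u).+1%:R / n.+1%:R.
Definition meshl n u : R := (cell n u).-1%:R / n.+1%:R.

Lemma mesh_ge0 n u : 0 <= mesh n u. Proof. by rewrite divr_ge0. Qed.
Lemma meshl_ge0 n u : 0 <= meshl n u. Proof. by rewrite divr_ge0. Qed.

Lemma mesh_gt n u : u < mesh n u.
Proof. by rewrite ltr_pdivlMr// mulrC; exact: truncnS_gt. Qed.

Lemma le_mesh n : {homo mesh n : u v / u <= v}.
Proof.
move=> u v uv; rewrite ler_pM2r ?invr_gt0// ler_nat ltnS; apply: le_truncn.
by rewrite ler_pM2l.
Qed.

Lemma mesh_le n u : 0 <= u -> mesh n u <= u + n.+1%:R^-1.
Proof.
move=> u0; rewrite /mesh -natr1 mulrDl mul1r lerD2r ler_pdivrMr// mulrC truncn_le.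
exact: mulr_ge0.
Qed.

Lemma meshl_le_mesh n u : meshl n u <= mesh n u.
Proof. by rewrite ler_pM2r ?invr_gt0// ler_nat (leq_trans (leq_pred _)). Qed.

Lemma meshl_lt n u : 0 < u -> meshl n u < u.
Proof.
move=> u0; rewrite /meshl /cell; case E : (Num.truncn _) => [|k] /=; first by rewrite mul0r.
rewrite ltr_pdivrMr// (lt_le_trans (y := k.+1%:R)) ?ltr_nat// -E mulrC truncn_le.
by rewrite mulr_ge0// ltW.
Qed.

Lemma meshl_ge n u : mesh n u - 2 / n.+1%:R <= meshl n u.
Proof.
rewrite /mesh /meshl -mulrBl ler_pM2r ?invr_gt0// lerBlDr -natrD ler_nat.
by case: (cell n u) => [//|k] /=; rewrite addn2.
Qed.

Lemma meshl0 n : meshl n 0 = 0.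
Proof. by rewrite /meshl /cell mulr0 truncn0 mul0r. Qed.

Lemma cvg_harm c : c / n.+1%:R @[n --> \oo] --> (0 : R).
Proof. by rewrite -[X in _ --> X](mulr0 c); apply: cvgMr; exact: cvg_harmonic. Qed.

Lemma cvg_mesh u : 0 <= u -> mesh n u @[n --> \oo] --> u.
Proof.
move=> u0; apply: (@squeeze_cvgr _ _ _ _ (cst u) (fun n => u + 1 / n.+1%:R)).
- by apply: nearW => n; rewrite mul1r mesh_le// andbT ltW// mesh_gt.
- exact: cvg_cst.
- by rewrite -[X in _ --> X]addr0; apply: cvgD; [exact: cvg_cst|exact: cvg_harm].
Qed.

Lemma cvg_mesh_gap u : mesh n u - meshl n u @[n --> \oo] --> (0 : R).
Proof.
apply: (@squeeze_cvgr _ _ _ _ (cst 0) (fun n => 2 / n.+1%:R)).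
- by apply: nearW => n; rewrite subr_ge0 meshl_le_mesh /= lerBlDr addrC -lerBlDr; exact: meshl_ge.
- exact: cvg_cst.
- exact: cvg_harm.
Qed.

Lemma cvg_meshl u : 0 <= u -> meshl n u @[n --> \oo] --> u.
Proof.
move=> u0; rewrite (_ : (fun n => _) = fun n => mesh n u - (mesh n u - meshl n u)); last first.
  by apply/funext => n; lra.
rewrite -[X in _ --> X]subr0; apply: cvgB; [exact: cvg_mesh|exact: cvg_mesh_gap].
Qed.

Lemma right_lim_mesh (F : R -> R) u (l : R) : 0 <= u -> F s @[s --> u^'+] --> l ->
  F (mesh n u) @[n --> \oo] --> l.
Proof.
move=> u0 /cvg_at_rightP; apply; split; [by move=> n; exact: mesh_gt|exact: cvg_mesh].
Qed.

Lemma left_lim_meshl (F : R -> R) u (l : R) : 0 < u -> F s @[s --> u^'-] --> l ->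
  F (meshl n u) @[n --> \oo] --> l.
Proof.
move=> u0 /cvg_at_leftP; apply; split; [by move=> n; exact: meshl_lt|].
by apply: cvg_meshl; exact: ltW.
Qed.

Lemma measurable_cell {d} {U : measurableType d} (T : U -> R) n :
  measurable_fun setT T -> measurable_fun setT (fun w => cell n (T w)).
Proof.
move=> mT _ B _; rewrite setTI.
rewrite (_ : _ @^-1` B = \bigcup_(q in B) [set w | cell n (T w) = q]); last first.
  by apply/seteqP; split => [w|w [q Bq] /= ->//]; exists (cell n (T w)) => //.
apply: bigcup_measurable => q _.
have le_meas p : measurable [set w | (p <= cell n (T w))%N].
  case: p => [|p]; first by rewrite (_ : [set _ | _] = setT)//; exact/seteqP.
  rewrite (_ : [set _ | _] = T @^-1` `[p.+1%:R / n.+1%:R, +oo[%classic).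
    by rewrite -[X in measurable X]setTI; apply: mT.
  by apply/seteqP; split => w /=; rewrite in_itv/= andbT ler_pdivrMr// mulrC /cell truncn_gt_nat.
rewrite (_ : [set _ | _] = [set w | (q <= cell n (T w))%N] `\` [set w | (q.+1 <= cell n (T w))%N]).
  exact: measurableD.
apply/seteqP; split => w /=; first by move=> ->; rewrite leqnn ltnn.
by move=> [h /negP]; rewrite -leqNgt => h'; apply/eqP; rewrite eqn_leq h h'.
Qed.

Lemma measurable_mesh {d} {U : measurableType d} (T : U -> R) n :
  measurable_fun setT T -> measurable_fun setT (fun w => mesh n (T w)).
Proof.
by move=> /(@measurable_cell _ _ T n); apply: (measurableT_comp (f := fun q => q.+1%:R / n.+1%:R : R)).
Qed.

Lemma measurable_meshl {d} {U : measurableType d} (T : U -> R) n :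
  measurable_fun setT T -> measurable_fun setT (fun w => meshl n (T w)).
Proof.
by move=> /(@measurable_cell _ _ T n); apply: (measurableT_comp (f := fun q => q.-1%:R / n.+1%:R : R)).
Qed.

End Mesh.

Lemma cos_measurable {R : realType} : measurable_fun setT (@cos R).
Proof. by apply: continuous_measurable_fun; exact: continuous_cos. Qed.

Lemma sin_measurable {R : realType} : measurable_fun setT (@sin R).
Proof. by apply: continuous_measurable_fun; exact: continuous_sin. Qed.

(** The scalars [f l t] are the projections of the free components, with
    information in [Gf]; the clocks and recipients have theirs in the
    independent [Ge]. *)
Section FreeMotion.
Context {dsp : measure_display} {Om : measurableType dsp} {R : realType}.
Variable P : probability Om R.
Context {N : nat}.
Variables (f : 'I_N -> R -> Om -> R) (theta : R).
Hypothesis theta0 : 0 <= theta.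
Variables (Delta : 'I_N -> nat -> Om -> R) (rcp : 'I_N -> nat -> Om -> 'I_N).

Lemma eq_displacement (u v : nat -> R) h j k w : (forall i, (i <= (size h).+1)%N -> u i = v i) ->
  displacement f u h j k w = displacement f v h j k w.
Proof.
elim: h j k => [|e h IH] j k uv /=; first by rewrite !uv.
by rewrite !uv//= IH// => i ih; apply: uv; exact: leqW.
Qed.

Lemma eq_decay_product (u v : nat -> R) (h : seq ('I_N * 'I_N)) j k : (forall i, (i <= (size h).+1)%N -> u i = v i) ->
  decay_product theta u h j k = decay_product theta v h j k.
Proof.
elim: h j k => [|e h IH] j k uv /=; first by rewrite !uv.
by rewrite !uv//= IH// => i ih; apply: uv; exact: leqW.
Qed.

Lemma decay_product_bounded (u : nat -> R) (h : seq ('I_N * 'I_N)) j k : (forall n, u n <= u n.+1) ->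
  0 <= decay_product theta u h j k <= 1.
Proof.
move=> um; have decay01 i (j' k' : 'I_N) : 0 <= decay theta j' k' (u i.+1 - u i) <= 1.
  rewrite ltW ?decay_gt0//= /decay; case: ifP => // _.
  by rewrite -expR0 ler_expR mulNr oppr_le0 mulr_ge0// subr_ge0.
elim: h j k => [|e h IH] j k /=; first by rewrite mulr1.
have /andP[a0 a1] := decay01 (size h).+1 j k.
have /andP[b0 b1] := IH (relabel e j) (relabel e k).
by rewrite mulr_ge0//= mulr_ile1.
Qed.

Lemma cvg_displacement (u_ : nat -> nat -> R) (u : nat -> R) h j k w :
  (forall l i, f l (u_ n i) w @[n --> \oo] --> f l (u i) w) ->
  displacement f (u_ n) h j k w @[n --> \oo] --> displacement f u h j k w.
Proof.
move=> cu; elim: h j k => [|e h IH] j k /=.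
  by apply: cvgD; [apply: cvgB; apply: cvgB|exact: cvg_cst].
by apply: cvgD => //; apply: cvgB; apply: cvgB.
Qed.

Lemma cvg_decay_product (u_ : nat -> nat -> R) (u : nat -> R) (h : seq ('I_N * 'I_N)) j k :
  (forall i, u_ n i @[n --> \oo] --> u i) ->
  decay_product theta (u_ n) h j k @[n --> \oo] --> decay_product theta u h j k.
Proof.
move=> cu; have cd i (j' k' : 'I_N) : decay theta j' k' (u_ n i.+1 - u_ n i) @[n --> \oo] -->
    decay theta j' k' (u i.+1 - u i).
  rewrite /decay; case: ifP => _; first exact: cvg_cst.
  apply: continuous_cvg; first exact: continuous_expR.
  by apply: cvgMr; exact: cvgB.
elim: h j k => [|e h IH] j k /=; first by rewrite mulr1; under eq_fun do rewrite mulr1; exact: cd.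
by apply: cvgM => //; exact: cd.
Qed.

Lemma measurable_displacement {d} {U : measurableType d} (pr : U -> Om) (v : U -> nat -> R) (h : seq ('I_N * 'I_N)) j k :
  (forall l i, (i <= (size h).+1)%N -> measurable_fun setT (fun z => f l (v z i) (pr z))) ->
  measurable_fun setT (fun z => displacement f (v z) h j k (pr z)).
Proof.
elim: h j k => [|e h IH] j k mv /=.
  by apply: measurable_funD => //; apply: measurable_funB; apply: measurable_funB; exact: mv.
apply: measurable_funD; last by apply: IH => l i ih; apply: mv; exact: leqW.
by apply: measurable_funB; apply: measurable_funB; exact: mv.
Qed.

Lemma measurable_decay_product {d} {U : measurableType d} (v : U -> nat -> R) (h : seq ('I_N * 'I_N)) j k :
  (forall i, (i <= (size h).+1)%N -> measurable_fun setT (fun z => v z i)) ->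
  measurable_fun setT (fun z => decay_product theta (v z) h j k).
Proof.
elim: h j k => [|e h IH] j k mv /=.
  by apply: measurable_funM => //; apply: measurable_decay; apply: measurable_funB; exact: mv.
apply: measurable_funM; last by apply: IH => i ih; apply: mv; exact: leqW.
by apply: measurable_decay; apply: measurable_funB; exact: mv.
Qed.

Notation last_epoch := (last_epoch Delta).
Notation valid := (valid Delta rcp).
Notation during := (during Delta rcp).

(** The successive epochs of the history, ended by the current time [s]. *)
Fixpoint times (h : seq ('I_N * 'I_N)) (s : R) (w : Om) (i : nat) : R :=
  if h is e :: h' then if (i <= (size h').+1)%N then times h' (last_epoch h w) w i else s
  else if i is 0%N then 0 else s.

Lemma times_end h s w : times h s w (size h).+1 = s.
Proof. by case: h => //= e h; rewrite ltnn. Qed.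

Lemma displacement_times_cons e h s j k w : displacement f (times (e :: h) s w) (e :: h) j k w =
  (f j s w - f j (last_epoch (e :: h) w) w) - (f k s w - f k (last_epoch (e :: h) w) w) +
  displacement f (times h (last_epoch (e :: h) w) w) h (relabel e j) (relabel e k) w.
Proof.
rewrite [LHS]/=  ltnn leqnn times_end; congr (_ + _).
by apply: eq_displacement => i ih; rewrite ih.
Qed.

(** The increments of the free motion are independent along increasing times
    only. *)
Lemma times_mono h s w : valid h w -> last_epoch h w <= s ->
  forall i, 0 <= times h s w i <= times h s w i.+1.
Proof.
elim: h s => [|e h IH] s /=; first by move=> _ s0 [|i] /=; rewrite s0 lexx.
move=> /and3P[vh lt _] ls i.
have {}IH := IH _ vh (ltW lt).
case: (leqP i (size h).+1) => ih; last by rewrite ltnNge (ltnW ih) /= (le_trans _ ls) ?lexx// (le_trans (last_epoch_ge0 vh))// ltW.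
case: ltnP => ih'; first exact: IH.
have -> : i = (size h).+1 by apply/eqP; rewrite eqn_leq ih.
by rewrite times_end ls (le_trans (last_epoch_ge0 vh))// ltW.
Qed.

(** The component where the ancestral line of [j] sits at time 0. *)
Fixpoint root (h : seq ('I_N * 'I_N)) (j : 'I_N) : 'I_N :=
  if h is e :: h' then root h' (relabel e j) else j.

Lemma coalescence_decay_product h j k s w :
  coalescence Delta theta h j k s w = (root h j == root h k)%:R * decay_product theta (times h s w) h j k.
Proof.
elim: h j k s => [|e h IH] j k s.
  by rewrite /coalescence /= subr0 mulr1 mulrC.
rewrite /coalescence [coalescence_at_last _ _ _ _ _ _]/= [LHS]mulrC [decay_product _ _ _ _ _]/= ltnn leqnn times_end.
rewrite (@eq_decay_product _ (times h (last_epoch (e :: h) w) w)); last by move=> i ih; rewrite ih.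
by rewrite [LHS]mulrC [RHS]mulrCA; congr (_ * _); exact: (IH (relabel e j) (relabel e k) (last_epoch (e :: h) w)).
Qed.

Variables (Gf Ge : set (set Om)).
Hypotheses (Gfm : Gf `<=` measurable) (Gem : Ge `<=` measurable).
Hypothesis ind : indep P <<s Gf >> <<s Ge >>.
Hypothesis fG : forall l t, 0 <= t -> meas_in Gf (f l t).
Hypothesis DeltaG : forall k n, meas_in Ge (Delta k n).
Hypothesis rcpG : forall k n q, meas_in Ge (fun w => rcp k n w == q).
Hypothesis f_displacement : forall u : nat -> R, 0 <= u 0%N -> (forall n, u n <= u n.+1) ->
  forall h j k, char_rv P (displacement f u h j k) = (decay_product theta u h j k)%:C.
Hypothesis f_cont : forall c : R, exists g : R -> R, [/\ continuous g, g 0 = 1 &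
  forall l s t, 0 <= s -> s <= t -> \int[P]_w cos (c * (f l t w - f l s w)) = g (t - s)].
Hypothesis f_regular : {ae P, forall w l,
  (forall t : R, 0 <= t -> cvg (f l s w @[s --> t^'+])) /\
  (forall t : R, 0 < t -> cvg (f l s w @[s --> t^'-]) /\
     (f l t w = lim (f l s w @[s --> t^'+]) \/ f l t w = lim (f l s w @[s --> t^'-])))}.

Let T1 := g_sigma_algebraType Gf.
Let T2 := g_sigma_algebraType Ge.

(** Evaluation at a random index is measurable because the index takes countably
    many values. *)
Lemma measurable_countable_eval {d1 d2} {U1 : measurableType d1} {U2 : measurableType d2}
    (F : nat -> U1 -> R) (K : U2 -> nat) :
  (forall n, measurable_fun setT (F n)) -> measurable_fun setT K ->
  measurable_fun [set: U1 * U2] (fun z => F (K z.2) z.1).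
Proof.
move=> mF mK _ B mB; rewrite setTI.
rewrite (_ : _ @^-1` B = \bigcup_q ((F q @^-1` B) `*` (K @^-1` [set q]))); last first.
  apply/seteqP; split => [[w1 w2] /= h|[w1 w2] [q _ [/= h e]]]; last by rewrite -e in h.
  by exists (K w2).
apply: bigcup_measurable => q _; apply: measurableX.
  by rewrite -[X in measurable X]setTI; exact: mF.
by rewrite -[X in measurable X]setTI; exact: mK.
Qed.

Lemma measurable_mesh_eval l n (T : Om -> R) : meas_in Ge T ->
  measurable_fun [set: T1 * T2] (fun z => f l (mesh n (T z.2)) z.1) /\
  measurable_fun [set: T1 * T2] (fun z => f l (meshl n (T z.2)) z.1).
Proof.
move=> mT; have mK := @measurable_cell _ _ T2 T n mT; split.
  apply: (@measurable_countable_eval _ _ T1 T2 (fun q => f l (q.+1%:R / n.+1%:R)) _ _ mK) => q.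
  by apply: fG; rewrite divr_ge0.
apply: (@measurable_countable_eval _ _ T1 T2 (fun q => f l (q.-1%:R / n.+1%:R)) _ _ mK) => q.
by apply: fG; rewrite divr_ge0.
Qed.

(** For [p] large the argument is smaller than [pi] in absolute value, where the
    cosine is injective. *)
Lemma cos_multiples_eq1 (x : R) : (forall p, cos (p.+1%:R^-1 * x) = 1) -> x = 0.
Proof.
move=> h; pose p := Num.truncn `|x|.
have xp : p.+1%:R^-1 * `|x| < 1.
  by rewrite mulrC ltr_pdivrMr// mul1r truncnS_gt.
have pi1 : 1 <= pi :> R by have := pi_ge2 R; lra.
have : cos (p.+1%:R^-1 * `|x|) = cos 0.
  by rewrite cos0; case: (ger0P x) => _; rewrite ?mulrN ?cosN h.
move/cos_inj; rewrite !in_itv /= lexx pi_ge0 mulr_ge0 ?invr_ge0// (ltW (lt_le_trans xp pi1)).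
move=> /(_ isT isT) /eqP; rewrite mulf_eq0 invr_eq0 pnatr_eq0 /= normr_eq0.
by move/eqP.
Qed.

(* limits along the mesh *)
(** The free motion has no jump at a time that is independent of it, hence is
    there the limit of its values on the mesh. By independence the expectation
    of the cosine of a multiple of the increment across the time is the value of
    [g] at the mesh gap, which tends to 1; so the cosine of a multiple of the
    jump is 1. *)
Lemma cvg_mesh_random_time l (T : Om -> R) : meas_in Ge T -> (forall w, 0 <= T w) ->
  {ae P, forall w, f l (mesh n (T w)) w @[n --> \oo] --> f l (T w) w}.
Proof.
move=> mT T0.
pose Rl w := lim (f l s w @[s --> (T w)^'+]).
pose Ll w := if T w == 0 then f l 0 w else lim (f l s w @[s --> (T w)^'-]).
have cR : {ae P, forall w, f l (mesh n (T w)) w @[n --> \oo] --> Rl w}.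
  by apply: filterS f_regular => w /(_ l) [h _]; exact: (right_lim_mesh (F := fun s => f l s w) (T0 w) (h _ (T0 w))).
have cL : {ae P, forall w, f l (meshl n (T w)) w @[n --> \oo] --> Ll w}.
  apply: filterS f_regular => w /(_ l) [_ h]; rewrite /Ll; case: eqVneq => [->|Tn0].
    by under eq_fun do rewrite meshl0; exact: cvg_cst.
  have T_gt0 : 0 < T w by rewrite lt_neqAle eq_sym Tn0 T0.
  exact: (left_lim_meshl (F := fun s => f l s w) T_gt0 (h _ T_gt0).1).
(* The multiples [p.+1%:R^-1] of the jump leave it no value but 0. *)
have J p : {ae P, forall w, cos (p.+1%:R^-1 * (Rl w - Ll w)) = 1}.
  have [g [gc g0 gE]] := f_cont p.+1%:R^-1.
  pose H n (z : T1 * T2) := cos (p.+1%:R^-1 * (f l (mesh n (T z.2)) z.1 - f l (meshl n (T z.2)) z.1)).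
  have mH n : measurable_fun setT (H n).
    have [m1 m2] := measurable_mesh_eval l n mT.
    apply: (measurableT_comp (f := @cos R)); first exact: cos_measurable.
    exact: (measurable_funM (@measurable_cst _ _ _ _ setT _) (measurable_funB m1 m2)).
  have H1 n z : `|H n z| <= 1 by rewrite ler_norml cos_geN1 cos_le1.
  apply: (@ae_limit_eq1 _ Om R P (fun n w => H n (w, w)) (fun w => cos (p.+1%:R^-1 * (Rl w - Ll w)))).
  - by move=> n; exact: (measurable_diag Gfm Gem (mH n)).
  - by move=> n w; exact: H1.
  - apply: filterS2 cR cL => w c1 c2; rewrite /H /=; apply: continuous_cvg; first exact: continuous_cos.
    by apply: cvgMr; exact: cvgB.
  - have E n : \int[P]_w H n (w, w) = \int[P]_w g (mesh n (T w) - meshl n (T w)).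
      rewrite (decouple_bounded Gfm Gem ind (mH n) (H1 n)); apply: eq_Rintegral => w _.
      by rewrite /H -(gE l) ?meshl_ge0 ?meshl_le_mesh.
    under eq_fun do rewrite E.
    rewrite (_ : 1 = \int[P]_w 1); last by rewrite exp_cst.
    apply: (@exp_cvg _ _ _ _ _ _ 1) => //.
    + move=> n; apply: (measurableT_comp (f := g)); first exact: continuous_measurable_fun.
      have mT' := sub_measurable_fun Gem mT.
      exact: (measurable_funB (@measurable_mesh _ _ _ T n mT') (@measurable_meshl _ _ _ T n mT')).
    + move=> n w; rewrite -(gE l) ?meshl_ge0 ?meshl_le_mesh//.
      apply: exp_abs; last by move=> w'; rewrite ler_norml cos_geN1 cos_le1.
      apply: (measurableT_comp (f := @cos R)); first exact: cos_measurable.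
      apply: measurable_funM => //.
      by apply: measurable_funB; apply: (sub_measurable_fun Gfm); apply: fG; rewrite ?mesh_ge0 ?meshl_ge0.
    + apply: nearW => w; rewrite -g0; apply: continuous_cvg; first exact: gc.
      exact: cvg_mesh_gap.
have J' : {ae P, forall w p, cos (p.+1%:R^-1 * (Rl w - Ll w)) = 1} by exact: ae_foralln.
apply: filterS3 J' cR f_regular => w /cos_multiples_eq1 /eqP; rewrite subr_eq0 => /eqP RL c1 /(_ l) [hr hl].
suff -> : f l (T w) w = Rl w by [].
move: RL; rewrite /Ll; case: eqVneq => [->//|Tn0 RL].
have T_gt0 : 0 < T w by rewrite lt_neqAle eq_sym Tn0 T0.
by case: (hl _ T_gt0).2 => -> //; rewrite -RL.
Qed.

Lemma history_measurable_epochs h : history_measurable Delta rcp (id : T2 -> Om) h.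
Proof. by move=> k i _; split=> [|q]; [exact: DeltaG|exact: rcpG]. Qed.

Lemma times_meas_in h (s : Om -> R) i : meas_in Ge s -> meas_in Ge (fun w => times h (s w) w i).
Proof.
elim: h s => [|e h IH] s ms /=; first by case: i => // ?; exact: measurable_cst.
case: (i <= _)%N => //; apply: (@IH (fun w => next_epoch Delta h e.1 w)).
exact: (measurable_next_epoch_sender (@history_measurable_epochs (e :: h))).
Qed.

Lemma during_meas_in h t : meas_in Ge (fun w => (during h t w)%:R : R).
Proof.
apply: measurable_fun_natb; rewrite /during.
have hm := @history_measurable_epochs h.
apply: measurable_and; first exact: (measurable_valid hm).
apply: measurable_and.
  by apply: measurable_fun_ltr => //; exact: (measurable_last_epoch hm).
apply: measurable_forall => k; apply: measurable_fun_ltr => //.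
apply: (measurable_epoch (pr := id : T2 -> Om)) => i _; exact: DeltaG.
Qed.

(** The variable [Y] coincides, while the history [h] lasts, with a displacement
    sampled at the epochs of [h]. Sampling on the mesh instead makes it jointly
    measurable, so that the free motion can be integrated first, the epochs
    being fixed; the mesh is then refined. *)
Section Limit.
Variables (h : seq ('I_N * 'I_N)) (j k : 'I_N) (t : R) (Y : Om -> R).
Hypothesis mY : measurable_fun setT Y.
Hypothesis YE : {ae P, forall w, during h t w -> Y w = displacement f (times h t w) h j k w}.

Let b w : R := (during h t w)%:R.
Let un n w i : R := mesh n (times h t w i).

Let un_displacement_meas n : measurable_fun [set: T1 * T2] (fun z => displacement f (un n z.2) h j k z.1).
Proof.
apply: (@measurable_displacement _ (T1 * T2)%type fst (fun z => un n z.2)) => l i _.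
apply: (measurable_mesh_eval l n (T := fun w => times h t w i) _).1.
by apply: (@times_meas_in h (fun=> t)); exact: measurable_cst.
Qed.

Let b_meas : measurable_fun [set: T1 * T2] (fun z => b z.2).
Proof. by apply: (measurableT_comp (f := b : T2 -> R)) => //; exact: during_meas_in. Qed.

Let b01 w : `|b w| <= 1. Proof. by rewrite /b; case: during; rewrite ?normr1 ?normr0. Qed.

Let b_mesh (g : R -> R) (v : R) (mg : measurable_fun setT g) (g1 : forall x, `|g x| <= 1) n :
  (forall w2, during h t w2 -> \int[P]_w1 g (displacement f (un n w2) h j k w1) = v *
     decay_product theta (un n w2) h j k) ->
  \int[P]_w (b w * g (displacement f (un n w) h j k w)) =
  \int[P]_w (b w * (v * decay_product theta (un n w) h j k)).
Proof.
move=> E; pose H (z : T1 * T2) := b z.2 * g (displacement f (un n z.2) h j k z.1).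
have mH : measurable_fun setT H.
  by apply: measurable_funM => //; apply: (measurableT_comp (f := g)).
have H1 z : `|H z| <= 1 by rewrite normrM mulr_ile1.
rewrite (decouple_bounded Gfm Gem ind mH H1); apply: eq_Rintegral => w _.
rewrite /H /= expZ; last first.
  split; last by exists 1 => w1; exact: g1.
  exact: (measurableT_comp mg (measurable_section1 Gfm w (@un_displacement_meas n))).
by rewrite /b; case E' : (during h t w); rewrite ?mul0r// E.
Qed.

Let ae_jump : {ae P, forall w l i, 0 <= times h t w i ->
  f l (un n w i) w @[n --> \oo] --> f l (times h t w i) w}.
Proof.
have : {ae P, forall w l i, f l (mesh n (Num.max 0 (times h t w i))) w @[n --> \oo] -->
    f l (Num.max 0 (times h t w i)) w}.
  apply: filter_forall => l; apply: ae_foralln => i.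
  apply: (@cvg_mesh_random_time l (fun w => Num.max 0 (times h t w i))); last by move=> w; rewrite le_max lexx.
  apply: measurable_maxr; first exact: measurable_cst.
  by apply: (@times_meas_in h (fun=> t)); exact: measurable_cst.
by apply: filterS => w wl l i /max_idPr e; have := wl l i; rewrite e.
Qed.

Let during_limit (g : R -> R) (v : R) : continuous g -> (forall x, `|g x| <= 1) -> `|v| <= 1 ->
  (forall n w2, during h t w2 -> \int[P]_w1 g (displacement f (un n w2) h j k w1) = v *
     decay_product theta (un n w2) h j k) ->
  \int[P]_w (b w * g (Y w)) = \int[P]_w (b w * (v * decay_product theta (times h t w) h j k)).
Proof.
move=> gc g1 v1 E.
have mg : measurable_fun setT g by exact: continuous_measurable_fun.
have mb : measurable_fun setT b by apply: (sub_measurable_fun Gem); exact: during_meas_in.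
have mdamp (q : Om -> nat -> R) : (forall i, meas_in Ge (fun w => q w i)) ->
    measurable_fun setT (fun w => decay_product theta (q w) h j k).
  move=> mq; apply: (sub_measurable_fun Gem (f := fun w => decay_product theta (q w) h j k)).
  by apply: (@measurable_decay_product _ T2).
have mt i : meas_in Ge (fun w => times h t w i).
  by apply: (@times_meas_in h (fun=> t)); exact: measurable_cst.
have valid_during w : during h t w -> forall i, 0 <= times h t w i <= times h t w i.+1.
  by move=> /and3P[vh lt _]; apply: times_mono => //; exact: ltW.
have mun n i : meas_in Ge (fun w => un n w i) by exact: measurable_mesh.
have bd n w : `|b w * decay_product theta (un n w) h j k| <= 1.
  rewrite /b; case bw : (during h t w); last by rewrite mul0r normr0.
  have /andP[d0 d1] : 0 <= decay_product theta (un n w) h j k <= 1.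
    apply: decay_product_bounded => // i; apply: le_mesh.
    by have /andP[] := valid_during w bw i.
  by rewrite mul1r ger0_norm.
have c1 : (\int[P]_w (b w * g (displacement f (un n w) h j k w))) @[n --> \oo] --> \int[P]_w (b w * g (Y w)).
  apply: (@exp_cvg _ _ _ _ _ _ 1).
  - move=> n; apply: measurable_funM => //; apply: (measurableT_comp mg).
    exact: (measurable_diag Gfm Gem (@un_displacement_meas n)).
  - by apply: measurable_funM => //; exact: measurableT_comp.
  - by move=> n w; rewrite normrM mulr_ile1.
  - apply: filterS2 ae_jump YE => w wl; rewrite /b; case: (boolP (during h t w)) => [dw /(_ isT) ->|_ _].
      apply: cvgMr; apply: continuous_cvg; first exact: gc.
      apply: cvg_displacement => l i; apply: wl.
      by have /andP[] := valid_during w dw i.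
    by under eq_fun do rewrite mul0r; rewrite mul0r; exact: cvg_cst.
have c2 : (\int[P]_w (b w * (v * decay_product theta (un n w) h j k))) @[n --> \oo] -->
    \int[P]_w (b w * (v * decay_product theta (times h t w) h j k)).
  apply: (@exp_cvg _ _ _ _ _ _ 1).
  - by move=> n; apply: measurable_funM => //; apply: measurable_funM => //; exact: mdamp.
  - by apply: measurable_funM => //; apply: measurable_funM => //; exact: mdamp.
  - by move=> n w; rewrite mulrCA normrM mulr_ile1.
  - apply: nearW => w; rewrite /b; case: (boolP (during h t w)) => [dw|_].
      apply: cvgMr; apply: cvgMr; apply: cvg_decay_product => i; apply: cvg_mesh.
      by have /andP[] := valid_during w dw i.
    by under eq_fun do rewrite mul0r; rewrite mul0r; exact: cvg_cst.
rewrite -(cvg_lim (@Rhausdorff R) c1) -(cvg_lim (@Rhausdorff R) c2).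
by under eq_fun do rewrite (b_mesh mg g1 (E _)).
Qed.

Let char_mesh n w2 : during h t w2 ->
  \int[P]_w1 cos (displacement f (un n w2) h j k w1) = decay_product theta (un n w2) h j k /\
  \int[P]_w1 sin (displacement f (un n w2) h j k w1) = 0.
Proof.
move=> /and3P[vh lt _].
have tm := times_mono vh (ltW lt).
have um i : un n w2 i <= un n w2 i.+1 by apply: le_mesh; have /andP[] := tm i.
by have [-> ->] := f_displacement (u := un n w2) (mesh_ge0 _ _) um h j k.
Qed.

Lemma during_cos : \int[P]_w (b w * cos (Y w)) = \int[P]_w (b w * decay_product theta (times h t w) h j k).
Proof.
rewrite (@during_limit cos 1); [|exact: continuous_cos| |by rewrite normr1|].
- by apply: eq_Rintegral => w _; rewrite mul1r.
- by move=> x; rewrite ler_norml cos_geN1 cos_le1.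
- by move=> n w /(char_mesh n)[-> _]; rewrite mul1r.
Qed.

Lemma during_sin : \int[P]_w (b w * sin (Y w)) = 0.
Proof.
rewrite (@during_limit sin 0); [|exact: continuous_sin| |by rewrite normr0|].
- by rewrite -[RHS](exp_cst P); apply: eq_Rintegral => w _; rewrite mul0r mulr0.
- by move=> x; rewrite ler_norml sin_geN1 sin_le1.
- by move=> n w /(char_mesh n)[_ ->]; rewrite mul0r.
Qed.

End Limit.

End FreeMotion.

(** * The dynamics along a history *)

Section Inner.
Context {R : realType} {d : nat}.
Implicit Types u v lam : 'rV[R]_d.

Lemma innerDr lam u v : inner lam (u + v) = inner lam u + inner lam v.
Proof. by rewrite /inner -big_split; apply: eq_bigr => i _; rewrite mxE mulrDr. Qed.

Lemma innerZr lam c u : inner lam (c *: u) = c * inner lam u.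
Proof. by rewrite /inner mulr_sumr; apply: eq_bigr => i _; rewrite mxE mulrCA. Qed.

Lemma innerZl lam c u : inner (c *: lam) u = c * inner lam u.
Proof. by rewrite /inner mulr_sumr; apply: eq_bigr => i _; rewrite mxE mulrA. Qed.

Lemma innerBr lam u v : inner lam (u - v) = inner lam u - inner lam v.
Proof. by rewrite innerDr -scaleN1r innerZr mulN1r. Qed.

Lemma continuous_inner lam : continuous (inner lam).
Proof.
rewrite /inner; apply: continuous_big => [|i _]; first exact: add_continuous.
move=> u; have c := @coord_continuous R 1 d ord0 i u.
exact: (continuous_comp c (@mulrl_continuous R (lam ord0 i) (u ord0 i))).
Qed.

End Inner.

Section Dynamics.
Context {R : realType} {N d : nat} {dsp : measure_display} {Om : measurableType dsp}.
Variables (free x : R -> Om -> 'M[R]_(N, d)) (tau : 'I_N -> nat -> Om -> R)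
  (r : 'I_N -> nat -> Om -> 'I_N) (T : nat -> Om -> R) (lam : 'rV[R]_d) (w : Om).

Definition interval k n (w : Om) := tau k n.+1 w - tau k n w.
Definition recipient k n (w : Om) := r k n.+1 w.
Definition proj_free l s (w : Om) := inner lam (row l (free s w)).

Hypothesis tau0 : forall k, tau k 0%N w = 0.
Hypothesis tauS : forall k n, tau k n w < tau k n.+1 w.
Hypothesis sup : superposition (fun k n => tau k n w) (fun q => T q w).
Hypothesis dyn : sync_dynamics (fun t => free t w) (fun k n => tau k n w)
      (fun k n => r k n w) (fun q => T q w) (fun t => x t w).
Hypothesis free_rlim : forall l k n,
  inner lam (row l (rlim (fun t => free t w) (tau k n w))) = proj_free l (tau k n w) w.

Notation next_epoch := (next_epoch interval).
Notation last_epoch := (last_epoch interval).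
Notation valid := (valid interval recipient).
Notation during := (during interval recipient).

Lemma epoch_interval k n : epoch interval k n w = tau k n w.
Proof.
elim: n => [|n IH]; first by rewrite epoch0 tau0.
by rewrite epochS IH /interval addrC subrK.
Qed.

Lemma tau_le k n n' : (n <= n')%N -> tau k n w <= tau k n' w.
Proof. elim: n' => [|n' IH]; first by rewrite leqn0 => /eqP ->.
rewrite leq_eqVlt => /orP[/eqP ->//|nn']; exact: (le_trans (IH nn') (ltW (tauS _ _))). Qed.

(** A history lasting at time [t] accounts for all the epochs before [t]: its
    last epoch is some [T q], and the next one is an epoch that the history does
    not contain. *)
Lemma last_epoch_superposition h t : valid h w -> last_epoch h w < t -> (forall k, t <= next_epoch h k w) ->
  exists q, [/\ T q w = last_epoch h w, (0 < size h)%N -> (0 < q)%N & T q w < t <= T q.+1 w].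
Proof.
have [T0 TS TE] := sup => vh lt tn.
have [q [qE q0]] : exists q, T q w = last_epoch h w /\ ((0 < size h)%N -> (0 < q)%N).
  case: h {lt tn} vh => [|e h] vh; first by exists 0%N; rewrite T0.
  have /TE[q q0 qE] : exists k n, (0 < n)%N /\ tau k n w = last_epoch (e :: h) w.
    by exists e.1, (sent_count h e.1).+1; rewrite /= next_epochE epoch_interval.
  by exists q.
exists q; split => //; rewrite qE lt /=.
have /TE[k [n [n0 nE]]] : exists2 q', (0 < q')%N & T q' w = T q.+1 w by exists q.+1.
rewrite -nE; case: (ltnP (sent_count h k) n) => kn.
  by rewrite (le_trans (tn k))// next_epochE epoch_interval tau_le.
have := TS q; rewrite -nE qE ltNge => /negP[].
by rewrite (le_trans (tau_le k kn))// -epoch_interval; exact: valid_epoch_le vh.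
Qed.

(** Each message replaces the components by their ancestors, so the difference
    telescopes into free increments along the two lines, plus the difference at
    time 0 of the roots, which vanishes when these agree. The bound
    [t <= next_epoch h k w] is not strict, in order that the induction may take
    [t] to be the next epoch itself. *)
Lemma dynamics_displacement h j k t : valid h w -> last_epoch h w < t -> (forall k, t <= next_epoch h k w) ->
  root h j = root h k ->
  inner lam (row j (x t w)) - inner lam (row k (x t w)) = displacement proj_free (times interval h t w) h j k w.
Proof.
elim: h j k t => [|e h IH] j k t vh lt tn.
  by move=> /= ->; rewrite !subrr addr0.
have [q [qE /(_ isT) q0 tq]] := last_epoch_superposition vh lt tn.
have [_ dynJ dynM] := dyn.
have {}dynM : x t w = rlim (fun t => x t w) (T q w) +
    (free t w - rlim (fun t => free t w) (T q w)) by case/andP: tq => ? ?; exact: dynM.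
have /and3P[vh' ltn' rE] : [&& valid h w, last_epoch h w < next_epoch h e.1 w &
  recipient e.1 (sent_count h e.1) w == e.2] := vh.
move=> rt.
have qtau : T q w = tau e.1 (sent_count h e.1).+1 w by rewrite qE [LHS]next_epochE epoch_interval.
have [jr jo] := dynJ _ _ _ q0 (ltn0Sn _) qtau.
have xE l : inner lam (row l (x t w)) = inner lam (row (relabel e l) (x (T q w) w)) +
    (proj_free l t w - proj_free l (T q w) w).
  rewrite dynM !linearD /= linearN /= innerDr innerBr {2}qtau free_rlim -qtau.
  congr (inner lam _ + _); rewrite /relabel.
  move: rE jr jo; rewrite /recipient => /eqP ->; case: eqVneq => [->//|ne] _.
  by apply.
rewrite displacement_times_cons !xE.
rewrite -(IH _ _ _ vh' ltn')//; last first.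
  move=> l; have := tn l; rewrite /next_epoch /sent_count /= -/(sent_count h l) .
  case: eqVneq => [->//|el]; rewrite add0n => tl; exact: (le_trans (ltW lt)).
by rewrite -/(last_epoch (e :: h) w) -qE; ring.
Qed.

End Dynamics.

(** * Approximation by coalescing histories *)

Section Disjointness.
Context {R : realType} {Om : Type} {N : nat}.
Variables (Delta : 'I_N -> nat -> Om -> R) (rcp : 'I_N -> nat -> Om -> 'I_N) (w : Om).
Hypothesis Delta_pos : forall k n, 0 < Delta k n w.
Hypothesis no_tie : forall k k' n n', epoch Delta k n.+1 w = epoch Delta k' n'.+1 w -> k = k'.
Implicit Types h : seq ('I_N * 'I_N).

Lemma epoch_le k n n' : (n <= n')%N -> epoch Delta k n w <= epoch Delta k n' w.
Proof.
elim: n' => [|n' IH]; first by rewrite leqn0 => /eqP ->.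
rewrite leq_eqVlt => /orP[/eqP ->//|nn']; apply: (le_trans (IH nn')).
by rewrite epochS lerDl ltW.
Qed.

Lemma during_sent_count_le h h' t k : during Delta rcp h t w -> during Delta rcp h' t w ->
  (sent_count h k <= sent_count h' k)%N.
Proof.
move=> /and3P[vh lt _] /and3P[_ _ /forallP /(_ k) nt]; rewrite leqNgt; apply/negP => hh'.
have := lt_le_trans nt (epoch_le k hh'); apply/negP; rewrite -leNgt.
exact: le_trans (valid_epoch_le k vh) (ltW lt).
Qed.

(** The last epoch of a history is the largest among the last epochs of the
    senders, so it is determined by the numbers of messages sent; without ties
    this gives the last sender, then the recipient, and the rest by
    induction. *)
Lemma valid_sent_count_inj h h' : valid Delta rcp h w -> valid Delta rcp h' w ->
  (forall k, sent_count h k = sent_count h' k) -> h = h'.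
Proof.
elim: h h' => [|e h IH] [|e' h'] //=.
- by move=> _ _ /(_ e'.1); rewrite /sent_count /= eqxx.
- by move=> _ _ /(_ e.1); rewrite /sent_count /= eqxx.
move=> vh vh' cE; have last_le g g' f' : valid Delta rcp g w -> (forall k, sent_count g k = sent_count (f' :: g') k) ->
    last_epoch Delta (f' :: g') w <= last_epoch Delta g w.
  move=> vg c; apply: le_trans (valid_epoch_le f'.1 vg).
  by rewrite c /= next_epochE /sent_count /= eqxx add1n.
have lE : last_epoch Delta (e :: h) w = last_epoch Delta (e' :: h') w.
  by apply/le_anti/andP; split; [exact: (last_le (e' :: h') _ _ vh' (fun l => esym (cE l)))|exact: (last_le (e :: h) _ _ vh)].
have e1 : e.1 = e'.1 by apply: no_tie lE.
case/and3P: vh => vh _ r; case/and3P: vh' => vh' _ r'.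
have cE' k : sent_count h k = sent_count h' k by have := cE k; rewrite /sent_count /= e1 => /addnI.
have e2 : e.2 = e'.2 by rewrite -(eqP r) -(eqP r') e1 cE'.
by rewrite (IH _ vh vh' cE') [e]surjective_pairing e1 e2 -surjective_pairing.
Qed.

(** Both histories record, for each sender, the epochs before [t]. *)
Lemma during_inj h h' t : during Delta rcp h t w -> during Delta rcp h' t w -> h = h'.
Proof.
move=> dh dh'; apply: valid_sent_count_inj; [by case/and3P: dh|by case/and3P: dh'|move=> k].
by apply/eqP; rewrite eqn_leq !(during_sent_count_le _ dh dh', during_sent_count_le _ dh' dh).
Qed.

Lemma size_histories n h : h \in @histories N n -> size h = n.
Proof.
elim: n h => [|n IH] h /=; first by rewrite inE => /eqP ->.
by move=> /allpairsP[[e h'] [_ h'n ->]] /=; rewrite IH.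
Qed.

Lemma histories_uniq n : uniq (@histories N n).
Proof.
elim: n => [//|n IH] /=; apply: allpairs_uniq => //; first exact: enum_uniq.
by move=> [e h] [e' h'] _ _ /= [-> ->].
Qed.

Definition histories_below M := flatten [seq @histories N n | n <- iota 0 M].

Lemma histories_below_uniq M : uniq (histories_below M).
Proof.
rewrite /histories_below; elim: M => [//|M IH]; rewrite -[M.+1]addn1 iotaD map_cat flatten_cat /= cats0 add0n.
rewrite cat_uniq IH histories_uniq andbT /=; apply/hasPn => h /size_histories hM.
apply/negP => /flattenP [s /mapP[n]]; rewrite mem_iota add0n /= => nM -> /size_histories hn.
by move: nM; rewrite -hn hM ltnn.
Qed.

Lemma during_sum_le1 t M : \sum_(h <- histories_below M) (during Delta rcp h t w)%:R <= 1 :> R.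
Proof.
have := histories_below_uniq M; elim: (histories_below M) => [|h s IH].
  by rewrite big_nil.
move=> /=/andP[hs us]; rewrite big_cons; case: (boolP (during Delta rcp h t w)) => [dh|_].
  rewrite big1_seq ?addr0// => h' /= h's; case: (boolP (during _ _ _ _ _)) => // dh'.
  by move: hs; rewrite (during_inj dh dh') h's.
by rewrite add0r; exact: IH.
Qed.

Lemma sum_histories_below (V : nmodType) (a : seq ('I_N * 'I_N) -> V) M :
  \sum_(h <- histories_below M) a h = \sum_(0 <= n < M) \sum_(h <- @histories N n) a h.
Proof. by rewrite big_flatten big_map /index_iota subn0. Qed.

End Disjointness.

(** At a fixed time [t] the space splits, up to a negligible set, into the
    events that the history is [h]. On those where the roots agree the
    trigonometric expectations of [Y] are known exactly; the others have total
    probability 1 minus the probability of coalescence. *)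
Section CoalescenceApproximation.
Context {dsp : measure_display} {Om : measurableType dsp} {R : realType}.
Variable P : probability Om R.
Context {N : nat}.
Variables (f : 'I_N -> R -> Om -> R) (theta : R).
Hypothesis theta0 : 0 <= theta.
Variables (Delta : 'I_N -> nat -> Om -> R) (rcp : 'I_N -> nat -> Om -> 'I_N).
Variables (Gf Ge : set (set Om)).
Hypotheses (Gfm : Gf `<=` measurable) (Gem : Ge `<=` measurable).
Hypothesis ind : indep P <<s Gf >> <<s Ge >>.
Hypothesis fG : forall l t, 0 <= t -> meas_in Gf (f l t).
Hypothesis DeltaG : forall k n, meas_in Ge (Delta k n).
Hypothesis rcpG : forall k n q, meas_in Ge (fun w => rcp k n w == q).
Hypothesis f_displacement : forall u : nat -> R, 0 <= u 0%N -> (forall n, u n <= u n.+1) ->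
  forall h j k, char_rv P (displacement f u h j k) = (decay_product theta u h j k)%:C.
Hypothesis f_cont : forall c : R, exists g : R -> R, [/\ continuous g, g 0 = 1 &
  forall l s t, 0 <= s -> s <= t -> \int[P]_w cos (c * (f l t w - f l s w)) = g (t - s)].
Hypothesis f_regular : {ae P, forall w l,
  (forall t : R, 0 <= t -> cvg (f l s w @[s --> t^'+])) /\
  (forall t : R, 0 < t -> cvg (f l s w @[s --> t^'-]) /\
     (f l t w = lim (f l s w @[s --> t^'+]) \/ f l t w = lim (f l s w @[s --> t^'-])))}.
Hypothesis Delta_pos : {ae P, forall w, forall k n, 0 < Delta k n w}.
Hypothesis noties : {ae P, forall w k k' n n',
  epoch Delta k n.+1 w = epoch Delta k' n'.+1 w -> k = k'}.

Notation during := (during Delta rcp).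

Variables (j k : 'I_N) (t : R) (Y : Om -> R).
Hypothesis mY : measurable_fun setT Y.
Hypothesis YE : {ae P, forall w, forall h, root h j = root h k -> during h t w ->
  Y w = displacement f (times Delta h t w) h j k w}.

Let b h w : R := (during h t w)%:R.
Let c h : R := (root h j == root h k)%:R.
Let mb h : measurable_fun setT (b h).
Proof. by apply: (sub_measurable_fun Gem); exact: during_meas_in. Qed.
Let bb h : bounded_rv (b h).
Proof. by split => //; exists 1 => w; rewrite /b; case: during; rewrite ?normr1 ?normr0. Qed.

Let term th h := \int[P]_w (b h w * coalescence Delta th h j k t w).

Let t_meas h i : meas_in Ge (fun w => times Delta h t w i).
Proof. by apply: (@times_meas_in _ _ _ _ Delta rcp Ge DeltaG rcpG h (fun=> t)); exact: measurable_cst. Qed.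

Let damping_in th h : meas_in Ge (fun w => decay_product th (times Delta h t w) h j k).
Proof. by apply: (@measurable_decay_product _ _ th _ (g_sigma_algebraType Ge) (times Delta h t)). Qed.

Let damping_meas th h : measurable_fun setT (fun w => decay_product th (times Delta h t w) h j k).
Proof. exact: (sub_measurable_fun (f := fun w => _) Gem (damping_in th h)). Qed.

Let b_damping th h : 0 <= th -> forall w,
  0 <= b h w * decay_product th (times Delta h t w) h j k <= b h w.
Proof.
move=> th0 w; rewrite /b; case dh : (during h t w); last by rewrite mul0r lexx.
rewrite mul1r; apply: decay_product_bounded => // i; case/and3P: dh => vh lt _.
by have /andP[] := times_mono vh (ltW lt) i.
Qed.

Let b_damping_bounded_rv th h : 0 <= th -> bounded_rv (fun w => b h w * decay_product th (times Delta h t w) h j k).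
Proof.
move=> th0; split; first by apply: measurable_funM => //; exact: mb.
exists 1 => w; have /andP[d0 d1] := b_damping h th0 w; rewrite ger0_norm//.
by apply: (le_trans d1); rewrite /b; case: during.
Qed.

Let termE th h : 0 <= th ->
  term th h = c h * \int[P]_w (b h w * decay_product th (times Delta h t w) h j k).
Proof.
move=> th0; rewrite -expZ; last exact: b_damping_bounded_rv.
by apply: eq_Rintegral => w _; rewrite coalescence_decay_product mulrCA.
Qed.

Let decay_product_theta0 (h : seq ('I_N * 'I_N)) (u : nat -> R) j' k' : decay_product 0 u h j' k' = 1.
Proof.
elim: h j' k' => [|e h IH] j' k' /=; rewrite ?IH mulr1 /decay; case: ifP => // _;
by rewrite oppr0 mul0r expR0.
Qed.

Let term0 h : term 0 h = c h * \int[P]_w b h w.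
Proof. by rewrite termE//; under eq_Rintegral do rewrite decay_product_theta0 mulr1. Qed.

Let cos_term h : c h * \int[P]_w (b h w * cos (Y w)) = term theta h.
Proof.
rewrite termE// /c; case: eqP => [rt|_]; last by rewrite !mul0r.
congr (_ * _); apply: (during_cos theta0 Gfm Gem ind fG DeltaG rcpG f_displacement f_cont f_regular mY).
by apply: filterS YE => w /(_ h rt).
Qed.

Let sin_term h : c h * \int[P]_w (b h w * sin (Y w)) = 0.
Proof.
rewrite /c; case: eqP => [rt|_]; last by rewrite !mul0r.
rewrite mul1r; apply: (during_sin (j := j) (k := k) theta0 Gfm Gem ind fG DeltaG rcpG f_displacement f_cont f_regular mY).
by apply: filterS YE => w /(_ h rt).
Qed.

Let bsum_le1 : {ae P, forall w M, \sum_(h <- histories_below M) b h w <= 1}.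
Proof. by apply: filterS2 Delta_pos noties => w pos nt M; exact: during_sum_le1. Qed.

Let S th M := \sum_(h <- histories_below M) term th h.

Let exp_sum (s : seq (seq ('I_N * 'I_N))) (g : seq ('I_N * 'I_N) -> Om -> R) :
  (forall h, bounded_rv (g h)) ->
  bounded_rv (fun w => \sum_(h <- s) g h w) /\
  \int[P]_w (\sum_(h <- s) g h w) = \sum_(h <- s) \int[P]_w g h w.
Proof.
move=> bg; elim: s => [|h s [IH1 IH2]].
  rewrite big_nil (_ : (fun w => _) = cst 0); last by apply/funext => w; rewrite big_nil.
  by split; [exact: bounded_rv_cst|exact: exp_cst].
rewrite (_ : (fun w => _) = (fun w => g h w + \sum_(h <- s) g h w)); last first.
  by apply/funext => w; rewrite big_cons.
by rewrite big_cons -IH2 -expD//; split => //; exact: bounded_rvD.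
Qed.

Let exp_le_ae (u v : Om -> R) : bounded_rv u -> bounded_rv v -> {ae P, forall w, u w <= v w} ->
  \int[P]_w u w <= \int[P]_w v w.
Proof.
move=> bu bv uv; have bm : bounded_rv (fun w => Num.min (u w) (v w)).
  split; first by apply: measurable_minr; [exact: bu.1|exact: bv.1].
  have [A hA] := bu.2; have [B hB] := bv.2.
  by exists (Num.max A B) => w; rewrite le_max; case: (leP (u w) (v w)); rewrite ?hA ?hB ?orbT.
have -> : \int[P]_w u w = \int[P]_w Num.min (u w) (v w).
  apply: exp_ae; [exact: bu.1|exact: bm.1|].
  by apply: filterS uv => w /min_idPl ->.
by apply: exp_le => // w; rewrite ge_min lexx orbT.
Qed.

(** The part of the expectation that is not accounted for is that of [g] on the
    complement of the events with equal roots. *)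
Let approx (g : Om -> R) (a : R) M : measurable_fun setT g -> (forall w, `|g w| <= 1) ->
  a = \sum_(h <- histories_below M) c h * \int[P]_w (b h w * g w) ->
  `|\int[P]_w g w - a| <= 1 - S 0 M.
Proof.
move=> mg g1 ->.
have bg : bounded_rv g by split => //; exists 1.
have bcb h : bounded_rv (fun w => c h * b h w) by apply: bounded_rvM => //; exact: bounded_rv_cst.
have bbg h : bounded_rv (fun w => b h w * g w) by exact: bounded_rvM.
have bcbg h : bounded_rv (fun w => c h * b h w * g w) by exact: bounded_rvM.
have [bs1 s1E] := exp_sum (histories_below M) bcb.
have [bs2 s2E] := exp_sum (histories_below M) bcbg.
pose q w := \sum_(h <- histories_below M) c h * b h w.
have -> : 1 - S 0 M = \int[P]_w (1 - q w).
  rewrite expB ?exp_cst//; last exact: bounded_rv_cst.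
  rewrite s1E; congr (_ - _); apply: eq_bigr => h _.
  by rewrite term0 expZ.
have -> : \int[P]_w g w - \sum_(h <- histories_below M) c h * \int[P]_w (b h w * g w) =
    \int[P]_w ((1 - q w) * g w).
  transitivity (\int[P]_w (g w - \sum_(h <- histories_below M) c h * b h w * g w)).
    rewrite expB// s2E; congr (_ - _); apply: eq_bigr => h _.
    by rewrite -expZ//; apply: eq_Rintegral => w _; rewrite mulrA.
  by apply: eq_Rintegral => w _; rewrite mulrBl mul1r /q mulr_suml.
have b1q : bounded_rv (fun w => 1 - q w) by apply: bounded_rvB => //; exact: bounded_rv_cst.
have q1 : {ae P, forall w, 0 <= 1 - q w}.
  apply: filterS bsum_le1 => w /(_ M) bl; rewrite subr_ge0; apply: le_trans bl.
  by apply: ler_sum => h _; rewrite /c; case: eqP; rewrite ?mul1r// mul0r /b; case: during.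
rewrite ler_norml -mulN1r -expZ//.
rewrite !exp_le_ae//; try exact: bounded_rvM; try by apply: bounded_rvM => //; exact: bounded_rv_cst.
- by apply: filterS q1 => w q0; rewrite ler_piMr//; have := g1 w; rewrite ler_norml => /andP[].
- apply: filterS q1 => w q0; rewrite mulN1r -mulrN1 ler_wpM2l//.
  by have := g1 w; rewrite ler_norml => /andP[].
Qed.

Lemma coalescence_cos M : `|\int[P]_w cos (Y w) - S theta M| <= 1 - S 0 M.
Proof.
apply: approx; last by apply: eq_bigr => h _; rewrite cos_term.
- exact: (measurableT_comp cos_measurable mY).
- by move=> w; rewrite ler_norml cos_geN1 cos_le1.
Qed.

Lemma coalescence_sin M : `|\int[P]_w sin (Y w)| <= 1 - S 0 M.
Proof.
rewrite -[X in `|X|]subr0; apply: approx; last by rewrite big1// => h _; rewrite sin_term.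
- exact: (measurableT_comp sin_measurable mY).
- by move=> w; rewrite ler_norml sin_geN1 sin_le1.
Qed.

Lemma coal_prob_cvg th : 0 <= th -> exists p : R,
  [/\ coal_prob P th Delta rcp j k t = p%:E, S th M @[M --> \oo] --> p & 0 <= p <= 1].
Proof.
move=> th0.
have tge0 h : 0 <= term th h by apply: Rintegral_ge0 => w _; rewrite mulr_ge0 ?coalescence_ge0// /b; case: during.
have btm h : bounded_rv (fun w => b h w * coalescence Delta th h j k t w).
  have -> : (fun w => b h w * coalescence Delta th h j k t w) =
      (fun w => c h * (b h w * decay_product th (times Delta h t w) h j k)).
    by apply/funext => w; rewrite coalescence_decay_product mulrCA.
  by apply: bounded_rvM; [exact: bounded_rv_cst|exact: b_damping_bounded_rv].
have tle M : S th M <= 1.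
  rewrite (_ : 1 = \int[P]_w 1); last by rewrite exp_cst.
  have [bs sE] := exp_sum (histories_below M) btm.
  rewrite /S -sE; apply: exp_le_ae => //; first exact: bounded_rv_cst.
  apply: filterS bsum_le1 => w /(_ M); apply: le_trans.
  apply: ler_sum => h _; rewrite coalescence_decay_product mulrCA; have /andP[d0 d1] := b_damping h th0 w.
  by case: eqP => _; rewrite ?mul1r// mul0r /b; case: during.
have SE : (fun M => (S th M)%:E) = (fun M => \sum_(0 <= n < M) \sum_(h <- @histories N n)
    \int[P]_w ((during h t w)%:R * coalescence Delta th h j k t w)%:E)%E.
  apply/funext => M; rewrite /S sum_histories_below -sumEFin; apply: eq_bigr => n _.
  by rewrite -sumEFin; apply: eq_bigr => h _; rewrite expE.
have cS : (S th M)%:E @[M --> \oo] --> coal_prob P th Delta rcp j k t.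
  rewrite SE; apply: is_cvg_nneseries => n _ _; apply: sume_ge0 => h _.
  by apply: integral_ge0 => w _; rewrite lee_fin mulr_ge0 ?coalescence_ge0//; case: during.
have c0 : (0 <= coal_prob P th Delta rcp j k t)%E by exact: coal_prob_ge0.
have c1 : (coal_prob P th Delta rcp j k t <= 1%:E)%E.
  by apply: (cvge_to_le cS); apply: nearW => M; rewrite lee_fin.
have pf : coal_prob P th Delta rcp j k t \is a fin_num.
  by rewrite ge0_fin_numE// (le_lt_trans c1)// ltry.
exists (fine (coal_prob P th Delta rcp j k t)); rewrite fineK//; split => //.
  by move: cS; rewrite -(fineK pf) => /fine_cvg.
by rewrite -!lee_fin fineK// c0.
Qed.

Lemma coalescence_bounds : exists p p0 : R,
  [/\ coal_prob P theta Delta rcp j k t = p%:E, coal_prob P 0 Delta rcp j k t = p0%:E,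
      (0 <= p <= 1) && (0 <= p0 <= 1),
      `|\int[P]_w cos (Y w) - p| <= 1 - p0 & `|\int[P]_w sin (Y w)| <= 1 - p0].
Proof.
have [p [pE pc p01]] := coal_prob_cvg theta0.
have [p0 [p0E p0c p001]] := coal_prob_cvg (lexx 0).
exists p, p0; split => //; first by rewrite p01.
- apply: (ler_cvg_to (cvg_norm (cvgB (cvg_cst _) pc)) (cvgB (cvg_cst _) p0c)).
  by apply: nearW => M; exact: coalescence_cos.
- apply: (ler_cvg_to (cvg_cst _) (cvgB (cvg_cst _) p0c)).
  by apply: nearW => M; exact: coalescence_sin.
Qed.

End CoalescenceApproximation.

(** * Abelian means *)

Section Abel.
Context {R : realType}.
Notation leb := (@lebesgue_measure R).
Implicit Types (F G : measurableTypeR R -> \bar R) (f g : R -> R).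

(** The mean of [F] at an independent exponential time of rate [eps]; it is the
    Laplace transform times [eps], and its limit as [eps] tends to 0 only
    depends on [F] near infinity. *)
Definition exp_mean F f := forall eps, 0 < eps ->
  (\int[leb]_t ((exponential_pdf eps t)%:E * F t) = (f eps)%:E)%E.

Let pdf_ge0 (eps t : R) : 0 < eps -> (0 <= (exponential_pdf eps t)%:E)%E.
Proof. by move=> e0; rewrite lee_fin exponential_pdf_ge0// ltW. Qed.

Let pdf_meas (eps : R) : measurable_fun [set: measurableTypeR R] (fun t => (exponential_pdf eps t)%:E).
Proof. by apply/measurable_EFinP; exact: measurable_exponential_pdf. Qed.

Lemma exp_mean_cst (c : R) : 0 <= c -> exp_mean (fun=> c%:E) (fun=> c).
Proof.
move=> c0 eps e0; under eq_integral do rewrite muleC.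
rewrite ge0_integralZl//; last by move=> t _; exact: pdf_ge0.
rewrite -[X in (_ * X)%E]/(exponential_prob eps setT).
have e := probability_setT (exponential_prob eps); rewrite [X in (_ * X)%E]e ?mule1//.
Qed.

Lemma exp_meanD F G f g : measurable_fun setT F -> measurable_fun setT G ->
  (forall t, 0 <= F t)%E -> (forall t, 0 <= G t)%E -> exp_mean F f -> exp_mean G g ->
  exp_mean (fun t => F t + G t)%E (fun eps => f eps + g eps).
Proof.
move=> mF mG F0 G0 Ff Gg eps e0.
under eq_integral do rewrite ge0_muleDr//.
by rewrite ge0_integralD ?Ff ?Gg//; try by [move=> t _; rewrite mule_ge0 ?pdf_ge0|exact: emeasurable_funM].
Qed.

Lemma exp_mean_indic (T : R) : 0 < T ->
  exp_mean (fun t => (2 * (t <= T)%R%:R)%:E) (fun eps => 2 * (1 - expR (- (eps * T)))).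
Proof.
move=> T0 eps e0.
transitivity (2%:E * \int[leb]_(t in `]-oo, T]%classic) (exponential_pdf eps t)%:E)%E.
  rewrite [in RHS]integral_mkcond -ge0_integralZl//; last 2 first.
  - apply: (measurable_restrictT _ _).1 => //; exact: measurable_funTS.
  - by move=> t _; apply: erestrict_ge0 => u _; exact: pdf_ge0.
  apply: eq_integral => t _; rewrite /patch mem_setE in_itv /=.
  by case: ifP => _; rewrite ?mulr1 ?mulr0 ?mule0 ?mul0e// muleC.
rewrite -[X in (_ * X)%E]/(exponential_prob eps `]-oo, T]%classic).
have := @exponential_prob_tail R eps^-1 _ T; rewrite invrK invr_gt0 => /(_ e0).
rewrite -setCitvl probability_setC// => h.
have compl (X : \bar R) (y : R) : (1 - X = (1 - y)%:E)%E -> X = y%:E.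
  by case: X => [x| |]// [] h'; congr (_%:E); lra.
rewrite (compl _ _ h) /exponential_df ltW//= -EFinM invrK.
by congr (_%:E); congr (2 * (1 - expR _)); ring.
Qed.

(** The exponential time falls below [T] with a probability that tends to 0 with
    [eps], so an inequality beyond [T] passes to the limits of the means. *)
Lemma exp_mean_le F G f g (a b T : R) :
  measurable_fun setT F -> measurable_fun setT G ->
  (forall t, 0 <= F t)%E -> (forall t, 0 <= G t)%E -> exp_mean F f -> exp_mean G g ->
  0 < T -> (forall t, F t <= G t + (2 * (t <= T)%R%:R)%:E)%E ->
  f eps @[eps --> 0^'+] --> a -> g eps @[eps --> 0^'+] --> b -> a <= b.
Proof.
move=> mF mG F0 G0 Ff Gg T0 FG fa gb.
have mi : measurable_fun [set: measurableTypeR R] (fun t : measurableTypeR R => (2 * (t <= T)%R%:R : R)%:E).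
  apply/measurable_EFinP; apply: measurable_funM => //; apply: measurable_fun_natb.
  exact: measurable_fun_ler.
have i0 (t : R) : (0 <= (2 * (t <= T)%R%:R : R)%:E)%E by rewrite lee_fin mulr_ge0.
have Gi := exp_meanD mG mi G0 i0 Gg (exp_mean_indic T0).
have le eps : 0 < eps -> f eps <= g eps + 2 * (1 - expR (- (eps * T))).
  move=> e0; rewrite -lee_fin -Ff// -Gi//; apply: ge0_le_integral => //.
  - by move=> t _; rewrite mule_ge0 ?pdf_ge0.
  - exact: emeasurable_funM.
  - by apply: emeasurable_funM => //; exact: emeasurable_funD.
  - by move=> t _; rewrite lee_wpmul2l ?pdf_ge0.
have lim0 : 2 * (1 - expR (- (eps * T))) @[eps --> 0^'+] --> (0 : R).
  have c : continuous (fun eps : R => 2 * (1 - expR (- (eps * T)))).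
    move=> x; apply: cvgMr; apply: cvgB; first exact: cvg_cst.
    apply: continuous_cvg; first exact: continuous_expR.
    by apply: cvgN; apply: cvgMl; exact: cvg_id.
  have := c 0; rewrite /continuous_at /= mul0r oppr0 expR0 subrr mulr0.
  exact: cvg_at_right_filter.
have gb' : g eps + 2 * (1 - expR (- (eps * T))) @[eps --> 0^'+] --> b.
  by rewrite -[X in _ --> X]addr0; exact: cvgD.
apply: (ler_cvg_to fa gb'); near=> eps; apply: le; near: eps.
exact: nbhs_right_gt.
Unshelve. all: end_near. Qed.

Definition abel_mean F (a : R) := [/\ measurable_fun setT F, forall t, (0 <= F t)%E &
  exists2 f : R -> R, exp_mean F f & f eps @[eps --> 0^'+] --> a].

Lemma abel_mean_cst (c : R) : 0 <= c -> abel_mean (fun=> c%:E) c.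
Proof.
move=> c0; split=> //.
by exists (fun=> c); [exact: exp_mean_cst|exact: cvg_cst].
Qed.

Lemma abel_meanD F G (a b : R) : abel_mean F a -> abel_mean G b ->
  abel_mean (fun t => F t + G t)%E (a + b).
Proof.
move=> [mF F0 [f Ff fa]] [mG G0 [g Gg gb]]; split.
- exact: emeasurable_funD.
- by move=> t; rewrite adde_ge0.
- by exists (fun eps => f eps + g eps); [exact: exp_meanD|exact: cvgD].
Qed.

Lemma abel_mean_le F G (a b T : R) : abel_mean F a -> abel_mean G b -> 0 < T ->
  (forall t, F t <= G t + (2 * (t <= T)%R%:R)%:E)%E -> a <= b.
Proof.
move=> [mF F0 [f Ff fa]] [mG G0 [g Gg gb]] T0 FG.
exact: (exp_mean_le mF mG F0 G0 Ff Gg T0 FG fa gb).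
Qed.

End Abel.

(** * The limit in the synchronization model *)

Section BorelMaps.
Context {R : realType} {E : ptopologicalType}.

Lemma borel_preimage_continuous (g : E -> R) (A : set R) :
  continuous g -> measurable A -> @borel E (g @^-1` A).
Proof.
move=> gc; suff mg : @measurable_fun _ _ (g_sigma_algebraType (@open E)) R setT g.
  by move=> mA; have := mg measurableT A mA; rewrite setTI.
apply: (measurability (@RGenOpens.G R)); first exact: RGenOpens.measurableE.
move=> _ [_ [x [y ->]] <-]; rewrite setTI; apply: sub_gen_smallest.
by apply: open_comp; [move=> u _; exact: gc|exact: interval_open].
Qed.

Lemma random_element_continuous {dsp : measure_display} {Om : measurableType dsp}
    (X : Om -> E) (g : E -> R) : random_element X -> continuous g ->
  measurable_fun setT (fun w => g (X w)).
Proof.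
move=> rX gc _ A mA; rewrite setTI -[_ @^-1` A]/(X @^-1` (g @^-1` A)).
by apply: rX; exact: borel_preimage_continuous.
Qed.

End BorelMaps.

Lemma measurable_inner {R : realType} {d : nat} {dsp : measure_display}
    {Om : measurableType dsp} (X : Om -> 'rV[R]_d) lam :
  random_element X -> measurable_fun setT (fun w => inner lam (X w)).
Proof. by move=> rX; apply: random_element_continuous => //; exact: continuous_inner. Qed.

Lemma cvg_mx_entries {R : realType} {m n : nat} {T : Type} (F : set_system T)
    (FF : Filter F) (g : T -> 'M[R]_(m, n)) (M : 'M[R]_(m, n)) :
  (forall i j, g s i j @[s --> F] --> M i j) -> g s @[s --> F] --> M.
Proof.
move=> cg A [B MB BA].
have gB : \forall s \near F, forall i j, B i j (g s i j).
  by apply: filter_forall => i; apply: filter_forall => j; exact: cg (MB i j).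
by apply: filterS gB => s gs; apply: BA.
Qed.

Section Exponent.
Context {R : realType}.
Implicit Types (z : R[i]) (h : R).

(** Only the real part of the exponent survives in the difference of two
    independent copies. *)
Lemma cexp_norm z : cexp z * (cexp z)^*%C = (expR (2 * complex.Re z))%:C.
Proof.
case: z => a b; rewrite /cexp /=; simpc; congr (_ +i* _); last by ring.
transitivity (expR a * expR a * (cos b ^+ 2 + sin b ^+ 2)); first by ring.
by rewrite cos2Dsin2 mulr1 -expRD; congr expR; ring.
Qed.

Lemma Re_scale h z : complex.Re (h%:C * z) = h * complex.Re z.
Proof. by case: z => a b /=; rewrite mul0r subr0. Qed.

Lemma Im_scale h z : complex.Im (h%:C * z) = h * complex.Im z.
Proof. by case: z => a b /=; rewrite mul0r addr0. Qed.

Lemma continuous_Re_cexp z : continuous (fun h => complex.Re (cexp (h%:C * z))).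
Proof.
move=> h; rewrite /cexp /=; under eq_fun do rewrite Re_scale Im_scale.
by apply: cvgM; (apply: continuous_cvg; [exact: continuous_expR|exact: cvgMl]) ||
  (apply: continuous_cvg; [exact: continuous_cos|exact: cvgMl]).
Qed.

End Exponent.

Section Model.
Context {R : realType} {N d : nat} {eta : 'rV[R]_d -> R[i]} {m : R}.
Hypotheses (hN : (2 <= N)%N) (hm : 0 < m).
Variables (S : sync_model N eta (exponential_df m)) (lam : 'rV[R]_d).

Notation P := (sm_P S).
Let theta : R := - (2 * complex.Re (eta lam)).
Let f := proj_free (@sm_free _ _ _ _ _ S) lam.
Let Delta := interval (@sm_tau _ _ _ _ _ S).
Let rcp := recipient (@sm_recip _ _ _ _ _ S).
Let Gf := \bigcup_(i in [set i : 'I_N * R | 0 <= i.2]) sigma_of measurable (f i.1 i.2).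
Let Ge : set (set (sm_Omega S)) := (\bigcup_k \bigcup_n sigma_of measurable (@sm_tau _ _ _ _ _ S k n)) `|`
   (\bigcup_k \bigcup_(n in [set n | (0 < n)%N]) sigma_of setT (@sm_recip _ _ _ _ _ S k n)).

Let fm l t : 0 <= t -> measurable_fun setT (f l t).
Proof. by move=> t0; exact: (measurable_inner _ (levy_random (sm_free_levy S l) t0)). Qed.

Let Gfm : Gf `<=` measurable.
Proof.
move=> A [[l t] /= t0 [B mB <-]]; exact: (fm l t0).
Qed.

Let Gem : Ge `<=` measurable.
Proof.
move=> A [[k _ [n _ [B mB <-]]]|[k _ [n _ [B mB <-]]]].
  exact: sm_tau_measurable.
by rewrite setTI; exact: sm_recip_measurable.
Qed.

Let cont_row l : continuous (fun M : 'M[R]_(N, d) => inner lam (row l M)).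
Proof.
rewrite /inner; apply: continuous_big => [|i _]; first exact: add_continuous.
move=> M; have c := @coord_continuous R N d l i M.
under eq_fun do rewrite mxE.
exact: (continuous_comp c (@mulrl_continuous R (lam ord0 i) (M l i))).
Qed.

Let ind : indep P <<s Gf >> <<s Ge >>.
Proof.
have h := @sm_independent _ _ _ _ _ S.
move=> A B GA GB.
have [i01 i12] : (ord0 : 'I_3) != 1 :> 'I_3 /\ true by [].
have := h [:: ord0; 1 : 'I_3] (fun i => if i == ord0 then A else B).
rewrite /= big_cons big_seq1 /= => <- //.
- by congr (P _); apply/seteqP; split => [w [Aw Bw] i /=|w hw]; [rewrite !inE; case: eqP|
    split; [have := hw ord0|have := hw 1]; rewrite /= !inE /=; apply].
- move=> i; rewrite !inE => /orP[]/eqP -> /=; last exact: GB.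
  move: A GA; apply: smallest_sub; first exact: smallest_sigma_algebra.
  move=> A [[l t] /= t0 [B' mB' <-]]; apply: sub_gen_smallest; exists t => //.
  exists ((fun M : 'M[R]_(N, d) => inner lam (row l M)) @^-1` B') => //.
  exact: borel_preimage_continuous.
Qed.

Let fG l t : 0 <= t -> meas_in Gf (f l t).
Proof.
move=> t0 _ B mB; apply: sub_gen_smallest; exists (l, t) => //=.
by exists B.
Qed.

Let tauG k n : meas_in Ge (@sm_tau _ _ _ _ _ S k n).
Proof. by move=> _ B mB; apply: sub_gen_smallest; left; exists k => //; exists n => //; exists B. Qed.

Let DeltaG k n : meas_in Ge (Delta k n).
Proof. by apply: measurable_funB; exact: tauG. Qed.

Let rcpG k n q : meas_in Ge (fun w => rcp k n w == q).
Proof.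
move=> _ B mB; apply: sub_gen_smallest; right; exists k => //; exists n.+1 => //.
by exists [set r | B (r == q)].
Qed.

Let char_increment l s t c : 0 <= s -> s <= t ->
  char_rv P (fun w => c * (f l t w - f l s w)) = cexp ((t - s)%:C * eta (c *: lam)).
Proof.
move=> s0 st; rewrite -(sm_free_exponent S l (c *: lam) s0 st) /char_rv /char_fun.
by congr (_ +i* _); apply: eq_Rintegral => w _; rewrite innerZl innerBr.
Qed.

Let f_cont (c : R) : exists g : R -> R, [/\ continuous g, g 0 = 1 &
  forall l s t, 0 <= s -> s <= t -> \int[P]_w cos (c * (f l t w - f l s w)) = g (t - s)].
Proof.
exists (fun h => complex.Re (cexp (h%:C * eta (c *: lam)))); split.
- exact: continuous_Re_cexp.
- by rewrite mul0r /cexp /= expR0 cos0 mulr1.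
- by move=> l s t s0 st; rewrite -(char_increment l).
Qed.

Section Disp.
Variable u : nat -> R.
Hypotheses (u0 : 0 <= u 0%N) (um : forall n, u n <= u n.+1).
Let u_ge0 n : 0 <= u n.
Proof. by elim: n => // n IH; exact: le_trans IH (um n). Qed.
Let xi (x : 'I_N * nat) w := f x.1 (u x.2.+1) w - f x.1 (u x.2) w.

Let Hl (l : 'I_N) := \bigcup_(t in [set t : R | 0 <= t])
  sigma_of (@borel 'rV[R]_d) (fun w => row l (@sm_free _ _ _ _ _ S t w)).

Let f_Hl l t : 0 <= t -> meas_in (Hl l) (f l t).
Proof.
move=> t0 _ B mB; apply: sub_gen_smallest; exists t => //.
exists (inner lam @^-1` B) => //.
by apply: borel_preimage_continuous => //; exact: continuous_inner.
Qed.

Let xi_Hl l i A : sigma_of measurable (xi (l, i)) A -> <<s Hl l >> A.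
Proof.
move=> [B mB <-].
have mx : meas_in (Hl l) (xi (l, i)) by apply: measurable_funB; exact: f_Hl.
exact: mx measurableT B mB.
Qed.

Let ind_xi : independent_family P (fun x => sigma_of measurable (xi x)).
Proof.
apply: (@independent_nested _ _ _ P 'I_N (fun l => <<s Hl l >>)).
- exact: sm_free_independent.
- move=> l s A us sA; have := levy_independent (sm_free_levy S l) u0 um.
  apply=> // i /sA [B mB <-].
  exists (inner lam @^-1` B).
    by apply: borel_preimage_continuous => //; exact: continuous_inner.
  by rewrite !setTI; apply/seteqP; split => w /=; rewrite innerBr.
- by move=> x; exists setT => //; rewrite preimage_setT setTI.
- move=> l s A hA; rewrite -[X in <<s _ >> X]setCK setC_bigcap; apply: sigma_algebraC.
  rewrite bigcup_mkcond; apply: sigma_algebra_bigcup => i.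
  case: ifPn => _; last exact: sigma_algebra0.
  by apply: sigma_algebraC; exact: xi_Hl (hA i).
Qed.

(** The components are independent, and the increments of each along the fixed
    increasing times [u] are independent with the prescribed exponent. *)
Lemma model_displacement h j k : char_rv P (displacement f u h j k) = (decay_product theta u h j k)%:C.
Proof.
apply: (@char_displacement _ _ _ P N f theta u _ ind_xi (fun n => cexp ((u n.+1 - u n)%:C * eta lam))).
- by move=> [l n]; apply: measurable_funB; exact: fm.
- move=> l n; have := char_increment l 1 (u_ge0 n) (um n); rewrite scale1r => <-.
  by congr char_rv; apply/funext => w; rewrite mul1r.
- by move=> n; rewrite cexp_norm Re_scale /theta; congr (expR _)%:C; ring.
Qed.

End Disp.

Section Pair.
Variables (j k : 'I_N).
Hypothesis jk : j != k.

(** A characteristic function is bounded by 1. *)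
Lemma theta_ge0 : 0 <= theta.
Proof.
have um n : n%:R <= n.+1%:R :> R by rewrite ler_nat.
have := @model_displacement (fun n => n%:R) (lexx 0) um [::] j k.
rewrite [decay_product _ _ _ _ _]/= mulr1 /decay (negbTE jk) subr0 mulr1 => -[e _].
have : expR (- theta) <= 1.
  rewrite -e; apply: le_trans (ler_norm _) _; apply: exp_abs.
    apply: (measurableT_comp cos_measurable) => /=.
    by apply: measurable_funD => //; apply: measurable_funB; apply: measurable_funB; exact: fm.
  by move=> w; rewrite ler_norml cos_geN1 cos_le1.
by rewrite -expR0 ler_expR oppr_le0.
Qed.

Let f_regular : {ae P, forall w l,
  (forall t : R, 0 <= t -> cvg (f l s w @[s --> t^'+])) /\
  (forall t : R, 0 < t -> cvg (f l s w @[s --> t^'-]) /\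
     (f l t w = lim (f l s w @[s --> t^'+]) \/ f l t w = lim (f l s w @[s --> t^'-])))}.
Proof.
apply: filterS (@sm_free_regular _ _ _ _ _ S) => w reg l.
have [rr rl] := reg l.
have rc t : 0 <= t -> f l s w @[s --> t^'+] --> inner lam (rlim (fun t => row l (sm_free t w)) t).
  by move=> t0; apply: continuous_cvg; [exact: continuous_inner|exact: rr].
have lc t : 0 < t -> f l s w @[s --> t^'-] --> inner lam (llim (fun t => row l (sm_free t w)) t).
  by move=> t0; apply: continuous_cvg; [exact: continuous_inner|exact: (rl _ t0).1].
split=> t t0; first by apply: cvgP (rc t t0).
split; first by apply: cvgP (lc t t0).
rewrite (cvg_lim (@Rhausdorff R) (rc t (ltW t0))) (cvg_lim (@Rhausdorff R) (lc t t0)).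
by have [_ [] e] := rl t t0; [left|right]; rewrite /f /proj_free -e.
Qed.

(** The epochs are random times independent of the free motion, which is thus
    continuous there. The right limit is taken on matrices in the model, and on
    scalar projections in [cvg_mesh_random_time]. *)
Let free_rlim : {ae P, forall w l i n,
  inner lam (row l (rlim (fun t => sm_free t w) (sm_tau i n w))) = f l (sm_tau i n w) w}.
Proof.
have J : {ae P, forall w l i n, f l (mesh q (Num.max 0 (sm_tau i n w))) w @[q --> \oo] -->
    f l (Num.max 0 (sm_tau i n w)) w}.
  apply: filter_forall => l; apply: filter_forall => i; apply: ae_foralln => n.
  apply: (cvg_mesh_random_time Gfm Gem ind fG f_cont f_regular l (T := fun w => Num.max 0 (sm_tau i n w))).
    by apply: measurable_maxr; [exact: measurable_cst|exact: tauG].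
  by move=> w; rewrite le_max lexx.
apply: filterS3 J (@sm_free_regular _ _ _ _ _ S) (@sm_tau_increasing _ _ _ _ _ S).
move=> w Jw reg inc l i n; have t0 : 0 <= sm_tau i n w.
  have [t00 tS] := inc i; elim: n => [|n IH]; first by rewrite t00.
  exact: le_trans IH (ltW (tS n)).
have := Jw l i n; rewrite (max_idPr t0) => c1.
have cr i' : cvg (row i' (sm_free s w) @[s --> (sm_tau i n w)^'+]) by exact: (reg i').1.
have cM : sm_free s w @[s --> (sm_tau i n w)^'+] -->
    \matrix_(a, b) (lim (row a (sm_free s w) @[s --> (sm_tau i n w)^'+])) ord0 b.
  apply: cvg_mx_entries => a b; rewrite mxE.
  rewrite (_ : (fun s => sm_free s w a b) = (fun M : 'rV[R]_d => M ord0 b) \o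
      (fun s => row a (sm_free s w))); last by apply/funext => s; rewrite /= mxE.
  exact: (cvg_comp _ _ (cr a) (@coord_continuous R 1 d ord0 b _)).
have c2 : f l s w @[s --> (sm_tau i n w)^'+] -->
    inner lam (row l (rlim (fun t => sm_free t w) (sm_tau i n w))).
  rewrite /rlim (cvg_lim _ cM)//.
  exact: (cvg_comp _ _ cM (@cont_row l _)).
have := right_lim_mesh (F := fun s => f l s w) t0 c2.
by move=> /(cvg_lim (@Rhausdorff R)) <-; exact: cvg_lim.
Qed.

Let Delta_pos : {ae P, forall w, forall i n, 0 < Delta i n w}.
Proof.
by apply: filterS (@sm_tau_increasing _ _ _ _ _ S) => w h i n; rewrite subr_gt0 (h i).2.
Qed.

Let noties : {ae P, forall w i i' n n',
  epoch Delta i n.+1 w = epoch Delta i' n'.+1 w -> i = i'}.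
Proof.
apply: filterS2 (@sm_tau_increasing _ _ _ _ _ S) (@sm_no_common_epoch _ _ _ _ _ S).
move=> w inc h i i' n n'.
by rewrite !epoch_interval; try (by move=> ?; exact: (inc _).1); exact: h.
Qed.

Let Y t w := inner lam (sm_diff S j k t w).

Let mY t : 0 <= t -> measurable_fun setT (Y t).
Proof.
move=> t0; rewrite /Y /sm_diff; under eq_fun do rewrite innerBr.
by apply: measurable_funB; apply: (random_element_continuous (sm_x_random S t0) (@cont_row _)).
Qed.

Let YE t : {ae P, forall w, forall h, root h j = root h k -> during Delta rcp h t w ->
  Y t w = displacement f (times Delta h t w) h j k w}.
Proof.
apply: filterS3 (filterI free_rlim (@sm_tau_increasing _ _ _ _ _ S))
  (@sm_superposition _ _ _ _ _ S) (@sm_x_dynamics _ _ _ _ _ S) => w [fr inc] sup dyn h rt.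
move=> /and3P[vh lt /forallP nt].
rewrite /Y /sm_diff innerBr.
by apply: (dynamics_displacement (fun i => (inc i).1) (fun i => (inc i).2) sup dyn fr) => // i; exact: ltW.
Qed.

Let coal_neg th t : t < 0 -> coal_prob P th Delta rcp j k t = 0%E.
Proof.
move=> t0; apply: eseries0 => n _ _; apply: big1 => h _; apply: integral0_eq => w _.
rewrite /during; case: (boolP (valid _ _ _ _)) => [vh|_]; last by rewrite mul0r.
by rewrite ltNge (ltW (lt_le_trans t0 (last_epoch_ge0 vh)))/= mul0r.
Qed.

Let beta : R := 2 * ((N.-1%:R)^-1 / m).

Let mDelta i n : measurable_fun setT (Delta i n).
Proof. by apply: measurable_funB; exact: sm_tau_measurable. Qed.

(** [coal_prob] vanishes at negative times, so that the exponential density may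
    be replaced by the discount factor on the whole line. *)
Let coal_mean th : 0 <= th -> exp_mean (coal_prob P th Delta rcp j k) (fun eps => beta / (eps + th + beta)).
Proof.
move=> th0 eps e0.
have L := laplace_coal_prob hN hm th0 e0 mDelta
  (fun i n A => @sm_recip_measurable _ _ _ _ _ S i n.+1 A) (@sm_interval_law _ _ _ _ _ S)
  (fun i n q => @sm_recip_law _ _ _ _ _ S i n.+1 q isT) (@sm_epochs_independent _ _ _ _ _ S) noties jk.
transitivity (eps%:E * \int[lebesgue_measure]_t
    ((expR (- eps * t))%:E * coal_prob P th Delta rcp j k t))%E; last first.
  rewrite L -EFinM /beta; congr (_%:E).
  rewrite -!mulrA mulrCA; congr (_ * _); rewrite mulrCA; congr (_ * _).
  by rewrite mulrCA mulVKf// gt_eqF.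
have mC : measurable_fun [set: measurableTypeR R] (coal_prob P th Delta rcp j k).
  exact: (measurable_coal_prob P th mDelta (fun i n A => @sm_recip_measurable _ _ _ _ _ S i n.+1 A) j k).
have mL : measurable_fun [set: measurableTypeR R]
    (fun t => (expR (- eps * t))%:E * coal_prob P th Delta rcp j k t)%E.
  apply: emeasurable_funM => //; apply/measurable_EFinP; apply: measurableT_comp => //.
rewrite -ge0_integralZl ?lee_fin ?(ltW e0)//; last first.
  by move=> t _; rewrite mule_ge0 ?lee_fin ?expR_ge0 ?coal_prob_ge0.
apply: eq_integral => t _; case: (ltP t 0) => t0; first by rewrite coal_neg// !mule0.
by rewrite muleA -EFinM exponential_pdfE.
Qed.

Let bounds t : 0 <= t -> exists p p0 : R,
  [/\ coal_prob P theta Delta rcp j k t = p%:E, coal_prob P 0 Delta rcp j k t = p0%:E,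
      (0 <= p <= 1) && (0 <= p0 <= 1),
      `|\int[P]_w cos (Y t w) - p| <= 1 - p0 & `|\int[P]_w sin (Y t w)| <= 1 - p0].
Proof.
move=> t0; exact: (coalescence_bounds theta_ge0 Gfm Gem ind fG DeltaG rcpG
  (fun u u0 um h j k => @model_displacement u u0 um h j k) f_cont f_regular Delta_pos noties (mY t0) (YE t)).
Qed.

Let beta_gt0 : 0 < beta.
Proof. by rewrite mulr_gt0// divr_gt0// invr_gt0 ltr0n; case: (N) hN => [|[]]. Qed.

Let C0 := coal_prob P 0 Delta rcp j k.
Let coal_lim (th : R) : 0 <= th -> beta / (eps + th + beta) @[eps --> 0^'+] --> beta / (th + beta).
Proof.
move=> th0; apply: cvgMr; apply: cvgV; first by rewrite gt_eqF// ltr_wpDl.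
rewrite -[X in _ --> X + _]add0r; apply: cvgD; last exact: cvg_cst.
apply: cvgD; last exact: cvg_cst.
by apply: cvg_at_right_filter; exact: cvg_id.
Qed.

Let coalescence_ge0 th t : (0 <= coal_prob P th Delta rcp j k t)%E.
Proof. exact: coal_prob_ge0. Qed.

Let coal_abel th : 0 <= th -> abel_mean (coal_prob P th Delta rcp j k) (beta / (th + beta)).
Proof.
move=> th0; split; [|exact: coalescence_ge0|].
  exact: (measurable_coal_prob P th mDelta (fun i n A => @sm_recip_measurable _ _ _ _ _ S i n.+1 A) j k).
by exists (fun eps => beta / (eps + th + beta)); [exact: coal_mean|exact: coal_lim].
Qed.

Let coal0_abel : abel_mean C0 1.
Proof. by have := coal_abel (lexx 0); rewrite add0r divff ?gt_eqF. Qed.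

Let coal_values t : exists p p0 : R, [/\ coal_prob P theta Delta rcp j k t = p%:E, C0 t = p0%:E,
  (0 <= p <= 1) && (0 <= p0 <= 1) &
  0 <= t -> `|\int[P]_w cos (Y t w) - p| <= 1 - p0 /\ `|\int[P]_w sin (Y t w)| <= 1 - p0].
Proof.
case: (leP 0 t) => t0; first by have [p [p0 [? ? ? ? ?]]] := bounds t0; exists p, p0.
by exists 0, 0; rewrite /C0 !coal_neg// lexx ler01.
Qed.

Let eventually_close (g : R -> R) (a e : R) : g t @[t --> +oo] --> a -> 0 < e ->
  exists2 T : R, 0 < T & forall t, T < t -> `|a - g t| <= e.
Proof.
move=> ca e0; have /cvgrPdist_le /(_ e e0) [M [_ hM]] := ca.
exists (Num.max M 1); first by rewrite lt_max ltr01 orbT.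
by move=> t; rewrite gt_max => /andP[Mt _]; exact: hM.
Qed.

(** The expectation of the cosine at time [t] lies within 1 minus [coal_prob] at
    [theta = 0] of [coal_prob] at [theta]. The limit of the expectation exists
    by assumption, so it is enough to compare Abelian means, where [coal_prob]
    at [theta = 0] has mean 1. *)
Lemma limit_cos (a : R) : (\int[P]_w cos (inner lam (sm_diff S j k t w))) @[t --> +oo] --> a ->
  a = beta / (theta + beta).
Proof.
move=> ca.
have aE : `|a| <= 1.
  apply: (cvgr_to_le (cvg_norm ca)); near=> t.
  have t0 : 0 <= t by near: t; exact: nbhs_pinfty_ge.
  apply: exp_abs; last by move=> w; rewrite ler_norml cos_geN1 cos_le1.
  exact: (measurableT_comp cos_measurable (mY t0)).
have {aE} [a1 a2] : -1 <= a /\ a <= 1 by apply/andP; rewrite -ler_norml.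
apply/le_anti/andP; split; apply/ler_addgt0Pr => e e0; have [T T0 hT] := eventually_close ca e0.
- suff : a + 1 + 1 <= 2 + e + beta / (theta + beta) by lra.
  apply: (abel_mean_le (abel_meanD (abel_mean_cst _) coal0_abel)
    (abel_meanD (abel_mean_cst _) (coal_abel theta_ge0)) T0); [lra|lra|move=> t].
  have [p [p0 [-> -> /andP[/andP[p1 p2] /andP[p3 p4]] h]]] := coal_values t.
  rewrite -!EFinD lee_fin; case: (leP t T) => tT; first by rewrite mulr1; lra.
  have [+ _] := h (ltW (lt_trans T0 tT)); have := hT t tT.
  by rewrite /Y !ler_norml mulr0 addr0 => /andP[? ?] /andP[? ?]; lra.
- suff : beta / (theta + beta) + 1 <= 1 + a + e by lra.
  apply: (abel_mean_le (abel_meanD (coal_abel theta_ge0) coal0_abel) (abel_mean_cst _) T0).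
    by lra.
  move=> t; have [p [p0 [-> -> /andP[/andP[p1 p2] /andP[p3 p4]] h]]] := coal_values t.
  rewrite -!EFinD lee_fin; case: (leP t T) => tT; first by rewrite mulr1; lra.
  have [+ _] := h (ltW (lt_trans T0 tT)); have := hT t tT.
  by rewrite /Y !ler_norml mulr0 addr0 => /andP[? ?] /andP[? ?]; lra.
Unshelve. all: end_near. Qed.

(** The displacement along coalescing lines has a real characteristic
    function. *)
Lemma limit_sin (a : R) : (\int[P]_w sin (inner lam (sm_diff S j k t w))) @[t --> +oo] --> a ->
  a = 0.
Proof.
move=> ca.
have a1 : `|a| <= 1.
  apply: (cvgr_to_le (cvg_norm ca)); near=> t.
  have t0 : 0 <= t by near: t; exact: nbhs_pinfty_ge.
  apply: exp_abs; last by move=> w; rewrite ler_norml sin_geN1 sin_le1.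
  exact: (measurableT_comp sin_measurable (mY t0)).
apply/eqP; rewrite -normr_le0; apply/ler_addgt0Pr => e e0; have [T T0 hT] := eventually_close ca e0.
suff : `|a| + 1 <= 1 + e by lra.
apply: (abel_mean_le (abel_meanD (abel_mean_cst (normr_ge0 a)) coal0_abel) (abel_mean_cst _) T0).
  by lra.
move=> t; have [p [p0 [_ -> /andP[_ /andP[p3 p4]] h]]] := coal_values t.
rewrite -!EFinD lee_fin; case: (leP t T) => tT; first by rewrite mulr1; lra.
have hs := hT t tT; have [_ hb] := h (ltW (lt_trans T0 tT)).
have := ler_normD (a - \int[P]_w sin (Y t w)) (\int[P]_w sin (Y t w)).
by rewrite subrK mulr0 addr0; move: hs hb; rewrite /Y; lra.
Unshelve. all: end_near. Qed.

End Pair.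
End Model.

(** * Uniqueness of characteristic functions *)

Section Cutoff.
Context {R : realType}.
Implicit Types (x u y : R) (n e : nat).

Lemma bernoulli_lower x e : 0 <= x <= 1 -> 1 - e%:R * x <= (1 - x) ^+ e.
Proof.
move=> /andP[x0 x1]; elim: e => [|e IH]; first by rewrite mul0r subr0.
have q0 : 0 <= (1 - x) ^+ e <= 1 by rewrite exprn_ge0 ?exprn_ile1//; lra.
by rewrite exprS -natr1; nra.
Qed.

Lemma bernoulli_upper x e : 0 <= x <= 1 -> (1 - x) ^+ e * (1 + e%:R * x) <= 1.
Proof.
move=> /andP[x0 x1]; elim: e => [|e IH]; first by rewrite mul0r addr0 mulr1.
have q0 : 0 <= (1 - x) ^+ e by rewrite exprn_ge0//; lra.
have e0 : 0 <= e%:R :> R by [].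
rewrite exprS -natr1; apply: le_trans IH.
have : (1 - x) * (1 + (e%:R + 1) * x) <= 1 + e%:R * x.
  have : 0 <= (e%:R + 1) * (x * x) by rewrite mulr_ge0 ?mulr_ge0// addr_ge0.
  by move=> h; nra.
by move=> h; rewrite mulrAC mulrC ler_wpM2l.
Qed.

(** A polynomial approximation of the indicator of [u < 1/2]. With
    [e = n.+1 ^ 2], Bernoulli's inequality compares [u ^+ e] to [(1/2) ^+ e];
    the factor [n.+1] in the exponent settles the boundary case [u = 1/2] and is
    absorbed, for [u < 1/2], by the quadratic growth of [e]. *)
Definition cutoff n u : R := (1 - u ^+ (n.+1 ^ 2)) ^+ (2 ^ (n.+1 ^ 2) * n.+1).

Lemma cutoff_bounds n u : 0 <= u <= 1 -> 0 <= cutoff n u <= 1.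
Proof.
move=> /andP[u0 u1]; have /andP[x0 x1] : 0 <= u ^+ (n.+1 ^ 2) <= 1.
  by rewrite exprn_ge0// exprn_ile1.
by rewrite exprn_ge0 ?subr_ge0//= exprn_ile1// ?subr_ge0// lerBlDr lerDl.
Qed.

Lemma cvg_cutoff u : 0 <= u <= 1 -> cutoff n u @[n --> \oo] --> ((u < 2^-1)%R%:R : R).
Proof.
move=> u01; have /andP[u0 u1] := u01.
have x01 e : 0 <= u ^+ e <= 1 by rewrite exprn_ge0// exprn_ile1.
case: (ltP u 2^-1) => uh.
- have d0 : 0 < 1 - 2 * u by lra.
  apply: (@squeeze_cvgr _ _ _ _ (fun n => 1 - (1 - 2 * u)^-1 / n.+1%:R) (cst 1)).
  + apply: nearW => n; have /andP[_ ->] := cutoff_bounds n u01; rewrite andbT.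
    apply: le_trans (bernoulli_lower _ (x01 _)); rewrite lerB//.
    rewrite natrM natrX mulrAC -exprMn.
    have := @bernoulli_upper (1 - 2 * u) (n.+1 ^ 2) _; rewrite subKr => /(_ _)/= h.
    have {}h : (2 * u) ^+ (n.+1 ^ 2) * (1 + (n.+1 ^ 2)%:R * (1 - 2 * u)) <= 1 by apply: h; lra.
    have q0 : 0 <= (2 * u) ^+ (n.+1 ^ 2) by rewrite exprn_ge0//; lra.
    rewrite ler_pdivlMr// -[leRHS]mul1r ler_pdivlMr//.
    by move: h; rewrite natrX; move: q0; set q := _ ^+ _ => q0; lra.
  + rewrite -[X in _ --> X]subr0; apply: cvgB; [exact: cvg_cst|exact: cvg_harm].
  + exact: cvg_cst.
- apply: (@squeeze_cvgr _ _ _ _ (cst 0) (fun n => 2^-1 ^+ n.+1)).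
  + apply: nearW => n; have /andP[-> _] := cutoff_bounds n u01.
    rewrite /cutoff exprM; set e := (n.+1 ^ 2)%N.
    have h2 : 0 <= (1 - u ^+ e) ^+ (2 ^ e) <= 2^-1.
      have /andP[a0 a1] := x01 e; rewrite exprn_ge0 ?subr_ge0//=.
      have := bernoulli_upper (2 ^ e) (x01 e).
      have q0 : 0 <= (1 - u ^+ e) ^+ (2 ^ e) by rewrite exprn_ge0// subr_ge0.
      have : 1 <= (2 ^ e)%:R * u ^+ e.
        by rewrite natrX -exprMn exprn_ege1//; lra.
      nra.
    have /andP[h0 h1] := h2.
    by rewrite /= ler_pXn2r// nnegrE.
  + exact: cvg_cst.
  + have := @cvg_geometric R 1 2^-1; rewrite ger0_norm// => /(_ _) h.
    have {}h : geometric 1 2^-1 @ \oo --> (0 : R) by apply: h; lra.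
    move: h; rewrite -cvg_shiftS; apply: cvg_trans.
    by apply: near_eq_cvg; apply: nearW => n; rewrite /= mul1r.
Qed.

End Cutoff.

Section TrigonometricPolynomials.
Context {R : realType} {d : nat}.
Implicit Types (lam v : 'rV[R]_d) (f g : 'rV[R]_d -> R).

Lemma innerC lam v : inner lam v = inner v lam.
Proof. by apply: eq_bigr => i _; rewrite mulrC. Qed.

Lemma innerDl lam lam' v : inner (lam + lam') v = inner lam v + inner lam' v.
Proof. by rewrite !(innerC _ v) innerDr. Qed.

Lemma innerBl lam lam' v : inner (lam - lam') v = inner lam v - inner lam' v.
Proof. by rewrite !(innerC _ v) innerBr. Qed.

Lemma inner_delta i v : inner (delta_mx ord0 i) v = v ord0 i.
Proof.
rewrite /inner (bigD1 i)//= mxE !eqxx mul1r big1 ?addr0// => l li.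
by rewrite mxE (negbTE li) andbF mul0r.
Qed.

(** Finite combinations of the functions whose expectations are prescribed by a
    characteristic function; the product formulas make them an algebra. *)
Inductive trig_poly : ('rV[R]_d -> R) -> Prop :=
| trig_wave a b lam : trig_poly (fun v => a * cos (inner lam v) + b * sin (inner lam v))
| trig_add f g : trig_poly f -> trig_poly g -> trig_poly (fun v => f v + g v).

Lemma trig_mul f g : trig_poly f -> trig_poly g -> trig_poly (fun v => f v * g v).
Proof.
elim=> [a b lam|f1 f2 _ IH1 _ IH2 tg]; last first.
  under eq_fun do rewrite mulrDl; exact: trig_add (IH1 tg) (IH2 tg).
elim=> [a' b' lam'|g1 g2 _ IH1 _ IH2]; last first.
  by under eq_fun do rewrite mulrDr; exact: trig_add.
pose c1 := (a * a' + b * b') / 2; pose s1 := (b * a' - a * b') / 2.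
pose c2 := (a * a' - b * b') / 2; pose s2 := (a * b' + b * a') / 2.
rewrite [X in trig_poly X](_ : _ = fun v =>
  (c1 * cos (inner (lam - lam') v) + s1 * sin (inner (lam - lam') v)) +
  (c2 * cos (inner (lam + lam') v) + s2 * sin (inner (lam + lam') v))).
  by apply: trig_add; exact: trig_wave.
apply/funext => v; rewrite innerBl innerDl cosB sinB cosD sinD /c1 /c2 /s1 /s2; by field.
Qed.

Lemma trig_cst (c : R) : trig_poly (fun=> c).
Proof.
rewrite [X in trig_poly X](_ : _ = fun v => c * cos (inner 0 v) + 0 * sin (inner 0 v)).
  exact: trig_wave.
by apply/funext => v; rewrite innerC -(scale0r v) innerZr mul0r cos0 mul0r addr0 mulr1.
Qed.

Lemma trig_pow f n : trig_poly f -> trig_poly (fun v => f v ^+ n).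
Proof.
move=> tf; elim: n => [|n IH]; first exact: trig_cst.
by under eq_fun do rewrite exprS; exact: trig_mul.
Qed.

Lemma trig_prod (I : Type) (s : seq I) (F : I -> 'rV[R]_d -> R) :
  (forall i, trig_poly (F i)) -> trig_poly (fun v => \prod_(i <- s) F i v).
Proof.
move=> tF; elim: s => [|i s IH].
  by under eq_fun do rewrite big_nil; exact: trig_cst.
by under eq_fun do rewrite big_cons; exact: trig_mul.
Qed.

(** A function valued in [[0, 1]] with [slope < 1/2] exactly where the sine is
    negative, that is where [v ord0 i < a] as soon as [L] is large compared to
    [v ord0 i - a]. *)
Definition slope (L a : R) (i : 'I_d) v : R := (1 + sin ((v ord0 i - a) / L)) / 2.

Lemma slope01 L a i v : 0 <= slope L a i v <= 1.
Proof. by rewrite /slope; have := sin_geN1 ((v ord0 i - a) / L); have := sin_le1 ((v ord0 i - a) / L); lra. Qed.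

Lemma trig_slope L a i : trig_poly (slope L a i).
Proof.
rewrite [X in trig_poly X](_ : _ = fun v => 2^-1 +
  (- (sin (a / L) / 2) * cos (inner (L^-1 *: delta_mx ord0 i) v) +
   cos (a / L) / 2 * sin (inner (L^-1 *: delta_mx ord0 i) v))).
  by apply: trig_add; [exact: trig_cst|exact: trig_wave].
apply/funext => v; rewrite /slope innerZl inner_delta mulrBl sinB [L^-1 * _]mulrC; by field.
Qed.

Lemma trig_cutoff n L a i : trig_poly (fun v => cutoff n (slope L a i v)).
Proof.
apply: trig_pow; rewrite [X in trig_poly X](_ : _ = fun v => 1 + (-1) * slope L a i v ^+ (n.+1 ^ 2)).
  apply: trig_add; first exact: trig_cst.
  apply: trig_mul; first exact: trig_cst.
  by apply: trig_pow; exact: trig_slope.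
by apply/funext => v; rewrite mulN1r.
Qed.

End TrigonometricPolynomials.

Section Uniqueness.
Context {R : realType} {d : nat}.

Lemma prod_nat_bool (I : finType) (b : I -> bool) :
  \prod_(i : I) ((b i)%:R : R) = ([forall i, b i])%:R.
Proof.
case: (boolP [forall i, b i]) => [/forallP h|/forallPn[i bi]].
  by apply: big1 => i _; rewrite h.
by rewrite (bigD1 i)//= (negbTE bi) mul0r.
Qed.

Definition orthant (a : 'I_d -> R) : set 'rV[R]_d := [set v | [forall i, v ord0 i < a i]].

Lemma orthants_setI : setI_closed (range orthant).
Proof.
move=> _ _ [a _ <-] [b _ <-]; exists (fun i => Num.min (a i) (b i)) => //.
apply/seteqP; split => v /=.
  by move=> /forallP h; split; apply/forallP => i; have := h i; rewrite lt_min => /andP[].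
by move=> [/forallP h /forallP h']; apply/forallP => i; rewrite lt_min h h'.
Qed.

(** An open set is the union of the boxes that it contains, with rational centre
    and inverse integer radius; these are countably many. *)
Lemma random_element_coords {dsp : measure_display} {T : measurableType dsp}
    (X : T -> 'rV[R]_d) : (forall i, measurable_fun setT (fun w => X w ord0 i)) ->
  random_element X.
Proof.
move=> mX B; move: B; apply: smallest_sub.
  have := @sigma_algebra_image _ _ setT X _ (@sigma_algebra_measurable _ T).
  by rewrite /image_set_system; under eq_fun do rewrite setTI.
move=> O oO /=.
pose box (q : {ffun 'I_d -> rat} * nat) : set 'rV[R]_d :=
  [set v | forall i, `|v ord0 i - ratr (q.1 i)| < q.2.+1%:R^-1].
(* The boxes contained in [O], enumerated by the countable type of the pairs. *)
pose sel n := if unpickle n is Some q then (if `[< box q `<=` O >] then box q else set0) else set0.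
have OE : O = \bigcup_n sel n.
  apply/seteqP; split => [v Ov|v [n _]]; last first.
    by rewrite /sel; case: (unpickle n) => // q; case: asboolP => // h /h.
  have : nbhs v O by exact: open_nbhs_nbhs.
  move=> /nbhs_ballP[e /= e0 eO].
  set n := Num.truncn (2 / e).
  have ne : 2 / n.+1%:R < e.
    by rewrite ltr_pdivrMr// mulrC -ltr_pdivrMr// truncnS_gt.
  have n0 : (0 : R) < n.+1%:R^-1 by rewrite invr_gt0.
  have /choice[q qv] i : exists q : rat, `|v ord0 i - ratr q| < n.+1%:R^-1.
    have lt : v ord0 i - n.+1%:R^-1 < v ord0 i + n.+1%:R^-1.
      by rewrite ltrBlDr -addrA ltrDl addr_gt0.
    have [q] := rat_in_itvoo lt; rewrite in_itv /= => /andP[h1 h2]; exists q.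
    by rewrite ltr_distlC h1 h2.
  pose q' := ([ffun i => q i], n).
  exists (pickle q') => //; rewrite /sel pickleK.
  have vq : box q' v by move=> i; rewrite ffunE.
  case: asboolP => // -[]; move=> u uq; apply: eO; split=> // a i.
  have -> : a = ord0 by case: a => -[]// ?; exact: val_inj.
  rewrite -ball_normE /ball_ /=; apply: le_lt_trans ne.
  have := ler_normB (v ord0 i - ratr (q i)) (u ord0 i - ratr (q i)).
  rewrite opprB addrA subrK => h; have := uq i; have := qv i; rewrite ffunE /= => h1 h2.
  apply: (le_trans h); rewrite mulrDl mul1r; exact: ltW (ltrD h1 h2).
rewrite OE preimage_bigcup; apply: bigcupT_measurable => n.
rewrite /sel; case: (unpickle n) => [q|]; last by rewrite preimage_set0.
case: asboolP => _; last by rewrite preimage_set0.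
rewrite [X in measurable X](_ : _ = \bigcap_(i in [set: 'I_d])
   ((fun w => X w ord0 i) @^-1` [set x | `|x - ratr (q.1 i)| < q.2.+1%:R^-1])); last first.
  by apply/seteqP; split => [w h i _|w h i]; [exact: h|exact: h i I].
apply: fin_bigcap_measurable => // i _; rewrite -[X in measurable X]setTI; apply: mX => //.
rewrite (_ : [set _ | _] = `]ratr (q.1 i) - q.2.+1%:R^-1, ratr (q.1 i) + q.2.+1%:R^-1[%classic).
  exact: measurable_itv.
by apply/seteqP; split => x /=; rewrite in_itv /= distrC ltr_distlC.
Qed.

(** A half-space for one coordinate is the increasing union of the orthants with
    integer bounds on the other coordinates. *)
Lemma borel_orthants (B : set 'rV[R]_d) : @borel 'rV[R]_d B -> <<s range orthant >> B.
Proof.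
pose T := g_sigma_algebraType (range orthant).
have mi (i : 'I_d) : @measurable_fun _ _ T R setT (fun v : 'rV[R]_d => v ord0 i).
  apply: (measurability (@RGenInftyO.G R)); first exact: RGenInftyO.measurableE.
  move=> _ [_ [c ->] <-]; rewrite setTI.
  rewrite (_ : _ @^-1` _ = \bigcup_n orthant (fun l => if l == i then c else n%:R)).
    by apply: bigcupT_measurable => n; apply: sub_gen_smallest; eexists.
  apply/seteqP; split => v /=.
    rewrite in_itv /= => vc; exists (\max_(l < d) (Num.truncn (v ord0 l)).+1) => //.
    apply/forallP => l; case: eqVneq => [->//|_].
    apply: lt_le_trans (truncnS_gt _) _; rewrite ler_nat.
    exact: (leq_bigmax l).
  by move=> [n _ /forallP /(_ i)]; rewrite eqxx in_itv.
exact: (@random_element_coords _ T id mi B).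
Qed.

Lemma measurable_coord {dsp : measure_display} {O : measurableType dsp} (X : O -> 'rV[R]_d) i :
  random_element X -> measurable_fun setT (fun w => X w ord0 i).
Proof.
move=> rX; apply: (random_element_continuous (g := fun v : 'rV[R]_d => v ord0 i) rX).
exact: (@coord_continuous R 1 d ord0 i).
Qed.

Lemma measurable_preimage_orthant {dsp : measure_display} {O : measurableType dsp}
    (X : O -> 'rV[R]_d) a : random_element X -> measurable (X @^-1` orthant a).
Proof.
move=> rX; rewrite [X in measurable X](_ : _ =
    \bigcap_(i in [set: 'I_d]) ((fun w => X w ord0 i) @^-1` `]-oo, a i[%classic)).
  apply: fin_bigcap_measurable => // i _; rewrite -[X in measurable X]setTI.
  by apply: measurable_coord => //; exact: measurable_itv.
apply/seteqP; split => [w /forallP h i _|w h]; first by rewrite /= in_itv /= h.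
by apply/forallP => i; have := h i I; rewrite /= in_itv.
Qed.

Lemma trivIset_preimage {T U : Type} (f : T -> U) (F : nat -> set U) :
  trivIset setT F -> trivIset setT (fun n => f @^-1` F n).
Proof. by move=> tF i j _ _ [w [/= wi wj]]; apply: tF => //; exists (f w). Qed.

Lemma same_law_orthants {d1 d2 : measure_display} {O1 : measurableType d1} {O2 : measurableType d2}
    (P1 : probability O1 R) (P2 : probability O2 R) (X1 : O1 -> 'rV[R]_d) (X2 : O2 -> 'rV[R]_d) :
  random_element X1 -> random_element X2 ->
  (forall a, P1 (X1 @^-1` orthant a) = P2 (X2 @^-1` orthant a)) -> same_law P1 X1 P2 X2.
Proof.
move=> r1 r2 eqO B /borel_orthants GB.
pose T := g_sigma_algebraType (range orthant).
have mX (dO : measure_display) (O : measurableType dO) (X : O -> 'rV[R]_d) (C : set T) :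
    random_element X -> measurable C -> measurable (X @^-1` C).
  move=> rX mC; have mX : @measurable_fun _ _ O T setT X.
    apply: (@measurability _ _ O T setT X (range orthant)) => // _ [_ [a _ <-] <-].
    by rewrite setTI; exact: measurable_preimage_orthant.
  by have := mX measurableT C mC; rewrite setTI.
apply: (@dynkin_induction _ T (range orthant) (fun C => P1 (X1 @^-1` C) = P2 (X2 @^-1` C))) => //.
- exact: orthants_setI.
- by rewrite !preimage_setT !probability_setT.
- move=> _ [a _ <-]; exact: eqO.
- move=> C mC e; have m1 := mX _ _ X1 C r1 mC; have m2 := mX _ _ X2 C r2 mC.
  transitivity (1 - P1 (X1 @^-1` C))%E; first exact: (probability_setC P1 m1).
  transitivity (1 - P2 (X2 @^-1` C))%E; last exact: (esym (probability_setC P2 m2)).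
  by congr (1 - _)%E; exact: e.
- move=> C mC tC e.
  have m1 n : measurable (X1 @^-1` C n) := mX _ _ X1 (C n) r1 (mC n).
  have m2 n : measurable (X2 @^-1` C n) := mX _ _ X2 (C n) r2 (mC n).
  have t1 := trivIset_preimage (f := X1) tC; have t2 := trivIset_preimage (f := X2) tC.
  rewrite !preimage_bigcup.
  transitivity (\sum_(0 <= n <oo) P1 (X1 @^-1` C n))%E.
    by apply: measure_semi_bigcup => //; exact: bigcupT_measurable.
  transitivity (\sum_(0 <= n <oo) P2 (X2 @^-1` C n))%E.
    by apply: eq_eseriesr => n _; exact: e.
  by apply/esym; apply: measure_semi_bigcup => //; exact: bigcupT_measurable.
Qed.

Section CharacteristicFunction.
Context {d1 d2 : measure_display} {O1 : measurableType d1} {O2 : measurableType d2}.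
Variables (P1 : probability O1 R) (P2 : probability O2 R).
Variables (X1 : O1 -> 'rV[R]_d) (X2 : O2 -> 'rV[R]_d).
Hypotheses (r1 : random_element X1) (r2 : random_element X2).
Hypothesis eq_ch : forall lam, char_fun P1 X1 lam = char_fun P2 X2 lam.

Let trig_exp f : trig_poly f -> [/\ bounded_rv (f \o X1), bounded_rv (f \o X2) &
  \int[P1]_w f (X1 w) = \int[P2]_w f (X2 w)].
Proof.
elim=> [a b lam|f1 f2 _ [m1 m2 e] _ [m1' m2' e']]; last first.
  by split; [exact: bounded_rvD|exact: bounded_rvD|rewrite !expD// e e'].
have bc (dO : measure_display) (O : measurableType dO) (X : O -> 'rV[R]_d) (c : R) : random_element X ->
    bounded_rv (fun w => c * cos (inner lam (X w))).
  by move=> rX; apply: bounded_rvM; [exact: bounded_rv_cst|exact/bounded_rv_cos/measurable_inner].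
have bs (dO : measure_display) (O : measurableType dO) (X : O -> 'rV[R]_d) (c : R) : random_element X ->
    bounded_rv (fun w => c * sin (inner lam (X w))).
  by move=> rX; apply: bounded_rvM; [exact: bounded_rv_cst|exact/bounded_rv_sin/measurable_inner].
split; [by apply: bounded_rvD; [exact: bc|exact: bs]|by apply: bounded_rvD; [exact: bc|exact: bs]|].
have [ec es] := eq_ch lam.
rewrite !expD; [|exact: bc|exact: bs|exact: bc|exact: bs].
by rewrite !expZ ?ec ?es//; by [exact/bounded_rv_cos/measurable_inner|exact/bounded_rv_sin/measurable_inner].
Qed.

(** The expectations of trigonometric polynomials agree. Two bounded limits lead
    to the orthants: the products of cutoffs of the slopes of scale [L] tend to
    the indicator of the negativity of all the sines, which tends to the
    indicator of the orthant as [L] tends to infinity. *)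
Lemma char_fun_inj : same_law P1 X1 P2 X2.
Proof.
apply: same_law_orthants => // a.
pose g k n v : R := \prod_(i < d) cutoff n (slope k.+1%:R (a i) i v).
have tg k n : trig_poly (g k n) by apply: trig_prod => i; exact: trig_cutoff.
pose h k v := [forall i, slope k.+1%:R (a i) i v < 2^-1].
have g01 k n v : `|g k n v| <= 1.
  rewrite ger0_norm; last by apply: prodr_ge0 => i _; have /andP[] := cutoff_bounds n (slope01 k.+1%:R (a i) i v).
  by apply: prodr_ile1 => i _; exact: cutoff_bounds (slope01 _ _ _ _).
have gh k v : g k n v @[n --> \oo] --> ((h k v)%:R : R).
  rewrite /h -prod_nat_bool; apply: cvg_big => [|i _]; first exact: mul_continuous.
  exact: cvg_cutoff (slope01 _ _ _ _).
have slope_lt k (i : 'I_d) v : (slope k.+1%:R (a i) i v < 2^-1) = (sin ((v ord0 i - a i) / k.+1%:R) < 0).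
  by rewrite /slope; apply/idP/idP; lra.
have ho v : ((h k v)%:R : R) @[k --> \oo] --> (([forall i, v ord0 i < a i])%:R : R).
  rewrite /h -prod_nat_bool; under eq_fun do rewrite -prod_nat_bool.
  apply: cvg_big => [|i _]; first exact: mul_continuous.
  apply: cvg_near_cst; exists (Num.truncn `|v ord0 i - a i|) => // k /= kv; rewrite slope_lt.
  have vk : `|(v ord0 i - a i) / k.+1%:R| < 1.
    rewrite normrM normfV normr_nat ltr_pdivrMr// mul1r.
    by apply: lt_le_trans (truncnS_gt _) _; rewrite ler_nat.
  have pi1 : 1 < pi :> R by have := pi_ge2 R; lra.
  have -> : (v ord0 i < a i) = ((v ord0 i - a i) / k.+1%:R < 0).
    by rewrite ltr_pdivrMr// mul0r subr_lt0.
  move: vk; set y := _ / _; rewrite ltr_norml => /andP[y1 y2].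
  congr (_%:R); congr nat_of_bool; case: (ltgtP y 0) => y0.
  - by rewrite -oppr_gt0 -sinN sin_gt0_pi// oppr_gt0 y0/= ltrNl (lt_trans _ y1)// ltrN2.
  - apply/negbTE; rewrite -leNgt ltW// sin_gt0_pi// y0 (lt_trans y2)//.
  - by rewrite y0 sin0 ltxx.
have mh (dO : measure_display) (O : measurableType dO) (X : O -> 'rV[R]_d) k :
    random_element X -> measurable_fun setT (fun w => (h k (X w))%:R : R).
  move=> rX; apply: measurable_fun_natb; apply: measurable_forall => i.
  apply: measurable_fun_ltr => //; apply: measurable_funM => //; apply: measurable_funD => //.
  apply: (measurableT_comp sin_measurable); apply: measurable_funM => //.
  by apply: measurable_funB => //; exact: measurable_coord.
have mo (dO : measure_display) (O : measurableType dO) (X : O -> 'rV[R]_d) :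
    random_element X -> measurable_fun setT (fun w => ([forall i, X w ord0 i < a i])%:R : R).
  move=> rX; apply: measurable_fun_natb; apply: measurable_forall => i.
  by apply: measurable_fun_ltr => //; exact: measurable_coord.
have b1 (b : bool) : `|b%:R : R| <= 1 by case: b; rewrite ?normr1 ?normr0.
have eqh k : \int[P1]_w ((h k (X1 w))%:R : R) = \int[P2]_w ((h k (X2 w))%:R : R).
  have c1 : \int[P1]_w g k n (X1 w) @[n --> \oo] --> \int[P1]_w ((h k (X1 w))%:R : R).
    apply: (exp_cvg _ (mh _ _ _ k r1) (fun n w => g01 k n (X1 w))).
      by move=> n; have [[]] := trig_exp (tg k n).
    by apply: nearW => w; exact: gh.
  have c2 : \int[P2]_w g k n (X2 w) @[n --> \oo] --> \int[P2]_w ((h k (X2 w))%:R : R).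
    apply: (exp_cvg _ (mh _ _ _ k r2) (fun n w => g01 k n (X2 w))).
      by move=> n; have [_ []] := trig_exp (tg k n).
    by apply: nearW => w; exact: gh.
  rewrite -(cvg_lim (@Rhausdorff R) c1) -(cvg_lim (@Rhausdorff R) c2).
  by congr (limn _); apply/funext => n; have [] := trig_exp (tg k n).
have eqo : \int[P1]_w (([forall i, X1 w ord0 i < a i])%:R : R) =
    \int[P2]_w (([forall i, X2 w ord0 i < a i])%:R : R).
  have c1 : \int[P1]_w ((h k (X1 w))%:R : R) @[k --> \oo] -->
      \int[P1]_w (([forall i, X1 w ord0 i < a i])%:R : R).
    apply: (exp_cvg (fun k => mh _ _ _ k r1) (mo _ _ _ r1) (fun k w => b1 _)).
    by apply: nearW => w; exact: ho.
  have c2 : \int[P2]_w ((h k (X2 w))%:R : R) @[k --> \oo] -->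
      \int[P2]_w (([forall i, X2 w ord0 i < a i])%:R : R).
    apply: (exp_cvg (fun k => mh _ _ _ k r2) (mo _ _ _ r2) (fun k w => b1 _)).
    by apply: nearW => w; exact: ho.
  rewrite -(cvg_lim (@Rhausdorff R) c1) -(cvg_lim (@Rhausdorff R) c2).
  by congr (limn _); apply/funext => n.
have probE (dO : measure_display) (O : measurableType dO) (P : probability O R) (X : O -> 'rV[R]_d) :
    random_element X -> P (X @^-1` orthant a) = (\int[P]_w (([forall i, X w ord0 i < a i])%:R : R))%:E.
  move=> rX; have mA := measurable_preimage_orthant a rX.
  rewrite expE; last by split; [exact: mo|exists 1 => w; exact: b1].
  have := integral_indic P measurableT mA; rewrite setIT => <-.
  apply: eq_integral => w _; rewrite indicE; congr (_%:R%:E).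
  congr nat_of_bool; apply/idP/idP; first by move=> /set_mem.
  by move=> hw; apply/mem_set; exact: hw.
by rewrite (probE _ _ P1 _ r1) (probE _ _ P2 _ r2) eqo.
Qed.

End CharacteristicFunction.
End Uniqueness.

(** * Stability and the scaling of the exponent *)

Lemma same_law_char_fun {R : realType} {d : nat} {d1 d2 : measure_display}
    {O1 : measurableType d1} {O2 : measurableType d2}
    (P1 : probability O1 R) (P2 : probability O2 R) (X1 : O1 -> 'rV[R]_d) (X2 : O2 -> 'rV[R]_d) lam :
  random_element X1 -> random_element X2 -> same_law P1 X1 P2 X2 ->
  char_fun P1 X1 lam = char_fun P2 X2 lam.
Proof.
move=> r1 r2 law.
suff E (g : R -> R) : continuous g -> (forall x, `|g x| <= 1) ->
    \int[P1]_w g (inner lam (X1 w)) = \int[P2]_w g (inner lam (X2 w)).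
  rewrite /char_fun; congr (_ +i* _).
    by apply: E => [|x]; [exact: continuous_cos|rewrite ler_norml cos_geN1 cos_le1].
  by apply: E => [|x]; [exact: continuous_sin|rewrite ler_norml sin_geN1 sin_le1].
move=> gc g1; have mg : measurable_fun setT g by exact: continuous_measurable_fun.
have m1 := measurable_inner lam r1; have m2 := measurable_inner lam r2.
pose Z1 : {mfun O1 >-> R} := HB.pack (fun w => inner lam (X1 w)) (isMeasurableFun.Build _ _ _ _ _ m1).
pose Z2 : {mfun O2 >-> R} := HB.pack (fun w => inner lam (X2 w)) (isMeasurableFun.Build _ _ _ _ _ m2).
have g0 x : (0 <= (g x + 1)%:E)%E by rewrite lee_fin; have := g1 x; rewrite ler_norml; lra.
have mg1 : measurable_fun setT (fun x => (g x + 1)%:E).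
  by apply/measurable_EFinP; exact: measurable_funD.
have e1 := ge0_integral_distribution (Z1 : {RV P1 >-> R}) mg1 (fun x => g0 x).
have e2 := ge0_integral_distribution (Z2 : {RV P2 >-> R}) mg1 (fun x => g0 x).
have : (\int[P1]_w (g (Z1 w) + 1)%:E = \int[P2]_w (g (Z2 w) + 1)%:E)%E.
  rewrite -e1 -e2; apply: eq_measure_integral => A mA _.
  apply: (law (inner lam @^-1` A)).
  by apply: borel_preimage_continuous => //; exact: continuous_inner.
have b1 : bounded_rv (fun w => g (Z1 w)) by split; [exact: (measurableT_comp mg m1)|exists 1 => w].
have b2 : bounded_rv (fun w => g (Z2 w)) by split; [exact: (measurableT_comp mg m2)|exists 1 => w].
rewrite -!expE; try by apply: bounded_rvD => //; exact: bounded_rv_cst.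
rewrite !expD//; try exact: bounded_rv_cst.
by rewrite !exp_cst => -[] /addIr.
Qed.

Section Stability.
Context {R : realType} {d : nat} {dsp : measure_display} {Om : measurableType dsp}.
Variables (P : probability Om R) (y : R -> Om -> 'rV[R]_d) (eta : 'rV[R]_d -> R[i]) (alpha : R).
Hypotheses (levy : levy_process P y) (expo : levy_exponent P eta y) (stable : stable_process P alpha y).

Let increment (i : nat) w := y i.+1%:R w - y i%:R w.

Let ry (i : nat) : random_element (y i%:R).
Proof. exact: (levy_random levy (ler0n _ i)). Qed.

Let rB (X Z : Om -> 'rV[R]_d) : random_element X -> random_element Z ->
  random_element (fun w => X w - Z w).
Proof.
move=> rX rZ; apply: random_element_coords => i.
under eq_fun do rewrite !mxE.
by apply: measurable_funB; exact: measurable_coord.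
Qed.

Let char_increment (i j : nat) lam : (i <= j)%N ->
  char_fun P (fun w => y j%:R w - y i%:R w) lam = cexp ((j%:R - i%:R)%:C * eta lam).
Proof. by move=> ij; apply: expo => //; rewrite ler_nat. Qed.

Let char_y1 lam : char_fun P (y 1) lam = cexp (eta lam).
Proof.
have := char_increment lam (leq0n 1); rewrite subr0 mul1r => <-.
have i0 : {ae P, forall w, inner lam (y 1 w) = inner lam (y 1 w - y 0%:R w)}.
  by apply: filterS (levy_start levy) => w ->; rewrite subr0.
have m1 : measurable_fun setT (fun w => inner lam (y 1 w)) := measurable_inner lam (ry 1).
have m2 := measurable_inner lam (rB (ry 1) (ry 0)).
by rewrite /char_fun; congr (_ +i* _); apply: exp_ae; try by
  [exact: (measurableT_comp cos_measurable m1)|exact: (measurableT_comp cos_measurable m2)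
  |exact: (measurableT_comp sin_measurable m1)|exact: (measurableT_comp sin_measurable m2)
  |apply: filterS i0 => w ->].
Qed.

(** A consequence of the exponent, by uniqueness of characteristic functions. *)
Let increment_law (i : nat) : same_law P (increment i) P (y 1).
Proof.
apply: char_fun_inj => [||lam]; [exact: rB|exact: (ry 1)|].
by rewrite char_increment// char_y1 -natrB// subSnn mul1r.
Qed.

Let increments_independent n :
  independent_family P (fun i : 'I_n => sigma_of (@borel 'rV[R]_d) (increment i)).
Proof.
case: n => [|n] s A us sA.
  case: s us sA => [|[]//] _ _; rewrite big_nil.
  by rewrite (_ : \bigcap_(_ in _) _ = setT) ?probability_setT//; apply/seteqP; split.
have h := levy_independent levy (t := fun i => i%:R) (lexx 0) _.
have {}h := h (fun n => _) (map val s) (fun i => A (inord i)) _ _.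
rewrite big_map in h; under [RHS]eq_bigr do rewrite -[X in A X]inord_val.
rewrite -h.
- by congr (P _); apply/seteqP; split => [w sw _ /mapP[i is_ ->]|w sw i is_]; rewrite ?inord_val;
   [exact: sw|have := sw (val i) (map_f val is_); rewrite inord_val].
- by move=> k; rewrite ler_nat.
- by rewrite map_inj_uniq//; exact: val_inj.
- by move=> _ /mapP[i is_ ->]; rewrite inord_val; exact: sA.
Qed.

(** The sum of [n] unit increments, which are independent copies of [y 1], is on
    one hand [y n - y 0] and on the other distributed as a dilation of [y 1] up
    to a translation. Taking the modulus of the characteristic functions removes
    the translation. *)
Lemma stable_exponent n lam : (0 < n)%N ->
  complex.Re (eta (n%:R `^ alpha^-1 *: lam)) = n%:R * complex.Re (eta lam).
Proof.
move=> n0; have [D hD] := stable ler01.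
have law := hD n n0 _ _ P (fun i => increment i) (fun i => rB (ry i.+1) (ry i))
  (fun i => increment_law i) (@increments_independent n).
set c := _ `^ _.
have rS : random_element (fun w => \sum_(i < n) increment i w).
  apply: random_element_coords => i; under eq_fun do rewrite summxE.
  apply: measurable_sum => l; have := measurable_coord i (rB (ry l.+1) (ry l)); exact.
have rU : random_element (fun w => c *: y 1 w + D n).
  apply: random_element_coords => i; under eq_fun do rewrite !mxE.
  by apply: measurable_funD => //; apply: measurable_funM => //; exact: measurable_coord (ry 1).
have := same_law_char_fun lam rS rU law.
have -> : char_fun P (fun w => \sum_(i < n) increment i w) lam = cexp (n%:R%:C * eta lam).
  have := char_increment lam (leq0n n); rewrite subr0 => <-; congr char_fun; apply/funext => w.
  by rewrite -(big_mkord xpredT (fun i => increment i w)) telescope_sumr.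
move=> /(congr1 (fun z => z * z^*%C)); rewrite cexp_norm Re_scale.
have -> : char_fun P (fun w => c *: y 1 w + D n) lam * (char_fun P (fun w => c *: y 1 w + D n) lam)^*%C =
    char_fun P (y 1) (c *: lam) * (char_fun P (y 1) (c *: lam))^*%C.
  pose a := \int[P]_w cos (inner (c *: lam) (y 1 w)); pose b := \int[P]_w sin (inner (c *: lam) (y 1 w)).
  pose dl := inner lam (D n).
  have mi : measurable_fun setT (fun w => inner (c *: lam) (y 1 w)) := measurable_inner _ (ry 1).
  have E w : inner lam (c *: y 1 w + D n) = inner (c *: lam) (y 1 w) + dl.
    by rewrite innerDr innerZr innerZl.
  have bc := bounded_rv_cos mi; have bs := bounded_rv_sin mi.
  have ca : \int[P]_w cos (inner lam (c *: y 1 w + D n)) = cos dl * a - sin dl * b.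
    under eq_Rintegral do rewrite E cosD mulrC [sin _ * _]mulrC.
    by rewrite expB ?expZ//; apply: bounded_rvM => //; exact: bounded_rv_cst.
  have sa : \int[P]_w sin (inner lam (c *: y 1 w + D n)) = cos dl * b + sin dl * a.
    under eq_Rintegral do rewrite E sinD mulrC [cos _ * _]mulrC.
    by rewrite expD ?expZ//; apply: bounded_rvM => //; exact: bounded_rv_cst.
  rewrite /char_fun ca sa -/a -/b; simpc; congr (_ +i* _); last by ring.
  transitivity ((cos dl ^+ 2 + sin dl ^+ 2) * (a * a + b * b)); first by ring.
  by rewrite cos2Dsin2 mul1r.
rewrite char_y1 cexp_norm => -[] /expR_inj; lra.
Qed.

End Stability.

(** This is [beta / (theta + beta)] with both terms multiplied by
    [(N - 1) / 2]. *)
Lemma limit_char_fun {R : realType} {N d : nat} {eta : 'rV[R]_d -> R[i]} {m : R}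
    (hN : (2 <= N)%N) (hm : 0 < m) (S : sync_model N eta (exponential_df m))
    (j k : 'I_N) (hjk : j != k) {disp : measure_display} {Omega : measurableType disp}
    (Q : probability Omega R) (D : Omega -> 'rV[R]_d)
    (hlim : converges_in_law (sm_P S) (sm_diff S j k) Q D) lam :
  char_fun Q D lam =
    (m^-1 / (m^-1 - N.-1%:R * complex.Re (eta lam)))%:C.
Proof.
have n0 : N.-1%:R != 0 :> R by rewrite pnatr_eq0; case: (N) hN => [|[]].
have cc := @continuous_inner R d lam.
have ccos : continuous (fun v : 'rV[R]_d => cos (inner lam v)).
  by move=> v; apply: continuous_comp; [exact: cc|exact: continuous_cos].
have csin : continuous (fun v : 'rV[R]_d => sin (inner lam v)).
  by move=> v; apply: continuous_comp; [exact: cc|exact: continuous_sin].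
have bcos : exists M : R, forall v : 'rV[R]_d, `|cos (inner lam v)| <= M.
  by exists 1 => v; rewrite ler_norml cos_geN1 cos_le1.
have bsin : exists M : R, forall v : 'rV[R]_d, `|sin (inner lam v)| <= M.
  by exists 1 => v; rewrite ler_norml sin_geN1 sin_le1.
rewrite /char_fun (limit_cos hN hm hjk (hlim _ ccos bcos)) (limit_sin hN hm hjk (hlim _ csin bsin)).
congr (_%:C); set r := complex.Re _.
have e2 : 2 / N.-1%:R != 0 :> R by rewrite mulf_neq0 ?invr_eq0.
have m0 : m != 0 by rewrite gt_eqF.
rewrite -[RHS]mulr1 -(divff e2) mulf_div.
by congr (_ / _); field; rewrite ?m0 ?n0.
Qed.

Section Scaling.
Context {R : realType} {d : nat} {disp0 : measure_display} {Omega0 : measurableType disp0}.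
Context {P0 : probability Omega0 R} {y : R -> Omega0 -> 'rV[R]_d} {alpha m : R}.
Context {eta : 'rV[R]_d -> R[i]}.
Hypotheses (hy_levy : levy_process P0 y) (hy_eta : levy_exponent P0 eta y)
  (hy_stable : stable_process P0 alpha y) (hm : 0 < m).

(** The rescaling divides [Re (eta lam)] by [N - 1], by stability. *)
Lemma scaled_limit_char_fun {N : nat} (hN : (2 <= N)%N) (S : sync_model N eta (exponential_df m))
    (j k : 'I_N) (hjk : j != k) {disp : measure_display} {Omega : measurableType disp}
    (Q : probability Omega R) (D : Omega -> 'rV[R]_d)
    (hlim : converges_in_law (sm_P S) (sm_diff S j k) Q D) lam :
  char_fun Q (fun w => (N.-1%:R `^ alpha^-1)^-1 *: D w) lam =
    (m^-1 / (m^-1 - complex.Re (eta lam)))%:C.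
Proof.
have n0 : (0 < N.-1)%N by case: (N) hN => [|[]].
set c := _ `^ _; have c0 : c != 0 by rewrite gt_eqF// powR_gt0// ltr0n.
transitivity (char_fun Q D (c^-1 *: lam)).
  by rewrite /char_fun; congr (_ +i* _); apply: eq_Rintegral => w _; rewrite innerZr innerZl.
rewrite (limit_char_fun hN hm hjk hlim).
by rewrite -(stable_exponent hy_levy hy_eta hy_stable _ n0) -/c scalerA divff// scale1r.
Qed.

Lemma scaled_random_element {disp : measure_display} {Omega : measurableType disp}
    (D : Omega -> 'rV[R]_d) c : random_element D -> random_element (fun w => c *: D w).
Proof.
move=> rD; apply: random_element_coords => i; under eq_fun do rewrite mxE.
by apply: measurable_funM => //; exact: measurable_coord.
Qed.

End Scaling.

Theorem theorem5 (R : realType) (d : nat) (hd : (1 <= d)%N)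
    (m : R) (hm : 0 < m) (alpha : R) (halpha0 : 0 < alpha) (halpha2 : alpha <= 2)
    (eta : 'rV[R]_d -> R[i])
    (* eta is the exponent of an alpha-stable Levy process y *)
    (disp0 : measure_display) (Omega0 : measurableType disp0)
    (P0 : probability Omega0 R) (y : R -> Omega0 -> 'rV[R]_d)
    (hy_levy : levy_process P0 y)
    (hy_eta : levy_exponent P0 eta y)
    (hy_stable : stable_process P0 alpha y)
    (* the model with N components and its limit D *)
    (N : nat) (hN : (2 <= N)%N)
    (S : sync_model N eta (exponential_df m))
    (j k : 'I_N) (hjk : j != k)
    (disp : measure_display) (Omega : measurableType disp)
    (Q : probability Omega R) (D : Omega -> 'rV[R]_d)
    (hD : random_element (E := 'rV[R]_d) D)
    (hlim : converges_in_law (E := 'rV[R]_d) (sm_P S) (sm_diff S j k) Q D)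
    (* the model with N' components and its limit D' *)
    (N' : nat) (hN' : (2 <= N')%N)
    (S' : sync_model N' eta (exponential_df m))
    (j' k' : 'I_N') (hjk' : j' != k')
    (disp' : measure_display) (Omega' : measurableType disp')
    (Q' : probability Omega' R) (D' : Omega' -> 'rV[R]_d)
    (hD' : random_element (E := 'rV[R]_d) D')
    (hlim' : converges_in_law (E := 'rV[R]_d) (sm_P S') (sm_diff S' j' k') Q' D') :
  same_law (E := 'rV[R]_d) Q (fun w => (N.-1%:R `^ alpha^-1)^-1 *: D w)
           Q' (fun w => (N'.-1%:R `^ alpha^-1)^-1 *: D' w).
Proof.
apply: char_fun_inj => [||lam]; [exact: scaled_random_element|exact: scaled_random_element|].
rewrite (scaled_limit_char_fun hy_levy hy_eta hy_stable hm hN hjk hlim).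
by rewrite (scaled_limit_char_fun hy_levy hy_eta hy_stable hm hN' hjk' hlim').
Qed.
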